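(* Let $\{a_n\}_{n\in\mathbb{Z}}$ be a sequence of complex numbers with at most polynomial growth and let $\gamma>0$. Assume that for every $\varepsilon>0$ $$\sum_{0\le n\le N} a_n e(nx)=O_\varepsilon\big(N^{\gamma+\varepsilon}\big)\quad\text{and}\quad \sum_{-N\le n\le 0} a_n e(nx)=O_\varepsilon\big(N^{\gamma+\varepsilon}\big)$$ hold uniformly in $x\in\mathbb{R}$. Let $\alpha>\gamma$ be such that the series $$f_\alpha(x)=\sum_{n\neq 0}\frac{a_n}{|n|^\alpha}e(nx)$$ converges absolutely, and for $z=x+iy$ with $y>0$ put $$f(z)=\sum_{n=-\infty}^{\infty}a_n e(nx)e^{-2\pi|n|y}.$$ If $x_0\in\mathbb{R}$ is such that $f(x_0+iy)\neq o(y^{-\gamma})$ as $y\to0^+$, then the Hölder exponents of the function $f_\alpha$ at $x_0$ satisfy $$\beta(x_0)=\beta^{*}(x_0)=\beta^{**}(x_0)=\alpha-\gamma.$$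
   Context: Notation: $e(x)=e^{2\pi i x}$. Hölder exponents of a continuous function $g:\mathbb{R}\to\mathbb{C}$ at $x_0\in\mathbb{R}$: (1) For $s\ge 0$, $C^s(x_0)$ is the set of continuous functions $g:\mathbb{R}\to\mathbb{C}$ for which there is a polynomial $P$ of degree at most $s$ with $|g(x)-P(x-x_0)|=O(|x-x_0|^s)$ as $x\to x_0$. The pointwise Hölder exponent is $\beta(x_0)=\sup\{s\ge0: g\in C^s(x_0)\}$. (2) For $0<s\le1$, $\Lambda^s(x_0)$ is the set of continuous functions $h$ (defined near $x_0$) with $|h(x)-h(x_0)|=O(|x-x_0|^s)$ as $x\to x_0$. For an integer $k\ge0$ and $0<s\le1$, $C^{k,s}(x_0)$ is the set of continuous functions $g:\mathbb{R}\to\mathbb{C}$ such that $g^{(k)}$ exists and is continuous in an open interval containing $x_0$ and $g^{(k)}\in\Lambda^s(x_0)$. The restricted local Hölder exponent is $\beta^*(x_0)=\sup\{k+s: g\in C^{k,s}(x_0),\ k\ge0,\ 0<s\le1\}$. (3) For an open set $\mathcal{U}\subset\mathbb{R}$, an integer $k\ge0$ and $0<s\le 1$, $C^{k,s}(\mathcal{U})$ is the set of $k$-times differentiable functions with $|g^{(k)}(x)-g^{(k)}(y)|=O(|x-y|^s)$ for all $x,y\in\mathcal{U}$; $C^{k,0}(\mathcal{U})$ is the set of functions with $k$ continuous derivatives on $\mathcal{U}$. The local Hölder exponent is $\beta^{**}(x_0)=\lim_{n\to\infty}\sup\{k+s: g\in C^{k,s}(I_n),\ k\ge0,\ 0\le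 s\le1\}$, where $I_1\supset I_2\supset\cdots$ are nested open intervals with $\bigcap I_n=\{x_0\}$ (the value does not depend on the choice of the intervals). *)

(* Defs.v *)
From Stdlib Require Import Reals ZArith.
From Coquelicot Require Import Coquelicot.

Open Scope R_scope.

(** * Exponential sums and series over the integers *)

(* [exp (2 i PI x)]; the library has no complex exponential. *)
Definition e (x : R) : C := (cos (2 * PI * x), sin (2 * PI * x)).

Definition CSeries (u : nat -> C) : C :=
  (Series (fun n => Re (u n)), Series (fun n => Im (u n))).

(* The sums over [n >= 0] and over [n <= -1] are taken separately; for an
   absolutely convergent series this agrees with every other order. *)
Definition ZSeries (c : Z -> C) : C :=
  Cplus (CSeries (fun n => c (Z.of_nat n)))
        (CSeries (fun n => c (- Z.of_nat (S n))%Z)).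

Definition ZSeries_abs_cv (c : Z -> C) : Prop :=
  ex_series (fun n => Cmod (c (Z.of_nat n))) /\
  ex_series (fun n => Cmod (c (- Z.of_nat (S n))%Z)).

Definition polynomial_growth (a : Z -> C) : Prop :=
  exists (K : nat) (M : R),
    forall n : Z, Cmod (a n) <= M * (1 + Rabs (IZR n)) ^ K.

Definition partial_sum_pos (a : Z -> C) (x : R) (N : nat) : C :=
  sum_n (fun n => Cmult (a (Z.of_nat n)) (e (IZR (Z.of_nat n) * x))) N.

Definition partial_sum_neg (a : Z -> C) (x : R) (N : nat) : C :=
  sum_n (fun n => Cmult (a (- Z.of_nat n)%Z)
                        (e (IZR (- Z.of_nat n) * x))) N.

(* [S x N = O(N ^ t)] uniformly in [x]; [N = 0] is left out because [0 ^ t]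
   vanishes for [t > 0] whereas [Rpower 0 t = 1]. *)
Definition unif_bigO_power (S : R -> nat -> C) (t : R) : Prop :=
  exists M : R, forall (x : R) (N : nat), (1 <= N)%nat ->
    Cmod (S x N) <= M * Rpower (INR N) t.

Definition f_alpha_term (a : Z -> C) (alpha x : R) (n : Z) : C :=
  if Z.eq_dec n 0 then RtoC 0
  else Cmult (Cdiv (a n) (RtoC (Rpower (Rabs (IZR n)) alpha))) (e (IZR n * x)).

Definition f_alpha (a : Z -> C) (alpha : R) (x : R) : C :=
  ZSeries (f_alpha_term a alpha x).

Definition f_ext (a : Z -> C) (z : C) : C :=
  ZSeries (fun n => Cmult (Cmult (a n) (e (IZR n * Re z)))
                          (RtoC (exp (- 2 * PI * Rabs (IZR n) * Im z)))).

(** * Hölder exponents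

   [Rpower 0 s = 1], so every bound by a power [|x - y| ^ s] is required for
   [x <> y] only; [locally'] is the punctured neighbourhood filter.  Suprema
   are taken in [Rbar], where the supremum of the empty set is [m_infty]. *)

Definition bigO_power_at (h : R -> C) (s x0 : R) : Prop :=
  exists M : R,
    locally' x0 (fun x => Cmod (h x) <= M * Rpower (Rabs (x - x0)) s).

Definition C_pointwise (s x0 : R) (g : R -> C) : Prop :=
  (forall x, continuous g x) /\
  exists (d : nat) (p : nat -> C), INR d <= s /\
    bigO_power_at
      (fun x => Cminus (g x)
                  (sum_n (fun j => Cmult (p j) (Cpow (RtoC (x - x0)) j)) d))
      s x0.

Definition holder_exponent (g : R -> C) (x0 : R) : Rbar :=
  Lub_Rbar (fun s => 0 <= s /\ C_pointwise s x0 g).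

(* [D j] is the [j]-th derivative of [g] on the open set [U], for [j <= k]. *)
Definition derivatives_on (U : R -> Prop) (g : R -> C) (k : nat)
    (D : nat -> R -> C) : Prop :=
  (forall x, U x -> D 0%nat x = g x) /\
  (forall j, (j < k)%nat -> forall x, U x ->
     @is_derive R_AbsRing C_R_NormedModule (D j) x (D (S j) x)).

Definition C_restricted (k : nat) (s x0 : R) (g : R -> C) : Prop :=
  (forall x, continuous g x) /\
  exists (l r : R) (D : nat -> R -> C), l < x0 < r /\
    derivatives_on (fun x => l < x < r) g k D /\
    (forall x, l < x < r -> continuous (D k) x) /\
    bigO_power_at (fun x => Cminus (D k x) (D k x0)) s x0.

Definition restricted_holder_exponent (g : R -> C) (x0 : R) : Rbar :=
  Lub_Rbar (fun t => exists (k : nat) (s : R),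
    0 < s <= 1 /\ C_restricted k s x0 g /\ t = INR k + s).

Definition C_on (k : nat) (s : R) (U : R -> Prop) (g : R -> C) : Prop :=
  exists D : nat -> R -> C, derivatives_on U g k D /\
    ((s = 0 /\ forall x, U x -> continuous (D k) x) \/
     (0 < s /\ exists M : R, forall x y, U x -> U y -> x <> y ->
        Cmod (Cminus (D k x) (D k y)) <= M * Rpower (Rabs (x - y)) s)).

Definition holder_exponent_on (U : R -> Prop) (g : R -> C) : Rbar :=
  Lub_Rbar (fun t => exists (k : nat) (s : R),
    0 <= s <= 1 /\ C_on k s U g /\ t = INR k + s).

Definition Rbar_interval (l r : Rbar) (x : R) : Prop :=
  Rbar_lt l x /\ Rbar_lt x r.

Definition nested_intervals_to (I : nat -> R -> Prop) (x0 : R) : Prop :=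
  (forall n, exists l r : Rbar, forall x, I n x <-> Rbar_interval l r x) /\
  (forall n x, I (S n) x -> I n x) /\
  (forall x, (forall n, I n x) <-> x = x0).

(* Convergence in the order topology of [Rbar]; the library's [is_lim_seq]
   only handles real-valued sequences. *)
Definition is_Rbar_lim_seq (u : nat -> Rbar) (L : Rbar) : Prop :=
  (forall r : Rbar, Rbar_lt r L -> eventually (fun n => Rbar_lt r (u n))) /\
  (forall r : Rbar, Rbar_lt L r -> eventually (fun n => Rbar_lt (u n) r)).

(* The limit does not depend on the intervals, so it is required to be [L]
   along every admissible sequence of intervals. *)
Definition is_local_holder_exponent (g : R -> C) (x0 : R) (L : Rbar) : Prop :=
  forall I : nat -> R -> Prop, nested_intervals_to I x0 ->
    is_Rbar_lim_seq (fun n => holder_exponent_on (I n) g) L.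

(* Main.v *)
Require Import Defs.
From Stdlib Require Import Reals ZArith Lra Lia Ranalysis5 FunctionalExtensionality.
From Coquelicot Require Import Coquelicot.

Open Scope R_scope.

(** The three exponents are ordered: Hölder continuity of the [k]-th derivative
    on an interval around [x0] gives it at the point [x0], and Taylor's formula
    turns that into approximation by a polynomial.  It therefore suffices to
    bound the local exponent from below and the pointwise exponent from above.

    Lower bound.  Differentiating [k] times replaces the weights [|n|^(-alpha)]
    by [|n|^(k - alpha)], up to a constant.  Summation by parts against the
    bound [O(N^(gamma + eps))] on the exponential sums shows that the
    differentiated series converge uniformly for [k < alpha - gamma].  For the
    Hölder condition consider the coefficients [a_n (e(nx) - e(ny))]: their
    partial sums are [O(N^(gamma + eps))], and by the mean value inequality also
    [O(N^(gamma + eps) N |x - y|)], hence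
    [O(N^(gamma + eps + theta) |x - y|^theta)].  A second summation by parts
    gives [|x - y|^theta] as long as [k + theta < alpha - gamma], uniformly in
    [x] and [y].  The two parts of the series, over [n > 0] and [n < 0], are
    treated separately throughout ([Abel_power_weight], [deriv_series_derive],
    [deriv_series_holder]).

    Upper bound.  Write [f_alpha (x0 + t) = sum b_n e(nt)] and suppose that it
    is a polynomial in [t] up to [O(|t|^s)], where one may take
    [alpha - gamma < s < alpha].  The part of [f (x0 + iy)] with [n > 0] is
    [sum n^alpha e^(-2 pi n y) b_n], the integral over a period of
    [f_alpha (x0 + t)] against the kernel [sum n^alpha e^(-2 pi n y) e(-nt)].
    Two facts make this integral small.
    - The kernel is [O((y + |t|)^(-alpha - 1))]: it is [sum n^alpha w^n] with
      [|1 - w|] comparable to [y + |t|], and iterated summation by parts gives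
      [|sum n^alpha w^n| = O(|1 - w|^(-alpha - 1))] in the unit disc
      ([pow_kernel_bound], [dist_to_one]).
    - A polynomial in [t] is a trigonometric polynomial up to [O(|t|^s)], because
      [2 i pi t = log (1 + (e(t) - 1))] ([trig_approx_poly]).  A trigonometric
      polynomial meets only finitely many frequencies of the kernel, so its
      integral against the kernel is bounded as [y] tends to [0]
      ([trig_pairing]).
    The remainder contributes the integral of [|t|^s (y + |t|)^(-alpha - 1)],
    which is [O(y^(s - alpha))] ([poisson_mean_bound]).  The part with [n < 0]
    is the same for [t -> f_alpha (x0 - t)].  Hence [f (x0 + iy)] is
    [O(y^(s - alpha))], which is [o(y^(- gamma))], against the hypothesis. *)

(** * Complex numbers and finite sums *)

(** The canonical structures type an equation between complex numbers in
    various carriers convertible to [C]; [ring] only knows [C]. *)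
Ltac Cring := match goal with |- @eq _ ?a ?b => change (@eq C a b) end; ring.

Notation derivC := (@is_derive R_AbsRing C_R_NormedModule).

Notation RIntC := (@is_RInt C_R_NormedModule).

Lemma Im_le_Cmod (z : C) : Rabs (Im z) <= Cmod z.
Proof. generalize (Rmax_Cmod z). generalize (Rmax_r (Rabs (fst z)) (Rabs (snd z))). unfold Im; lra. Qed.

Lemma Cmod_le_Re_Im (z : C) : Cmod z <= Rabs (Re z) + Rabs (Im z).
Proof.
  destruct z as [x y]; simpl.
  replace ((x, y) : C) with (RtoC x + Ci * RtoC y)%C.
  - eapply Rle_trans; [apply Cmod_triangle|].
    rewrite Cmod_mult, !Cmod_R.
    replace (Cmod Ci) with 1; [lra|].
    unfold Cmod, Ci; simpl. replace (0 * (0 * 1) + 1 * (1 * 1)) with 1 by ring.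
    now rewrite sqrt_1.
  - unfold RtoC, Ci, Cplus, Cmult; simpl. f_equal; ring.
Qed.

Lemma norm_Cmod (z : C) : @norm R_AbsRing C_R_NormedModule z = Cmod z.
Proof.
  destruct z as [x y]. change (sqrt (Rabs x ^ 2 + Rabs y ^ 2) = Cmod (x, y)).
  unfold Cmod; simpl. f_equal. rewrite !Rmult_1_r, <- !Rabs_mult.
  rewrite (Rabs_pos_eq (x*x)), (Rabs_pos_eq (y*y)); nra.
Qed.

Lemma Cmod_minus_sym (z w : C) : Cmod (z - w) = Cmod (w - z).
Proof. rewrite <- (Cmod_opp (z - w)). f_equal. ring. Qed.

Lemma Cmod_minus_triangle (z w : C) : Cmod (z - w) <= Cmod z + Cmod w.
Proof. unfold Cminus. rewrite <- (Cmod_opp w). apply Cmod_triangle. Qed.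

Lemma Cmod_scale (r : R) (z : C) : 0 <= r -> Cmod (RtoC r * z) = r * Cmod z.
Proof. intros. now rewrite Cmod_mult, Cmod_R, Rabs_pos_eq. Qed.

Lemma sum_n_Re (u : nat -> C) N : Re (sum_n u N) = sum_n (fun n => Re (u n)) N.
Proof.
  induction N; [now rewrite !sum_O|]. rewrite !sum_Sn, <- IHN. reflexivity.
Qed.

Lemma sum_n_Im (u : nat -> C) N : Im (sum_n u N) = sum_n (fun n => Im (u n)) N.
Proof.
  induction N; [now rewrite !sum_O|]. rewrite !sum_Sn, <- IHN. reflexivity.
Qed.

Lemma sum_n_S_C (u : nat -> C) N : sum_n u (S N) = (sum_n u N + u (S N))%C :> C.
Proof. now rewrite sum_Sn. Qed.

Lemma sum_n_S_R (u : nat -> R) N : sum_n u (S N) = sum_n u N + u (S N) :> R.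
Proof. now rewrite sum_Sn. Qed.

Lemma sum_n_head (u : nat -> C) N : sum_n u (S N) = (u 0%nat + sum_n (fun n => u (S n)) N)%C :> C.
Proof.
  induction N; [now rewrite sum_n_S_C, !sum_O|].
  rewrite sum_n_S_C, IHN, (sum_n_S_C (fun n => u (S n))). ring.
Qed.

Lemma sum_n_split (u : nat -> C) l i :
  sum_n u (l + S i) = (sum_n u l + sum_n (fun k => u (S l + k)%nat) i)%C :> C.
Proof.
  induction i.
  - rewrite sum_O, Nat.add_1_r, sum_n_S_C, Nat.add_0_r. reflexivity.
  - replace (l + S (S i))%nat with (S (l + S i)) by lia.
    rewrite !sum_n_S_C, IHi. replace (S l + S i)%nat with (S (l + S i)) by lia. ring.
Qed.

Lemma Cmod_sum_n_le (u : nat -> C) (v : nat -> R) N :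
  (forall n, (n <= N)%nat -> Cmod (u n) <= v n) -> Cmod (sum_n u N) <= sum_n v N.
Proof.
  induction N; intros H.
  - rewrite !sum_O. apply H; lia.
  - rewrite sum_n_S_C, sum_n_S_R. eapply Rle_trans; [apply Cmod_triangle|].
    apply Rplus_le_compat; [apply IHN; intros; apply H; lia | apply H; lia].
Qed.

Lemma sum_n_Cmult_l (c : C) (u : nat -> C) N :
  sum_n (fun n => (c * u n)%C) N = (c * sum_n u N)%C :> C.
Proof. exact (sum_n_mult_l (K := C_Ring) c u N). Qed.

Lemma sum_n_Cplus (u v : nat -> C) N :
  sum_n (fun n => (u n + v n)%C) N = (sum_n u N + sum_n v N)%C :> C.
Proof. exact (sum_n_plus (G := C_AbelianMonoid) u v N). Qed.

Lemma sum_n_Cminus (u v : nat -> C) N :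
  sum_n (fun n => (u n - v n)%C) N = (sum_n u N - sum_n v N)%C :> C.
Proof.
  induction N; [now rewrite !sum_O|]. rewrite !sum_n_S_C, IHN. ring.
Qed.

Lemma sum_n_delta (c : C) n N :
  sum_n (fun k => if Nat.eq_dec k n then c else RtoC 0) N
  = (if le_lt_dec n N then c else RtoC 0) :> C.
Proof.
  induction N.
  - rewrite sum_O. destruct (Nat.eq_dec 0 n), (le_lt_dec n 0); auto; lia.
  - rewrite sum_n_S_C, IHN.
    destruct (Nat.eq_dec (S N) n), (le_lt_dec n N), (le_lt_dec n (S N)); try lia; Cring.
Qed.

(** * Limits and series of complex numbers *)

Definition is_lim_C (u : nat -> C) (l : C) : Prop :=
  is_lim_seq (fun n => Cmod (u n - l)) 0.

Lemma is_lim_seq_le_0 (u v : nat -> R) :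
  (forall n, 0 <= u n <= v n) -> is_lim_seq v 0 -> is_lim_seq u 0.
Proof.
  intros H Hv. apply is_lim_seq_le_le with (fun _ => 0) v; [apply H| |assumption].
  apply is_lim_seq_const.
Qed.

Lemma is_lim_seq_abs_minus (u : nat -> R) (l : R) :
  is_lim_seq (fun n => Rabs (u n - l)) 0 <-> is_lim_seq u l.
Proof.
  split; intros H.
  - apply is_lim_seq_abs_0 in H. apply is_lim_seq_ext with (fun n => (u n - l) + l).
    + intros; ring.
    + replace (Finite l) with (Rbar_plus 0 l) by (simpl; f_equal; ring).
      apply is_lim_seq_plus'; [assumption|apply is_lim_seq_const].
  - apply (is_lim_seq_abs_0 (fun n => u n - l)).
    replace 0 with (l - l) by ring. apply is_lim_seq_minus'; [assumption|apply is_lim_seq_const].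
Qed.

Lemma is_lim_C_components u l :
  is_lim_C u l <->
  is_lim_seq (fun n => Re (u n)) (Re l) /\ is_lim_seq (fun n => Im (u n)) (Im l).
Proof.
  unfold is_lim_C; split.
  - intros H; split; apply is_lim_seq_abs_minus;
      apply is_lim_seq_le_0 with (2 := H); intros n; (split; [apply Rabs_pos|]).
    + apply (re_le_Cmod (u n - l)%C).
    + apply (Im_le_Cmod (u n - l)%C).
  - intros [H1 H2]. apply is_lim_seq_abs_minus in H1, H2.
    generalize (is_lim_seq_plus' _ _ _ _ H1 H2). rewrite Rplus_0_l.
    apply is_lim_seq_le_0. intros n; split; [apply Cmod_ge_0|].
    apply (Cmod_le_Re_Im (u n - l)%C).
Qed.

Lemma CSeries_correct (u : nat -> C) l : is_lim_C (sum_n u) l -> CSeries u = l.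
Proof.
  intros H. apply is_lim_C_components in H as [H1 H2].
  destruct l as [a b]; unfold CSeries; f_equal; apply is_series_unique.
  - apply (is_lim_seq_ext _ _ _ (sum_n_Re u)) in H1. exact H1.
  - apply (is_lim_seq_ext _ _ _ (sum_n_Im u)) in H2. exact H2.
Qed.

Lemma is_lim_C_Cauchy (u : nat -> C) :
  (forall eps, 0 < eps -> exists N, forall n m, (N <= n)%nat -> (n <= m)%nat ->
     Cmod (u m - u n) <= eps) -> exists l, is_lim_C u l.
Proof.
  intros H.
  assert (A : ex_finite_lim_seq (fun n => Re (u n)) /\ ex_finite_lim_seq (fun n => Im (u n))).
  { split; apply ex_lim_seq_cauchy_corr; intros eps;
    destruct (H (eps / 2)) as [N HN]; try (destruct eps; simpl; lra);
    exists N; intros n m Hn Hm;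
    assert (Hnm : Cmod (u n - u m) <= eps / 2)
      by (destruct (Nat.le_ge_cases n m);
          [rewrite Cmod_minus_sym|]; apply HN; assumption).
    - generalize (re_le_Cmod (u n - u m)%C). destruct eps; simpl in *.
      unfold Re, Rminus in *; lra.
    - generalize (Im_le_Cmod (u n - u m)%C). destruct eps; simpl in *.
      unfold Im, Rminus in *; lra. }
  destruct A as [[a Ha] [b Hb]]. exists (a, b). apply is_lim_C_components. now split.
Qed.

Lemma is_lim_C_plus u v l m :
  is_lim_C u l -> is_lim_C v m -> is_lim_C (fun n => (u n + v n)%C) (l + m)%C.
Proof.
  rewrite !is_lim_C_components. intros [H1 H2] [H3 H4].
  split; apply is_lim_seq_plus'; assumption.
Qed.

Lemma is_lim_C_const c : is_lim_C (fun _ => c) c.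
Proof. apply is_lim_C_components; split; apply is_lim_seq_const. Qed.

Lemma is_lim_C_scal c u l : is_lim_C u l -> is_lim_C (fun n => (c * u n)%C) (c * l)%C.
Proof.
  intros H. generalize (is_lim_seq_scal_l _ (Cmod c) _ H).
  unfold is_lim_C; simpl. rewrite Rmult_0_r.
  apply is_lim_seq_ext. intros n. rewrite <- Cmod_mult. f_equal. ring.
Qed.

Lemma is_lim_C_ext u v l : (forall n, u n = v n) -> is_lim_C u l -> is_lim_C v l.
Proof. intros H. apply is_lim_seq_ext. intros n. now rewrite H. Qed.

Lemma is_lim_C_incr_1 u l : is_lim_C (fun n => u (S n)) l <-> is_lim_C u l.
Proof. unfold is_lim_C. symmetry. apply (is_lim_seq_incr_1 (fun n => Cmod (u n - l))). Qed.

Lemma CSeries_head (u : nat -> C) l :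
  is_lim_C (sum_n (fun n => u (S n))) l -> CSeries u = (u 0%nat + l)%C.
Proof.
  intros H. apply CSeries_correct, is_lim_C_incr_1.
  apply is_lim_C_ext with (fun n => (u 0%nat + sum_n (fun n => u (S n)) n)%C).
  - intros n. now rewrite sum_n_head.
  - apply is_lim_C_plus; [apply is_lim_C_const|exact H].
Qed.

(** The bound [b] may depend on [n]: for the Poisson means it contains a boundary
    term of a summation by parts that only disappears in the limit. *)
Lemma is_lim_C_Cmod_le u l (b : nat -> R) (B : R) :
  is_lim_C u l -> eventually (fun n => Cmod (u n) <= b n) -> is_lim_seq b B -> Cmod l <= B.
Proof.
  intros H [N HN] Hb.
  generalize (is_lim_seq_plus' _ _ _ _ H Hb). rewrite Rplus_0_l. intros H'.
  apply (is_lim_seq_le_loc (fun _ => Cmod l) (fun n => Cmod (u n - l) + b n) (Cmod l) B).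
  - exists N; intros n Hn. specialize (HN n Hn). rewrite Cmod_minus_sym.
    replace l with ((l - u n) + u n)%C at 1 by ring.
    eapply Rle_trans; [apply Cmod_triangle|lra].
  - apply is_lim_seq_const.
  - exact H'.
Qed.

Lemma is_lim_C_distance_le u l (N : nat) (B : R) :
  is_lim_C u l -> (forall m, (N <= m)%nat -> Cmod (u m - u N) <= B) -> Cmod (l - u N) <= B.
Proof.
  intros H HB.
  apply (is_lim_C_Cmod_le (fun n => (u n - u N)%C) (l - u N)%C (fun _ => B) B).
  - unfold Cminus. apply is_lim_C_plus; [exact H|apply is_lim_C_const].
  - exists N; exact HB.
  - apply is_lim_seq_const.
Qed.

Lemma sum_n_tail_bound (u : nat -> C) (v : nat -> R) n m :
  (n <= m)%nat -> (forall k, Cmod (u k) <= v k) ->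
  Cmod (sum_n u m - sum_n u n) <= sum_n v m - sum_n v n.
Proof.
  intros Hnm H. induction Hnm as [|m Hnm IH].
  - replace (sum_n u n - sum_n u n)%C with (RtoC 0) by ring. rewrite Cmod_0. lra.
  - rewrite sum_n_S_C, sum_n_S_R.
    replace (sum_n u m + u (S m) - sum_n u n)%C
      with ((sum_n u m - sum_n u n) + u (S m))%C by ring.
    eapply Rle_trans; [apply Cmod_triangle|]. specialize (H (S m)). lra.
Qed.

Lemma sum_n_le_Series (v : nat -> R) n :
  (forall k, 0 <= v k) -> ex_series v -> sum_n v n <= Series v.
Proof.
  intros H [l Hl]. rewrite (is_series_unique _ _ Hl).
  apply is_lim_seq_incr_compare with (u := sum_n v); [exact Hl|].
  intros k. rewrite sum_n_S_R. generalize (H (S k)). lra.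
Qed.

Lemma series_tail_lim (v : nat -> R) : ex_series v ->
  is_lim_seq (fun n => Series v - sum_n v n) 0.
Proof.
  intros H. replace 0 with (Series v - Series v) by ring.
  apply is_lim_seq_minus'; [apply is_lim_seq_const|]. apply (Series_correct v H).
Qed.

(** The explicit remainder makes the convergence uniform when the terms depend
    on a parameter and [v] does not. *)
Lemma CSeries_dominated (u : nat -> C) (v : nat -> R) :
  (forall k, Cmod (u k) <= v k) -> ex_series v ->
  is_lim_C (sum_n u) (CSeries u) /\
  forall n, Cmod (CSeries u - sum_n u n) <= Series v - sum_n v n.
Proof.
  intros H Hv.
  assert (Hp : forall k, 0 <= v k) by (intros k; eapply Rle_trans; [apply Cmod_ge_0|apply H]).
  assert (B : forall n m, (n <= m)%nat ->
            Cmod (sum_n u m - sum_n u n) <= Series v - sum_n v n).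
  { intros n m Hnm. eapply Rle_trans; [apply sum_n_tail_bound; eauto|].
    generalize (sum_n_le_Series v m Hp Hv); lra. }
  destruct (is_lim_C_Cauchy (sum_n u)) as [l Hl].
  { intros eps Heps. generalize (Series_correct _ Hv). intros L.
    change (is_lim_seq (sum_n v) (Series v)) in L. apply is_lim_seq_spec in L.
    destruct (L (mkposreal eps Heps)) as [N HN].
    exists N. intros n m Hn Hm. eapply Rle_trans; [apply B; assumption|].
    generalize (HN n Hn). simpl. intros K.
    apply Rabs_def2 in K. lra. }
  rewrite (CSeries_correct _ _ Hl). split; [assumption|].
  intros n. apply is_lim_C_distance_le with (1 := Hl). intros; now apply B.
Qed.

(** * Complex-valued functions of a real variable *)

Lemma continuous_C_eps (g : R -> C) x :
  (forall eps, 0 < eps -> exists d, 0 < d /\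
     forall y, Rabs (y - x) < d -> Cmod (g y - g x) < eps) <-> continuous g x.
Proof.
  split; intros H.
  - apply filterlim_locally. intros eps.
    destruct (H eps (cond_pos eps)) as [d [Hd K]].
    exists (mkposreal d Hd). intros y Hy. specialize (K y Hy).
    split; change (Rabs (fst (g y) - fst (g x)) < eps) || change (Rabs (snd (g y) - snd (g x)) < eps).
    + generalize (re_le_Cmod (g y - g x)%C). unfold Re; simpl; unfold Rminus; lra.
    + generalize (Im_le_Cmod (g y - g x)%C). unfold Im; simpl; unfold Rminus; lra.
  - intros eps Heps.
    assert (He : 0 < eps / 2) by lra.
    destruct (proj1 (filterlim_locally _ _) H (mkposreal _ He)) as [d Hd].
    exists d; split; [apply cond_pos|]. intros y Hy.
    destruct (Hd y Hy) as [K1 K2].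
    change (Rabs (fst (g y) - fst (g x)) < eps/2) in K1.
    change (Rabs (snd (g y) - snd (g x)) < eps/2) in K2.
    eapply Rle_lt_trans; [apply Cmod_le_Re_Im|]. unfold Re, Im; simpl. unfold Rminus in *. lra.
Qed.

Lemma continuous_C_components (g : R -> C) x :
  continuous g x <-> continuous (fun t => Re (g t)) x /\ continuous (fun t => Im (g t)) x.
Proof.
  split.
  - intros H. split.
    + apply (continuous_comp g fst); [exact H|]. destruct (g x). apply continuous_fst.
    + apply (continuous_comp g snd); [exact H|]. destruct (g x). apply continuous_snd.
  - intros [H1 H2]. apply filterlim_locally. intros eps.
    generalize (filter_and _ _ (proj1 (filterlim_locally _ _) H1 eps)
                 (proj1 (filterlim_locally _ _) H2 eps)).
    apply filter_imp. intros y [K1 K2]. split; assumption.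
Qed.

Lemma continuous_Cplus (f g : R -> C) x :
  continuous f x -> continuous g x -> continuous (fun t => (f t + g t)%C) x.
Proof. apply (continuous_plus (V := C_R_NormedModule)). Qed.

Lemma continuous_Cmult (f g : R -> C) x :
  continuous f x -> continuous g x -> continuous (fun t => (f t * g t)%C) x.
Proof.
  rewrite !continuous_C_components. intros [H1 H2] [H3 H4]. split; simpl.
  - apply (continuous_minus (V := R_NormedModule)); apply (continuous_mult (K := R_AbsRing)); assumption.
  - apply (continuous_plus (V := R_NormedModule)); apply (continuous_mult (K := R_AbsRing)); assumption.
Qed.

Lemma continuous_Cminus (f g : R -> C) x :
  continuous f x -> continuous g x -> continuous (fun t => (f t - g t)%C) x.
Proof. apply (continuous_minus (V := C_R_NormedModule)). Qed.

Lemma continuous_sum_C (f : nat -> R -> C) (x : R) N :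
  (forall n, continuous (f n) x) -> continuous (fun t => sum_n (fun n => f n t) N : C) x.
Proof.
  intros H. induction N.
  - apply continuous_ext with (f 0%nat); [intros; now rewrite sum_O|]. apply H.
  - apply continuous_ext with (fun t => (sum_n (fun n => f n t) N + f (S N) t)%C).
    + intros; now rewrite sum_n_S_C.
    + now apply continuous_Cplus.
Qed.

Lemma continuous_uniform_limit (h : nat -> R -> C) (g : R -> C) (b : nat -> R) :
  is_lim_seq b 0 -> (forall n x, Cmod (g x - h n x) <= b n) ->
  (forall n (x : R), continuous (h n) x) -> forall x : R, continuous g x.
Proof.
  intros Hb Hu Hc x. apply continuous_C_eps. intros eps Heps.
  apply is_lim_seq_spec in Hb. destruct (Hb (mkposreal (eps / 3) ltac:(lra))) as [N HN].
  specialize (HN N (Nat.le_refl _)). simpl in HN. apply Rabs_def2 in HN.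
  destruct (proj2 (continuous_C_eps (h N) x) (Hc N x) (eps / 3) ltac:(lra)) as [d [Hd K]].
  exists d; split; [assumption|]. intros y Hy. specialize (K y Hy).
  replace (g y - g x)%C with ((g y - h N y) + ((h N y - h N x) - (g x - h N x)))%C by ring.
  eapply Rle_lt_trans; [apply Cmod_triangle|].
  pose proof (Cmod_minus_triangle (h N y - h N x) (g x - h N x)).
  generalize (Hu N x) (Hu N y). lra.
Qed.

Lemma derivC_components (h : R -> C) x l :
  derivC h x l <->
  is_derive (fun t => Re (h t)) x (Re l) /\ is_derive (fun t => Im (h t)) x (Im l).
Proof.
  split.
  - intros H. split.
    + generalize (filterdiff_comp' h (fst : C_R_NormedModule -> R_NormedModule) x _ fst H
        (filterdiff_linear _ is_linear_fst)).
      intros K; exact K.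
    + generalize (filterdiff_comp' h (snd : C_R_NormedModule -> R_NormedModule) x _ snd H
        (filterdiff_linear _ is_linear_snd)).
      intros K; exact K.
  - intros [H1 H2].
    assert (K : filterdiff (fun t => ((Re (h t), Im (h t)) : C_R_NormedModule)) (locally x)
       (fun y : R => (scal y (Re l), scal y (Im l)))).
    { apply (filterdiff_comp'_2 (fun t => Re (h t)) (fun t => Im (h t))
        (fun a b => (a, b) : C_R_NormedModule) x _ _ (fun a b => (a, b) : C_R_NormedModule) H1 H2).
      apply (filterdiff_ext_lin (fun t => (fst t, snd t)) (fun t => t)); [|intros []; reflexivity].
      apply (filterdiff_ext (fun t => t)); [intros []; reflexivity|]. apply filterdiff_id. }
    unfold is_derive.
    apply (filterdiff_ext_lin h
      (fun y : R => ((scal y (Re l), scal y (Im l)) : C_R_NormedModule))).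
    + revert K. apply filterdiff_ext. intros t. now destruct (h t).
    + intros y. destruct l. reflexivity.
Qed.

Lemma derivC_const (c : C) (x : R) : derivC (fun _ => c) x (RtoC 0).
Proof. apply (is_derive_const (V := C_R_NormedModule)). Qed.

Lemma derivC_Cplus (f g : R -> C) x df dg :
  derivC f x df -> derivC g x dg -> derivC (fun t => (f t + g t)%C) x (df + dg)%C.
Proof. apply (is_derive_plus (V := C_R_NormedModule)). Qed.

Lemma derivC_Cmult (f g : R -> C) x df dg :
  derivC f x df -> derivC g x dg ->
  derivC (fun t => (f t * g t)%C) x (df * g x + f x * dg)%C.
Proof.
  rewrite !derivC_components. intros [H1 H2] [H3 H4]. split; simpl.
  - generalize (is_derive_minus _ _ _ _ _
      (is_derive_mult _ _ _ _ _ H1 H3 Rmult_comm) (is_derive_mult _ _ _ _ _ H2 H4 Rmult_comm)).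
    intros K.
    evar_last; [exact K|]. unfold minus, plus, opp, mult; simpl. unfold Re, Im; ring.
  - generalize (is_derive_plus _ _ _ _ _
      (is_derive_mult _ _ _ _ _ H1 H4 Rmult_comm) (is_derive_mult _ _ _ _ _ H2 H3 Rmult_comm)).
    intros K. evar_last; [exact K|]. unfold minus, plus, opp, mult; simpl. unfold Re, Im; ring.
Qed.

Lemma derivC_Cmult_l (c : C) (f : R -> C) x df :
  derivC f x df -> derivC (fun t => (c * f t)%C) x (c * df)%C.
Proof.
  intros H. evar_last; [apply derivC_Cmult; [apply derivC_const|exact H]|].
  cbv beta. change (RtoC 0 * f x + c * df = c * df)%C. ring.
Qed.

Lemma derivC_sum (h dh : nat -> R -> C) x N :
  (forall n, derivC (h n) x (dh n x)) ->
  derivC (fun t => sum_n (fun n => h n t) N) x (sum_n (fun n => dh n x) N).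
Proof.
  intros H. induction N.
  - apply (is_derive_ext (h 0%nat)); [intros; now rewrite sum_O|]. rewrite sum_O. apply H.
  - apply (is_derive_ext (fun t => (sum_n (fun n => h n t) N + h (S N) t)%C)).
    { intros; now rewrite sum_n_S_C. }
    rewrite sum_n_S_C. apply derivC_Cplus; auto.
Qed.

Lemma derivC_pow (h : R -> C) (x : R) (dh : C) n :
  derivC h x dh -> derivC (fun t => Cpow (h t) (S n)) x (RtoC (INR (S n)) * Cpow (h x) n * dh)%C.
Proof.
  intros H. induction n.
  - evar_last.
    + apply (is_derive_ext (V := C_R_NormedModule) h); [|exact H]. intros; simpl; Cring.
    + simpl. Cring.
  - evar_last.
    + apply (derivC_Cmult h (fun t => Cpow (h t) (S n)) x _ _ H IHn).
    + rewrite (S_INR (S n)), RtoC_plus. cbn [Cpow]. Cring.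
Qed.

Lemma derivC_continuous (h : R -> C) x l : derivC h x l -> continuous h x.
Proof.
  intros H. apply (ex_derive_continuous (V := C_R_NormedModule)). now exists l.
Qed.

(** The factor [2] comes from treating the real and imaginary parts separately. *)
Lemma mean_value_C (h dh : R -> C) (B x y : R) :
  (forall t, Rabs (t - x) <= Rabs (y - x) -> derivC h t (dh t) /\ Cmod (dh t) <= B) ->
  Cmod (h y - h x) <= 2 * B * Rabs (y - x).
Proof.
  intros H.
  assert (H1 : Rabs (Re (h y) - Re (h x)) <= B * Rabs (y - x)).
  { apply (bounded_variation (fun t => Re (h t)) (fun t => Re (dh t))). intros t Ht.
    destruct (H t Ht) as [K1 K2]. apply derivC_components in K1.
    split; [apply K1|]. eapply Rle_trans; [apply re_le_Cmod|exact K2]. }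
  assert (H2 : Rabs (Im (h y) - Im (h x)) <= B * Rabs (y - x)).
  { apply (bounded_variation (fun t => Im (h t)) (fun t => Im (dh t))). intros t Ht.
    destruct (H t Ht) as [K1 K2]. apply derivC_components in K1.
    split; [apply K1|]. eapply Rle_trans; [apply Im_le_Cmod|exact K2]. }
  eapply Rle_trans; [apply Cmod_le_Re_Im|].
  unfold Re, Im in *; simpl; unfold Rminus in *; lra.
Qed.

Lemma derivC_uniform_limit (h dh : nat -> R -> C) (g dg : R -> C) (b : nat -> R) :
  (forall n x, derivC (h n) x (dh n x)) ->
  (forall x, is_lim_C (fun n => h n x) (g x)) ->
  is_lim_seq b 0 ->
  (forall n x, Cmod (dg x - dh n x) <= b n) ->
  (forall x, continuous dg x) ->
  forall x, derivC g x (dg x).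
Proof.
  intros Hd Hl Hb Hu Hc x.
  assert (U : forall (p : C -> R), (forall z, Rabs (p z) <= Cmod z) ->
    (forall z w, p (z - w)%C = p z - p w) ->
    (forall n x, is_derive (fun t => p (h n t)) x (p (dh n x))) ->
    (forall x, continuous (fun t => p (dg t)) x) ->
    (forall x, is_lim_seq (fun n => p (h n x)) (p (g x))) ->
    is_derive (fun t => p (g t)) x (p (dg x))).
  { intros p Hp Hm H1 H2 H3. apply is_derive_Reals.
    apply (derivable_pt_lim_CVU (fun n t => p (h n t)) (fun n t => p (dh n t))
             (fun t => p (g t)) (fun t => p (dg t)) x x (mkposreal 1 Rlt_0_1)).
    - unfold Boule; simpl. rewrite Rminus_diag, Rabs_R0. lra.
    - intros y n _. apply is_derive_Reals, H1.
    - intros y _. apply is_lim_seq_Reals, H3.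
    - intros eps Heps. apply is_lim_seq_spec in Hb.
      destruct (Hb (mkposreal eps Heps)) as [N HN]. exists N. intros n y Hn _.
      rewrite <- Hm. eapply Rle_lt_trans; [apply Hp|].
      eapply Rle_lt_trans; [apply Hu|]. specialize (HN n Hn). simpl in HN.
      apply Rabs_def2 in HN. lra.
    - intros y _. apply continuity_pt_filterlim, H2. }
  apply derivC_components. split.
  - apply (U Re); try (intros; reflexivity).
    + apply re_le_Cmod.
    + intros n t. apply (derivC_components (h n) t). apply Hd.
    + intros t. apply (continuous_C_components dg t), Hc.
    + intros t. apply (is_lim_C_components (fun n => h n t)), Hl.
  - apply (U Im); try (intros; reflexivity).
    + apply Im_le_Cmod.
    + intros n t. apply (derivC_components (h n) t). apply Hd.
    + intros t. apply (continuous_C_components dg t), Hc.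
    + intros t. apply (is_lim_C_components (fun n => h n t)), Hl.
Qed.

Lemma RIntC_Cplus (f g : R -> C) a b (l m : C) :
  RIntC f a b l -> RIntC g a b m -> RIntC (fun t => (f t + g t)%C) a b (l + m)%C.
Proof. apply (is_RInt_plus (V := C_R_NormedModule)). Qed.

Lemma RIntC_components (f : R -> C) a b (l : C) :
  RIntC f a b l <-> is_RInt (fun t => Re (f t)) a b (Re l) /\ is_RInt (fun t => Im (f t)) a b (Im l).
Proof.
  split.
  - intros H; split;
    [ exact (is_RInt_fct_extend_fst (U := R_NormedModule) (V := R_NormedModule) f a b l H)
    | exact (is_RInt_fct_extend_snd (U := R_NormedModule) (V := R_NormedModule) f a b l H)].
  - destruct l as [l1 l2]. intros [H1 H2].
    exact (is_RInt_fct_extend_pair (U := R_NormedModule) (V := R_NormedModule) f a b l1 l2 H1 H2).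
Qed.

Lemma RIntC_Cmult_l (c : C) (f : R -> C) a b (l : C) :
  RIntC f a b l -> RIntC (fun t => (c * f t)%C) a b (c * l)%C.
Proof.
  rewrite !RIntC_components. intros [H1 H2]. split; simpl.
  - apply (is_RInt_minus (V := R_NormedModule)); apply (is_RInt_scal (V := R_NormedModule)); assumption.
  - apply (is_RInt_plus (V := R_NormedModule)); apply (is_RInt_scal (V := R_NormedModule)); assumption.
Qed.

Lemma RIntC_ext (f g : R -> C) a b (l : C) :
  (forall t, f t = g t) -> RIntC f a b l -> RIntC g a b l.
Proof. intros H. apply is_RInt_ext. intros; apply H. Qed.

Lemma RIntC_continuous (f : R -> C) a b :
  (forall t : R, continuous f t) -> exists l, RIntC f a b l.
Proof. intros H. apply (ex_RInt_continuous (V := C_R_CompleteNormedModule)). intros; apply H. Qed.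

Lemma RIntC_derive (f df : R -> C) a b :
  (forall t : R, derivC f t (df t)) -> (forall t : R, continuous df t) ->
  RIntC df a b (f b - f a)%C.
Proof. intros H1 H2. apply (is_RInt_derive (V := C_R_CompleteNormedModule)); intros; auto. Qed.

Lemma RIntC_unique (f : R -> C) a b (l m : C) :
  RIntC f a b l -> RIntC f a b m -> l = m.
Proof.
  intros H1 H2. apply (is_RInt_unique (V := C_R_CompleteNormedModule)) in H1, H2. congruence.
Qed.

Lemma RIntC_sum (f : nat -> R -> C) (l : nat -> C) a b N :
  (forall n, (n <= N)%nat -> RIntC (f n) a b (l n)) ->
  RIntC (fun t => sum_n (fun n => f n t) N) a b (sum_n l N).
Proof.
  intros H. induction N.
  - rewrite sum_O. apply RIntC_ext with (f 0%nat); [intros; now rewrite sum_O|]. apply H; lia.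
  - rewrite sum_n_S_C. apply RIntC_ext with (fun t => (sum_n (fun n => f n t) N + f (S N) t)%C).
    { intros; now rewrite sum_n_S_C. }
    apply RIntC_Cplus; [apply IHN; intros; apply H; lia|apply H; lia].
Qed.

Lemma RIntC_bound (f : R -> C) (g : R -> R) a b (l : C) L : a <= b ->
  (forall t, a <= t <= b -> Cmod (f t) <= g t) -> RIntC f a b l -> is_RInt g a b L -> Cmod l <= L.
Proof.
  intros Hab H H1 H2. rewrite <- norm_Cmod. eapply norm_RInt_le; eauto.
  intros t Ht. cbv beta. rewrite norm_Cmod. auto.
Qed.

Lemma RIntC_bound_const (f : R -> C) (M : R) a b (l : C) : a <= b ->
  (forall t, a <= t <= b -> Cmod (f t) <= M) -> RIntC f a b l -> Cmod l <= (b - a) * M.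
Proof.
  intros Hab H H1. apply (RIntC_bound f (fun _ => M) a b); auto.
  apply (is_RInt_const (V := R_NormedModule)).
Qed.

(** * The exponential *)

Lemma e_plus x y : e (x + y) = (e x * e y)%C.
Proof.
  unfold e, Cmult; simpl. rewrite Rmult_plus_distr_l, cos_plus, sin_plus. f_equal; ring.
Qed.

Lemma e_0 : e 0 = RtoC 1.
Proof. unfold e. rewrite Rmult_0_r, cos_0, sin_0. reflexivity. Qed.

Lemma Cmod_e x : Cmod (e x) = 1.
Proof.
  unfold Cmod, e; simpl. rewrite !Rmult_1_r, Rplus_comm.
  generalize (sin2_cos2 (2 * PI * x)); unfold Rsqr; intros ->. apply sqrt_1.
Qed.

Lemma e_INR n : e (INR n) = RtoC 1.
Proof.
  unfold e. replace (2 * PI * INR n) with (0 + 2 * INR n * PI) by ring.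
  rewrite cos_period, sin_period, cos_0, sin_0. reflexivity.
Qed.

Lemma e_opp x : (e x * e (- x) = RtoC 1)%C.
Proof. rewrite <- e_plus, Rplus_opp_r. apply e_0. Qed.

Lemma e_IZR n : e (IZR n) = RtoC 1.
Proof.
  destruct n as [|p|p].
  - apply e_0.
  - rewrite <- (positive_nat_Z p), <- INR_IZR_INZ. apply e_INR.
  - change (Z.neg p) with (- Z.pos p)%Z. rewrite opp_IZR, <- (positive_nat_Z p), <- INR_IZR_INZ.
    generalize (e_opp (INR (Pos.to_nat p))). rewrite e_INR. intros <-. ring.
Qed.

Lemma Cpow_e t n : Cpow (e t) n = e (INR n * t).
Proof.
  induction n; [simpl; rewrite Rmult_0_l; symmetry; apply e_0|].
  cbn [Cpow]. rewrite IHn, S_INR, Rmult_plus_distr_r, e_plus, Rmult_1_l. ring.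
Qed.

(** The factor [2 i pi c] of the derivative of [e (c t)]. *)
Definition freq (c : R) : C := (0, 2 * PI * c).

Lemma freq_mult x y : freq (x * y) = (freq x * RtoC y)%C.
Proof. unfold freq, RtoC, Cmult; simpl. f_equal; ring. Qed.

Lemma Cmod_freq c : Cmod (freq c) = 2 * PI * Rabs c.
Proof.
  replace (freq c) with (RtoC (2 * PI * c) * Ci)%C.
  - rewrite Cmod_mult, Cmod_R, !Rabs_mult, (Rabs_pos_eq PI), (Rabs_pos_eq 2).
    + replace (Cmod Ci) with 1; [ring|]. unfold Cmod; simpl.
      replace (0 * (0 * 1) + 1 * (1 * 1)) with 1 by ring. now rewrite sqrt_1.
    + lra.
    + generalize PI_RGT_0; lra.
  - unfold freq, RtoC, Ci, Cmult; simpl. f_equal; ring.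
Qed.

Lemma freq_neq_0 c : c <> 0 -> freq c <> RtoC 0.
Proof.
  intros Hc H. apply (f_equal Cmod) in H. rewrite Cmod_freq, Cmod_0 in H.
  generalize PI_RGT_0 (Rabs_pos_lt c Hc). nra.
Qed.

Lemma derivC_e c x : derivC (fun t => e (c * t)) x (freq c * e (c * x))%C.
Proof.
  apply derivC_components. unfold e, freq; simpl. split; auto_derive; auto; ring.
Qed.

Lemma derivC_e1 x : derivC e x (freq 1 * e x)%C.
Proof.
  generalize (derivC_e 1 x). rewrite Rmult_1_l. apply is_derive_ext. intros; f_equal; apply Rmult_1_l.
Qed.

Lemma continuous_e c (x : R) : continuous (fun t => e (c * t)) x.
Proof. eapply derivC_continuous, derivC_e. Qed.

Lemma Cmod_e_minus_1 t : Cmod (e t - 1) <= 4 * PI * Rabs t.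
Proof.
  rewrite <- e_0.
  eapply Rle_trans; [apply (mean_value_C e (fun x => freq 1 * e x)%C (2 * PI) 0 t)|].
  - intros x _. split; [apply derivC_e1|]. rewrite Cmod_mult, Cmod_e, Cmod_freq, Rabs_R1. lra.
  - rewrite Rminus_0_r. lra.
Qed.

Lemma RIntC_e_integer (m : Z) :
  RIntC (fun t => e (IZR m * t)) (- / 2) (/ 2) (if Z.eq_dec m 0 then RtoC 1 else RtoC 0).
Proof.
  destruct (Z.eq_dec m 0) as [->|Hm].
  - apply RIntC_ext with (fun _ => RtoC 1); [intros; now rewrite Rmult_0_l, e_0|].
    evar_last; [apply (is_RInt_const (V := C_R_NormedModule))|].
    change (((/ 2 - - / 2) * 1, (/ 2 - - / 2) * 0) = RtoC 1 :> R * R).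
    unfold RtoC; f_equal; lra.
  - assert (Hm' : IZR m <> 0) by (now apply not_0_IZR).
    apply RIntC_ext with (fun t => (/ freq (IZR m) * (freq (IZR m) * e (IZR m * t)))%C).
    { intros t. match goal with |- @eq _ ?a ?b => change (@eq C a b) end. field. now apply freq_neq_0. }
    evar_last.
    + apply (RIntC_derive (fun t => (/ freq (IZR m) * e (IZR m * t))%C)).
      * intros t. apply derivC_Cmult_l, derivC_e.
      * intros t. apply continuous_Cmult; [apply continuous_const|].
        apply continuous_Cmult; [apply continuous_const|apply continuous_e].
    + replace (IZR m * / 2) with (IZR m + IZR m * - / 2) by field.
      rewrite e_plus, e_IZR. Cring.
Qed.

(** * Real powers *)

Lemma Rpower_pos x p : 0 < Rpower x p.
Proof. apply exp_pos. Qed.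

Lemma Rpower_1_l p : Rpower 1 p = 1.
Proof. unfold Rpower. rewrite ln_1, Rmult_0_r. apply exp_0. Qed.

Lemma ln_le_minus_1 x : 0 < x -> ln x <= x - 1.
Proof. intros H. generalize (exp_ineq1_le (ln x)). rewrite exp_ln; lra. Qed.

Lemma Rpower_inv_l x p : 0 < x -> Rpower (/ x) p = Rpower x (- p).
Proof. intros H. unfold Rpower. rewrite ln_Rinv by assumption. f_equal; ring. Qed.

Lemma Rpower_ge_1 x p : 1 <= x -> 0 <= p -> 1 <= Rpower x p.
Proof. intros. rewrite <- (Rpower_1_l p). apply Rle_Rpower_l; lra. Qed.

Lemma Rpower_antitone_exponent x p q : 0 < x <= 1 -> q <= p -> Rpower x p <= Rpower x q.
Proof.
  intros Hx Hpq.
  assert (0 < / x) by (apply Rinv_0_lt_compat; lra).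
  rewrite <- (Rinv_inv x), !(Rpower_inv_l (/ x)) by assumption. apply Rle_Rpower; [|lra].
  rewrite <- Rinv_1. apply Rinv_le_contravar; lra.
Qed.

Lemma Rle_Rpower_neg a b c : c <= 0 -> 0 < a <= b -> Rpower b c <= Rpower a c.
Proof.
  intros Hc Hab. rewrite <- (Rinv_inv a), <- (Rinv_inv b).
  rewrite !(Rpower_inv_l (/ _)) by (apply Rinv_0_lt_compat; lra).
  apply Rle_Rpower_l; [lra|]. split; [apply Rinv_0_lt_compat; lra|].
  apply Rinv_le_contravar; lra.
Qed.

(** A power varies by at most a constant factor over [x, 2x], whatever the sign
    of the exponent; this covers the steps [x, x + 1] with [x >= 1]. *)
Lemma Rpower_double_bound x y a : 0 < x -> x <= y <= 2 * x ->
  Rpower y a <= Rpower 2 (Rabs a) * Rpower x a.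
Proof.
  intros Hx Hy. destruct (Rle_lt_dec 0 a) as [Ha|Ha].
  - rewrite Rabs_pos_eq, Rpower_mult_distr by lra. apply Rle_Rpower_l; lra.
  - rewrite <- (Rmult_1_l (Rpower y a)). apply Rmult_le_compat.
    + lra.
    + left; apply Rpower_pos.
    + apply Rpower_ge_1; [lra|apply Rabs_pos].
    + apply Rle_Rpower_neg; lra.
Qed.

Lemma INR_S_ge_1 n : 1 <= INR (S n).
Proof. rewrite S_INR. generalize (pos_INR n); lra. Qed.

Lemma Rpower_INR_mono p n m : 0 <= p -> (n <= m)%nat -> Rpower (INR (S n)) p <= Rpower (INR (S m)) p.
Proof.
  intros Hp Hn. apply Rle_Rpower_l; [assumption|]. split; [apply lt_0_INR; lia|apply le_INR; lia].
Qed.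

Lemma Rpower_small (M s eps : R) : 0 <= M -> 0 < s -> 0 < eps ->
  exists d, 0 < d /\ forall t, 0 < t <= d -> M * Rpower t s < eps.
Proof.
  intros HM Hs He. assert (Hq : 0 < eps / (M + 1)) by (apply Rdiv_lt_0_compat; lra).
  exists (Rpower (eps / (M + 1)) (/ s)). split; [apply Rpower_pos|]. intros t Ht.
  assert (P : Rpower t s <= eps / (M + 1)).
  { eapply Rle_trans; [apply Rle_Rpower_l; [left; exact Hs|exact Ht]|].
    rewrite Rpower_mult, Rinv_l, Rpower_1 by lra. lra. }
  apply Rle_lt_trans with (M * (eps / (M + 1))); [apply Rmult_le_compat_l; assumption|].
  apply Rlt_le_trans with ((M + 1) * (eps / (M + 1))); [|right; field; lra].
  apply Rmult_lt_compat_r; lra.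
Qed.

Lemma Rpower_INR_lim_0 q : 0 < q -> is_lim_seq (fun n => Rpower (INR (S n)) (- q)) 0.
Proof.
  intros Hq. apply is_lim_seq_spec. intros eps.
  destruct (nfloor_ex (Rpower (/ eps) (/ q)) ) as [N HN]; [left; apply Rpower_pos|].
  assert (He : 0 < eps) by apply cond_pos.
  assert (Hie : 0 < / eps) by (now apply Rinv_0_lt_compat).
  exists N. intros n Hn. rewrite Rminus_0_r, Rabs_pos_eq by (left; apply Rpower_pos).
  rewrite <- (Rinv_inv eps). rewrite Rpower_Ropp. apply Rinv_lt_contravar.
  - apply Rmult_lt_0_compat; [assumption|apply Rpower_pos].
  - replace (/ eps) with (Rpower (Rpower (/ eps) (/ q)) q)
      by (rewrite Rpower_mult, Rinv_l, Rpower_1; lra).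
    apply Rlt_Rpower_l; [assumption|]. split; [apply Rpower_pos|].
    eapply Rlt_le_trans; [apply HN|]. rewrite <- S_INR. apply le_INR; lia.
Qed.

Lemma exp_pow a n : exp a ^ n = exp (a * INR n).
Proof.
  induction n; [simpl; now rewrite Rmult_0_r, exp_0|].
  rewrite S_INR, Rmult_plus_distr_l, exp_plus, Rmult_1_r, <- IHn. simpl. ring.
Qed.

Lemma Rpower_exp_bounded p a : 0 < p -> 0 < a ->
  exists B, 0 <= B /\ forall x, 0 < x -> Rpower x p * exp (- a * x) <= B.
Proof.
  intros Hp Ha. exists (exp (- p - p * ln (a / p))). split; [left; apply exp_pos|].
  intros x Hx. unfold Rpower. rewrite <- exp_plus.
  assert (L : ln (x * (a / p)) <= x * (a / p) - 1)
    by (apply ln_le_minus_1, Rmult_lt_0_compat; [assumption|apply Rdiv_lt_0_compat; assumption]).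
  rewrite ln_mult in L by (auto; apply Rdiv_lt_0_compat; assumption).
  apply Rmult_le_compat_l with (r := p) in L; [|lra].
  replace (p * (x * (a / p) - 1)) with (a * x - p) in L by (field; lra).
  destruct (Req_dec (p * ln x + - a * x) (- p - p * ln (a / p))) as [->|]; [lra|].
  left; apply exp_increasing. lra.
Qed.

Lemma Rpower_exp_lim p a : 0 < p -> 0 < a ->
  is_lim_seq (fun N => Rpower (INR (S (S N))) p * exp (- a * INR (S (S N)))) 0.
Proof.
  intros Hp Ha. destruct (Rpower_exp_bounded (p + 1) a ltac:(lra) Ha) as [B [HB H]].
  apply is_lim_seq_le_0 with (fun N => B * / INR (S (S N))).
  - intros n. assert (Hn : 0 < INR (S (S n))) by (apply lt_0_INR; lia). split.
    + apply Rmult_le_pos; left; apply exp_pos.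
    + specialize (H _ Hn). rewrite Rpower_plus, Rpower_1 in H by assumption.
      apply Rmult_le_reg_r with (INR (S (S n))); [assumption|].
      replace (B * / INR (S (S n)) * INR (S (S n))) with B by (field; lra). lra.
  - replace (Finite 0) with (Rbar_mult B 0) by (simpl; f_equal; ring).
    apply is_lim_seq_scal_l.
    generalize (proj1 (is_lim_seq_incr_n (fun n => / INR n) 2 0)). intros G. 
    apply is_lim_seq_ext with (fun n => / INR (n + 2)).
    { intros n. do 2 f_equal. lia. }
    apply G. replace (Finite 0) with (Rbar_inv p_infty) by reflexivity.
    apply is_lim_seq_inv; [apply is_lim_seq_INR|discriminate].
Qed.

Lemma log_step_bounds x : 1 <= x -> / (2 * x) <= ln (x + 1) - ln x <= / x.
Proof.
  intros Hx.
  assert (H1 : ln (x / (x + 1)) <= x / (x + 1) - 1) by (apply ln_le_minus_1, Rdiv_lt_0_compat; lra).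
  assert (H2 : ln ((x + 1) / x) <= (x + 1) / x - 1) by (apply ln_le_minus_1, Rdiv_lt_0_compat; lra).
  rewrite ln_div in H1, H2 by lra.
  replace ((x + 1) / x - 1) with (/ x) in H2 by (field; lra).
  replace (x / (x + 1) - 1) with (- / (x + 1)) in H1 by (field; lra).
  assert (/ (2 * x) <= / (x + 1)) by (apply Rinv_le_contravar; lra). lra.
Qed.

Lemma Rpower_succ x p : 0 < x -> Rpower (x + 1) p = Rpower x p * exp (p * (ln (x + 1) - ln x)).
Proof. intros. unfold Rpower. rewrite <- exp_plus. f_equal; ring. Qed.

Lemma Rpower_minus_1 x p : 0 < x -> Rpower x (p - 1) = Rpower x p * / x.
Proof.
  intros. unfold Rminus. rewrite Rpower_plus, Rpower_Ropp, Rpower_1; auto.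
Qed.

Lemma Rpower_step_upper x q : 1 <= x -> 0 <= q ->
  Rpower x (- q) - Rpower (x + 1) (- q) <= q * Rpower x (- q - 1).
Proof.
  intros Hx Hq. rewrite Rpower_succ, Rpower_minus_1 by lra.
  pose proof (log_step_bounds x Hx) as [_ Hv]. set (v := ln (x + 1) - ln x) in *.
  pose proof (exp_ineq1_le (- q * v)). pose proof (Rpower_pos x (- q)).
  assert (q * v <= q * / x) by (apply Rmult_le_compat_l; assumption).
  replace (Rpower x (- q) - Rpower x (- q) * exp (- q * v))
    with (Rpower x (- q) * (1 - exp (- q * v))) by ring.
  replace (q * (Rpower x (- q) * / x)) with (Rpower x (- q) * (q * / x)) by ring.
  apply Rmult_le_compat_l; lra.
Qed.

(** The terms [x^(-q-1)] are dominated by the differences of [x^(-q)], so their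
    sums telescope: a substitute for comparing the sum with an integral. *)
Lemma Rpower_step_lower x q : 1 <= x -> 0 < q ->
  Rpower x (- q - 1) <= (Rpower 2 q * 2 / q) * (Rpower x (- q) - Rpower (x + 1) (- q)).
Proof.
  intros Hx Hq. pose proof (log_step_bounds x Hx) as [Hv _].
  pose proof (Rpower_double_bound x (x + 1) q ltac:(lra) ltac:(lra)) as D.
  rewrite Rabs_pos_eq in D by lra.
  rewrite Rpower_succ in D by lra.
  rewrite Rpower_succ, Rpower_minus_1 by lra. set (v := ln (x + 1) - ln x) in *.
  pose proof (Rpower_pos x q) as P1. pose proof (Rpower_pos x (- q)) as P2.
  assert (E : exp (q * v) <= Rpower 2 q).
  { apply Rmult_le_reg_l with (Rpower x q); lra. }
  pose proof (exp_ineq1_le (q * v)) as G.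
  assert (I : exp (- q * v) * exp (q * v) = 1).
  { rewrite <- exp_plus. replace (- q * v + q * v) with 0 by ring. apply exp_0. }
  pose proof (exp_pos (- q * v)) as P3.
  assert (J : / x <= Rpower 2 q * 2 / q * (1 - exp (- q * v))).
  { assert (A : exp (- q * v) * (q * v) <= 1 - exp (- q * v)) by nra.
    assert (B : 1 <= Rpower 2 q * exp (- q * v)) by nra.
    assert (Hv' : / x <= 2 * v).
    { replace (/ x) with (2 * / (2 * x)) by (field; lra). lra. }
    assert (0 < / x) by (apply Rinv_0_lt_compat; lra).
    replace (Rpower 2 q * 2 / q * (1 - exp (- q * v)))
      with (Rpower 2 q * (1 - exp (- q * v)) * (2 / q)) by (field; lra).
    apply Rle_trans with (Rpower 2 q * (exp (- q * v) * (q * v)) * (2 / q)).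
    - replace (Rpower 2 q * (exp (- q * v) * (q * v)) * (2 / q))
        with (Rpower 2 q * exp (- q * v) * (2 * v)) by (field; lra).
      nra.
    - apply Rmult_le_compat_r; [apply Rlt_le, Rdiv_lt_0_compat; lra|].
      apply Rmult_le_compat_l; [left; apply Rpower_pos|exact A]. }
  replace (Rpower 2 q * 2 / q * (Rpower x (- q) - Rpower x (- q) * exp (- q * v)))
    with (Rpower x (- q) * (Rpower 2 q * 2 / q * (1 - exp (- q * v)))) by ring.
  apply Rmult_le_compat_l; [lra|exact J].
Qed.

Lemma sum_Rpower_tail L q N : 1 <= L -> 0 < q ->
  sum_n (fun i => Rpower (L + INR i) (- q - 1)) N <= Rpower 2 q * 2 / q * Rpower L (- q).
Proof.
  intros HL Hq.
  assert (K : 0 < Rpower 2 q * 2 / q).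
  { apply Rdiv_lt_0_compat; [|assumption]. generalize (Rpower_pos 2 q); lra. }
  assert (H : sum_n (fun i => Rpower (L + INR i) (- q - 1)) N <=
    Rpower 2 q * 2 / q * (Rpower L (- q) - Rpower (L + INR (S N)) (- q))).
  { induction N.
    - rewrite sum_O. simpl. rewrite Rplus_0_r. apply Rpower_step_lower; assumption.
    - rewrite sum_n_S_R.
      pose proof (Rpower_step_lower (L + INR (S N)) q) as A.
      rewrite (S_INR (S N)), <- Rplus_assoc.
      pose proof (pos_INR (S N)). specialize (A ltac:(lra) Hq). nra. }
  eapply Rle_trans; [exact H|]. apply Rmult_le_compat_l; [lra|].
  pose proof (Rpower_pos (L + INR (S N)) (- q)). lra.
Qed.

(** * The power series of n^p in the unit disc *)

(** The [j]-th forward difference of [x^p]. *)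
Fixpoint dpow (p : R) (j : nat) (x : R) : R :=
  match j with
  | O => Rpower x p
  | S j => dpow p j (x + 1) - dpow p j x
  end.

Lemma dpow_derive p j x : 0 < x -> is_derive (dpow p j) x (p * dpow (p - 1) j x).
Proof.
  revert x. induction j; intros x Hx; simpl.
  - apply is_derive_Reals, derivable_pt_lim_power, Hx.
  - replace (p * (dpow (p - 1) j (x + 1) - dpow (p - 1) j x))
      with (minus (p * dpow (p - 1) j (x + 1)) (p * dpow (p - 1) j x))
      by (unfold minus, plus, opp; simpl; ring).
    apply (is_derive_minus (V := R_NormedModule) (fun x => dpow p j (x + 1)));
      [|apply IHj; assumption].
    replace (p * dpow (p - 1) j (x + 1)) with (scal 1 (p * dpow (p - 1) j (x + 1)))
      by (unfold scal; simpl; unfold mult; simpl; ring).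
    apply (is_derive_comp (V := R_NormedModule) (dpow p j) (fun x => x + 1)).
    + apply IHj; lra.
    + auto_derive; auto.
Qed.

(** Each difference gains a factor [1/x] because a step of length [1] is a
    derivative at an intermediate point, and the derivative of the [j]-th
    difference of [x^p] is the [j]-th difference of [p x^(p-1)]. *)
Lemma dpow_bound j p : exists K, 0 <= K /\
  forall x, 1 <= x -> Rabs (dpow p j x) <= K * Rpower x (p - INR j).
Proof.
  revert p. induction j; intros p.
  - exists 1. split; [lra|]. intros x Hx. simpl.
    rewrite Rabs_pos_eq by (left; apply Rpower_pos). rewrite Rminus_0_r. lra.
  - destruct (IHj (p - 1)) as [K [HK B]].
    exists (Rabs p * (K * Rpower 2 (Rabs (p - 1 - INR j)))). split.
    { repeat apply Rmult_le_pos; auto using Rabs_pos. left; apply Rpower_pos. }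
    intros x Hx. cbn [dpow].
    destruct (MVT_gen (dpow p j) x (x + 1) (fun x => p * dpow (p - 1) j x)) as [c [Hc E]].
    + intros t Ht. rewrite Rmin_left, Rmax_right in Ht by lra. apply dpow_derive; lra.
    + intros t Ht. rewrite Rmin_left, Rmax_right in Ht by lra.
      apply continuity_pt_filterlim, (ex_derive_continuous (V := R_NormedModule)).
      eexists. apply dpow_derive; lra.
    + rewrite Rmin_left, Rmax_right in Hc by lra. rewrite E.
      replace (x + 1 - x) with 1 by ring. rewrite Rmult_1_r, Rabs_mult.
      rewrite !Rmult_assoc. apply Rmult_le_compat_l; [apply Rabs_pos|].
      eapply Rle_trans; [apply B; lra|]. apply Rmult_le_compat_l; [assumption|].
      rewrite S_INR. replace (p - (INR j + 1)) with (p - 1 - INR j) by ring.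
      apply Rpower_double_bound; lra.
Qed.

(** The terms of [sum n^p w^n] of index [L] to [L + N], divided by [w^L], with
    the [j]-th differences of the coefficients in place of the coefficients. *)
Definition pow_tail (p : R) (j : nat) (L : R) (w : C) (N : nat) : C :=
  sum_n (fun i => (RtoC (dpow p j (L + INR i)) * Cpow w i)%C) N.

Lemma pow_tail_by_parts p j L w N :
  ((1 - w) * pow_tail p j L w N =
   RtoC (dpow p j L) - RtoC (dpow p j (L + INR (S N))) * Cpow w (S N)
   + w * pow_tail p (S j) L w N)%C.
Proof.
  unfold pow_tail. induction N.
  - rewrite !sum_O. cbn [dpow INR Cpow]. rewrite Rplus_0_r, RtoC_minus. ring.
  - rewrite !sum_n_S_C, !Cmult_plus_distr_l, IHN.
    rewrite (S_INR (S N)), <- Rplus_assoc. cbn [dpow]. rewrite RtoC_minus.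
    cbn [Cpow]. ring.
Qed.

(** For [1/|1 - w| <= L] every summation by parts costs a factor at most [L]
    and gains a factor [1/L] in the coefficients.  After
    [m > p + 1] steps the coefficients are summable, with sum [O(L^(p-m+1))].
    The boundary terms at [L] are of the expected size [L^(p+1)]; those at the
    far end contain [|w|^N] and are kept explicit. *)
Lemma pow_tail_bound p m k j : 0 < p -> p + 1 < INR m -> (j + k = m)%nat ->
  exists K, 0 <= K /\ forall (L : R) (w : C) (N : nat),
    1 <= L -> Cmod w <= 1 -> / L <= Cmod (1 - w) ->
    Cmod (pow_tail p j L w N) <=
      K * (Rpower L (p - INR j + 1) + L ^ k * (Rpower (L + INR (S N)) p * Cmod w ^ S N)).
Proof.
  intros Hp Hm. revert j. induction k; intros j Hj.
  - destruct (dpow_bound j p) as [K [HK B]].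
    assert (j = m) by lia. subst j.
    set (q := INR m - p - 1). assert (Hq : 0 < q) by (unfold q; lra).
    exists (K * (Rpower 2 q * 2 / q)).
    assert (K2 : 0 <= Rpower 2 q * 2 / q).
    { apply Rlt_le, Rdiv_lt_0_compat; [|assumption]. generalize (Rpower_pos 2 q); lra. }
    split; [now apply Rmult_le_pos|].
    intros L w N HL Hw _. unfold pow_tail.
    apply Rle_trans with (sum_n (fun i => K * Rpower (L + INR i) (- q - 1)) N).
    + apply Cmod_sum_n_le. intros i _. rewrite Cmod_mult, Cmod_R, Cmod_pow.
      rewrite <- (Rmult_1_r (K * _)). apply Rmult_le_compat.
      * apply Rabs_pos.
      * apply pow_le, Cmod_ge_0.
      * replace (- q - 1) with (p - INR m) by (unfold q; ring). apply B.
        generalize (pos_INR i); lra.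
      * rewrite <- (pow1 i). apply pow_incr. split; [apply Cmod_ge_0|assumption].
    + replace (sum_n (fun i => K * Rpower (L + INR i) (- q - 1)) N)
        with (K * sum_n (fun i => Rpower (L + INR i) (- q - 1)) N)
        by (symmetry; apply (sum_n_mult_l (K := R_Ring))).
      rewrite Rmult_assoc. apply Rmult_le_compat_l; [assumption|].
      eapply Rle_trans; [apply sum_Rpower_tail; assumption|].
      apply Rmult_le_compat_l; [assumption|].
      replace (p - INR m + 1) with (- q) by (unfold q; ring).
      assert (0 <= L ^ 0 * (Rpower (L + INR (S N)) p * Cmod w ^ S N)).
      { rewrite pow_O, Rmult_1_l. apply Rmult_le_pos; [left; apply Rpower_pos|].
        apply pow_le, Cmod_ge_0. }
      lra.
  - destruct (IHk (S j) ltac:(lia)) as [K [HK B]].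
    destruct (dpow_bound j p) as [K' [HK' B']].
    exists (K' + K). split; [lra|]. intros L w N HL Hw HD.
    specialize (B L w N HL Hw HD).
    (* Each summation by parts divides by [1 - w], that is multiplies by at most [L]. *)
    assert (DL : 1 <= L * Cmod (1 - w)).
    { apply Rmult_le_compat_l with (r := L) in HD; [|lra]. rewrite Rinv_r in HD by lra. exact HD. }
    set (Ee := Rpower (L + INR (S N)) p * Cmod w ^ S N) in *.
    assert (HE : 0 <= Ee).
    { apply Rmult_le_pos; [left; apply Rpower_pos|]. apply pow_le, Cmod_ge_0. }
    assert (A : Cmod ((1 - w) * pow_tail p j L w N) <=
      K' * Rpower L (p - INR j) + K' * Ee + Cmod (pow_tail p (S j) L w N)).
    { rewrite pow_tail_by_parts. eapply Rle_trans; [apply Cmod_triangle|].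
      apply Rplus_le_compat.
      - eapply Rle_trans; [apply Cmod_minus_triangle|]. apply Rplus_le_compat.
        + rewrite Cmod_R. now apply B'.
        + rewrite Cmod_mult, Cmod_R, Cmod_pow. unfold Ee. rewrite <- Rmult_assoc.
          apply Rmult_le_compat_r; [apply pow_le, Cmod_ge_0|].
          eapply Rle_trans; [apply B'; generalize (pos_INR (S N)); lra|].
          apply Rmult_le_compat_l; [assumption|].
          apply Rle_Rpower; generalize (pos_INR (S N)), (pos_INR j); lra.
      - rewrite Cmod_mult. rewrite <- (Rmult_1_l (Cmod (pow_tail p (S j) L w N))) at 2.
        apply Rmult_le_compat_r; [apply Cmod_ge_0|assumption]. }
    rewrite Cmod_mult in A.
    rewrite S_INR in B. replace (p - (INR j + 1) + 1) with (p - INR j) in B by ring.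
    assert (T : Cmod (pow_tail p j L w N) <=
      L * (K' * Rpower L (p - INR j) + K' * Ee + Cmod (pow_tail p (S j) L w N))).
    { apply Rle_trans with (L * (Cmod (1 - w) * Cmod (pow_tail p j L w N))).
      - rewrite <- Rmult_assoc. rewrite <- (Rmult_1_l (Cmod (pow_tail p j L w N))) at 1.
        apply Rmult_le_compat_r; [apply Cmod_ge_0|assumption].
      - apply Rmult_le_compat_l; [lra|exact A]. }
    eapply Rle_trans; [exact T|].
    replace (Rpower L (p - INR j + 1)) with (L * Rpower L (p - INR j))
      by (rewrite Rpower_plus, Rpower_1 by lra; ring).
    assert (Lk : 1 <= L ^ k) by (apply pow_R1_Rle; lra).
    simpl pow.
    assert (F : K' * Ee <= K' * (L ^ k * Ee)).
    { apply Rmult_le_compat_l; [assumption|]. nra. }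
    replace ((K' + K) * (L * Rpower L (p - INR j) + L * L ^ k * Ee))
      with (L * ((K' + K) * (Rpower L (p - INR j) + L ^ k * Ee))) by ring.
    apply Rmult_le_compat_l; [lra|]. lra.
Qed.

Lemma pow_head_bound p w n l : 0 < p -> Cmod w <= 1 -> (n <= l)%nat ->
  Cmod (sum_n (fun n => (RtoC (Rpower (INR (S n)) p) * Cpow w (S n))%C) n)
    <= Rpower (INR (S l)) (p + 1).
Proof.
  intros Hp Hw Hn.
  apply Rle_trans with (sum_n (fun _ => Rpower (INR (S l)) p) n).
  - apply Cmod_sum_n_le. intros i Hi. rewrite Cmod_scale by (left; apply Rpower_pos).
    rewrite Cmod_pow. rewrite <- (Rmult_1_r (Rpower (INR (S l)) p)). apply Rmult_le_compat.
    + left; apply Rpower_pos.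
    + apply pow_le, Cmod_ge_0.
    + apply Rpower_INR_mono; [lra|lia].
    + rewrite <- (pow1 (S i)). apply pow_incr. split; [apply Cmod_ge_0|assumption].
  - rewrite sum_n_const, Rpower_plus, Rpower_1 by (apply lt_0_INR; lia).
    rewrite Rmult_comm. apply Rmult_le_compat_l; [left; apply Rpower_pos|]. apply le_INR; lia.
Qed.

(** The terms with [n] up to about [1/|1 - w|] are bounded trivially, the others by
    [pow_tail_bound].  The bound concerns the finite sums, so it ends with a
    boundary term that tends to [0] with [N] for every fixed [w] in the open
    disc. *)
Lemma pow_kernel_bound p : 0 < p -> exists K m, 0 <= K /\ forall (w : C) (N : nat),
  Cmod w <= 1 -> 0 < Cmod (1 - w) ->
  Cmod (sum_n (fun n => (RtoC (Rpower (INR (S n)) p) * Cpow w (S n))%C) N) <=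
   K * (Rpower (Cmod (1 - w)) (- (p + 1))
        + (/ Cmod (1 - w)) ^ m * (Rpower (INR (S N) + 1) p * Cmod w ^ S (S N))).
Proof.
  intros Hp. destruct (nfloor_ex (p + 1) ltac:(lra)) as [m0 Hm0].
  set (m := S m0). assert (Hm : p + 1 < INR m) by (unfold m; rewrite S_INR; lra).
  destruct (pow_tail_bound p m m 0 Hp Hm eq_refl) as [K [HK B]].
  exists ((1 + K) * (Rpower 5 (p + 1) + 5 ^ m)), m.
  assert (P3 : 0 < Rpower 5 (p + 1)) by apply Rpower_pos.
  assert (Q3 : 0 < 5 ^ m) by (apply pow_lt; lra).
  split; [apply Rmult_le_pos; lra|].
  intros w N Hw HD. set (D := Cmod (1 - w)) in *.
  assert (D2 : D <= 2).
  { unfold D. eapply Rle_trans; [apply Cmod_minus_triangle|]. rewrite Cmod_1; lra. }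
  assert (iD : 0 < / D) by (apply Rinv_0_lt_compat; assumption).
  assert (iD2 : / 2 <= / D) by (apply Rinv_le_contravar; lra).
  (* The cut [l + 2] lies between [1/D] and [5/D], as [D <= 2]. *)
  destruct (nfloor_ex (/ D) ltac:(lra)) as [l [Hl1 Hl2]].
  set (Ee := Rpower (INR (S N) + 1) p * Cmod w ^ S (S N)).
  assert (HE : 0 <= Ee).
  { apply Rmult_le_pos; [left; apply Rpower_pos|]. apply pow_le, Cmod_ge_0. }
  set (L := INR (S (S l))).
  assert (HL : 1 <= L) by (unfold L; rewrite !S_INR; generalize (pos_INR l); lra).
  assert (L3 : L <= 5 * / D) by (unfold L; rewrite !S_INR; lra).
  assert (LD : / L <= D).
  { rewrite <- (Rinv_inv D). apply Rinv_le_contravar; [assumption|]. unfold L; rewrite !S_INR; lra. }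
  assert (G : Cmod (sum_n (fun n => (RtoC (Rpower (INR (S n)) p) * Cpow w (S n))%C) N) <=
    (1 + K) * (Rpower L (p + 1) + L ^ m * Ee)).
  { assert (PL : 0 < Rpower L (p + 1)) by apply Rpower_pos.
    assert (QL : 0 <= L ^ m * Ee) by (apply Rmult_le_pos; [apply pow_le; lra|assumption]).
    destruct (le_lt_dec N l) as [HN|HN].
    - eapply Rle_trans; [apply (pow_head_bound p w N l Hp Hw HN)|].
      assert (Rpower (INR (S l)) (p + 1) <= Rpower L (p + 1)) by (apply Rpower_INR_mono; [lra|lia]).
      nra.
    - assert (HN' : N = (l + S (N - S l))%nat) by lia.
      set (i := (N - S l)%nat) in *. rewrite HN', sum_n_split.
      eapply Rle_trans; [apply Cmod_triangle|].
      assert (T : sum_n (fun k => (RtoC (Rpower (INR (S (S l + k))) p) * Cpow w (S (S l + k)))%C) i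
        = (Cpow w (S (S l)) * pow_tail p 0 L w i)%C :> C).
      { unfold pow_tail. rewrite <- sum_n_Cmult_l. apply sum_n_ext. intros k.
        replace (S (S l + k)) with (S (S l) + k)%nat by lia.
        rewrite Cpow_add_r. cbn [dpow]. unfold L. rewrite <- plus_INR. Cring. }
      rewrite T, Cmod_mult, Cmod_pow.
      pose proof (pow_head_bound p w l l Hp Hw (Nat.le_refl _)) as A1.
      assert (A2 : Rpower (INR (S l)) (p + 1) <= Rpower L (p + 1)) by (apply Rpower_INR_mono; [lra|lia]).
      specialize (B L w i HL Hw LD). simpl INR in B at 1. rewrite Rminus_0_r in B.
      assert (E1 : Cmod w ^ S (S l) * (L ^ m * (Rpower (L + INR (S i)) p * Cmod w ^ S i)) = L ^ m * Ee).
      { unfold Ee. replace (S (S N)) with (S (S l) + S i)%nat by lia. rewrite pow_add.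
        replace (INR (S N) + 1) with (L + INR (S i)); [ring|].
        unfold L. rewrite <- plus_INR, <- S_INR. f_equal. lia. }
      assert (W0 : 0 <= Cmod w ^ S (S l)) by (apply pow_le, Cmod_ge_0).
      assert (W1 : Cmod w ^ S (S l) <= 1).
      { rewrite <- (pow1 (S (S l))). apply pow_incr. split; [apply Cmod_ge_0|assumption]. }
      apply Rmult_le_compat_l with (r := Cmod w ^ S (S l)) in B; [|assumption].
      assert (E2 : Cmod w ^ S (S l) * Rpower L (p + 1) <= Rpower L (p + 1)) by nra.
      assert (E3 : Cmod w ^ S (S l) * (K * (Rpower L (p + 1) + L ^ m * (Rpower (L + INR (S i)) p * Cmod w ^ S i)))
         <= K * (Rpower L (p + 1) + L ^ m * Ee)).
      { rewrite <- E1. apply Rle_trans with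
          (K * (Cmod w ^ S (S l) * Rpower L (p + 1)
                + Cmod w ^ S (S l) * (L ^ m * (Rpower (L + INR (S i)) p * Cmod w ^ S i)))); [right; ring|].
        apply Rmult_le_compat_l; lra. }
      nra. }
  eapply Rle_trans; [exact G|]. rewrite Rmult_assoc. apply Rmult_le_compat_l; [lra|].
  assert (A1 : Rpower L (p + 1) <= Rpower 5 (p + 1) * Rpower D (- (p + 1))).
  { rewrite <- Rpower_inv_l, Rpower_mult_distr by lra. apply Rle_Rpower_l; lra. }
  assert (A2 : L ^ m <= 5 ^ m * (/ D) ^ m).
  { rewrite <- Rpow_mult_distr. apply pow_incr; lra. }
  assert (A3 : L ^ m * Ee <= 5 ^ m * (/ D) ^ m * Ee) by (apply Rmult_le_compat_r; assumption).
  assert (P4 : 0 < Rpower D (- (p + 1))) by apply Rpower_pos.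
  assert (P5 : 0 <= (/ D) ^ m * Ee) by (apply Rmult_le_pos; [apply pow_le; lra|assumption]).
  replace ((Rpower 5 (p + 1) + 5 ^ m) * (Rpower D (- (p + 1)) + (/ D) ^ m * Ee))
    with (Rpower 5 (p + 1) * Rpower D (- (p + 1)) + 5 ^ m * (/ D) ^ m * Ee
          + (Rpower 5 (p + 1) * ((/ D) ^ m * Ee) + 5 ^ m * Rpower D (- (p + 1)))) by ring.
  nra.
Qed.

(** From [sin x >= x - x^3 / 6] and [x <= 2]. *)
Lemma sin_ge_third x : 0 <= x <= PI / 2 -> x / 3 <= sin x.
Proof.
  intros [H1 H2]. assert (H3 : x <= 2) by (generalize PI_4; lra).
  destruct (SIN x H1 ltac:(lra)) as [H _].
  eapply Rle_trans; [|exact H]. unfold sin_lb, sin_approx, sin_term; simpl.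
  assert (0 <= x * x <= 4) by nra.
  assert (0 <= x * (x * x) * (x * x) * (42 - x * x)) by (repeat apply Rmult_le_pos; nra).
  field_simplify. nra.
Qed.

(** With [r = exp (- 2 PI y)], the square of the distance from [r e(-t)] to [1]
    is [(1 - r)^2 + 4 r sin^2 (PI t)], where [1 - r] is at least a multiple of
    [y] and [|sin (PI t)|] is at least [|t|]. *)
Lemma dist_to_one y t : 0 < y <= 1 -> Rabs t <= / 2 ->
  exp (- 2 * PI) / 2 * (y + Rabs t)
    <= Cmod (1 - RtoC (exp (- 2 * PI * y)) * e (- t)).
Proof.
  intros Hy Ht. pose proof PI_RGT_0 as HPI. pose proof PI_4 as HPI4.
  assert (PI2 : 2 <= PI) by (generalize PI2_1; lra).
  set (r0 := exp (- 2 * PI)). set (r := exp (- 2 * PI * y)).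
  assert (Hr0 : 0 < r0) by apply exp_pos.
  assert (Hr01 : r0 <= 1).
  { unfold r0. rewrite <- exp_0. destruct (Req_dec (-2 * PI) 0) as [->|]; [lra|].
    left; apply exp_increasing; lra. }
  assert (Hr : r0 <= r).
  { unfold r0, r. destruct (Req_dec y 1) as [->|]; [right; f_equal; ring|].
    left; apply exp_increasing; nra. }
  assert (Hy1 : r0 * y <= 1 - r).
  { pose proof (exp_ineq1_le (2 * PI * y)) as G.
    assert (I : r * exp (2 * PI * y) = 1).
    { unfold r. rewrite <- exp_plus. replace (-2 * PI * y + 2 * PI * y) with 0 by ring. apply exp_0. }
    assert (0 < r) by apply exp_pos.
    assert (r * (1 + 2 * PI * y) <= 1) by (rewrite <- I; apply Rmult_le_compat_l; lra).
    assert (r0 * y <= r * y) by (apply Rmult_le_compat_r; lra).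
    assert (r * y <= r * (2 * PI * y)) by (apply Rmult_le_compat_l; nra).
    lra. }
  assert (Hs : Rabs t * Rabs t <= sin (PI * t) * sin (PI * t)).
  { assert (A : Rabs t <= Rabs (sin (PI * t))).
    { destruct (Rle_lt_dec 0 t) as [Hp|Hp].
      - rewrite (Rabs_pos_eq t) in * by lra.
        assert (B : PI * t / 3 <= sin (PI * t)) by (apply sin_ge_third; nra).
        destruct (Rle_lt_dec 3 PI) as [P3|P3].
        + rewrite Rabs_pos_eq; nra.
        + exfalso. generalize PI2_3_2. lra.
      - rewrite (Rabs_left t) in * by lra.
        assert (B : PI * (- t) / 3 <= sin (PI * (- t))) by (apply sin_ge_third; nra).
        replace (PI * - t) with (- (PI * t)) in B by ring. rewrite sin_neg in B.
        assert (P3 : 3 < PI) by (generalize PI2_3_2; lra).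
        rewrite Rabs_left; nra. }
    pose proof (Rabs_pos t). 
    replace (sin (PI * t) * sin (PI * t)) with (Rabs (sin (PI * t)) * Rabs (sin (PI * t))).
    - nra.
    - rewrite <- Rabs_mult. apply Rabs_pos_eq. nra. }
  apply Rsqr_incr_0_var; [|apply Cmod_ge_0].
  unfold Rsqr, Cmod. rewrite sqrt_sqrt by (apply Rplus_le_le_0_compat; apply pow2_ge_0).
  unfold e; cbn [fst snd Cminus Cplus Copp Cmult RtoC].
  replace (2 * PI * - t) with (- (2 * (PI * t))) by ring.
  rewrite cos_neg, sin_neg, cos_2a_sin, sin_2a.
  pose proof (sin2_cos2 (PI * t)) as SC. unfold Rsqr in SC.
  set (sn := sin (PI * t)) in *. set (cn := cos (PI * t)) in *.
  assert (Q : (1 + - (r * (1 - 2 * sn * sn) - 0 * - (2 * sn * cn))) ^ 2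
    + (0 + - (r * - (2 * sn * cn) + 0 * (1 - 2 * sn * sn))) ^ 2
    = (1 - r) ^ 2 + 4 * r * (sn * sn) + 4 * r * r * sn * sn * (sn * sn + cn * cn - 1)).
  { ring. }
  (* The last term of [Q] vanishes by [SC]; it makes [Q] an identity of polynomials. *)
  rewrite Q, SC. pose proof (Rabs_pos t) as At.
  assert (r0 * y * (r0 * y) <= (1 - r) ^ 2) by (simpl; rewrite Rmult_1_r; apply Rmult_le_compat; nra).
  assert (r0 * r0 * (Rabs t * Rabs t) <= 4 * r * (sn * sn)).
  { apply Rmult_le_compat; nra. }
  nra.
Qed.

(** * Approximation of polynomials by trigonometric polynomials *)

(** Only nonnegative frequencies occur; they suffice, as powers of [e t - 1]
    already do.  The generation by the shift makes closure under products and
    the pairing with a kernel plain inductions. *)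
Inductive trig_poly : (R -> C) -> Prop :=
| trig_const c : trig_poly (fun _ => c)
| trig_shift f : trig_poly f -> trig_poly (fun t => (e t * f t)%C)
| trig_plus f g : trig_poly f -> trig_poly g -> trig_poly (fun t => (f t + g t)%C)
| trig_ext f g : (forall t, f t = g t) -> trig_poly f -> trig_poly g.

Lemma trig_scal c f : trig_poly f -> trig_poly (fun t => (c * f t)%C).
Proof.
  induction 1 as [d|f Hf IH|f g Hf IHf Hg IHg|f g E Hf IH].
  - apply trig_const.
  - apply trig_ext with (fun t => (e t * (c * f t))%C); [intros; ring|]. now apply trig_shift.
  - apply trig_ext with (fun t => (c * f t + c * g t)%C); [intros; ring|]. now apply trig_plus.
  - apply trig_ext with (2 := IH). intros; now rewrite E.
Qed.

Lemma trig_mult f g : trig_poly f -> trig_poly g -> trig_poly (fun t => (f t * g t)%C).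
Proof.
  intros H Hg. induction H as [d|f Hf IH|f1 f2 Hf1 IH1 Hf2 IH2|f1 f2 E Hf IH].
  - now apply trig_scal.
  - apply trig_ext with (fun t => (e t * (f t * g t))%C); [intros; ring|]. now apply trig_shift.
  - apply trig_ext with (fun t => (f1 t * g t + f2 t * g t)%C); [intros; ring|]. now apply trig_plus.
  - apply trig_ext with (2 := IH). intros; now rewrite E.
Qed.

Lemma trig_sum (f : nat -> R -> C) N :
  (forall n, trig_poly (f n)) -> trig_poly (fun t => sum_n (fun n => f n t) N).
Proof.
  intros H. induction N.
  - apply trig_ext with (f 0%nat); auto. intros; now rewrite sum_O.
  - apply trig_ext with (fun t => (sum_n (fun n => f n t) N + f (S N) t)%C).
    + intros; now rewrite sum_n_S_C.
    + now apply trig_plus.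
Qed.

Lemma trig_continuous f : trig_poly f -> forall x : R, continuous f x.
Proof.
  induction 1 as [d|f Hf IH|f1 f2 Hf1 IH1 Hf2 IH2|f1 f2 E Hf IH]; intros x.
  - apply continuous_const.
  - apply continuous_Cmult; [|apply IH]. eapply derivC_continuous, derivC_e1.
  - now apply continuous_Cplus.
  - apply continuous_ext with f1; auto.
Qed.

Lemma trig_bounded f : trig_poly f -> exists B, forall t, Cmod (f t) <= B.
Proof.
  induction 1 as [d|f Hf [B IH]|f1 f2 Hf1 [B1 IH1] Hf2 [B2 IH2]|f1 f2 E Hf [B IH]].
  - exists (Cmod d). intros; lra.
  - exists B. intros t. now rewrite Cmod_mult, Cmod_e, Rmult_1_l.
  - exists (B1 + B2). intros t. eapply Rle_trans; [apply Cmod_triangle|].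
    now apply Rplus_le_compat.
  - exists B. intros t. now rewrite <- E.
Qed.

(** Boundedness is part of the definition to make the class closed under
    products. *)
Definition trig_approx (D : nat) (h : R -> C) : Prop :=
  (exists B, forall t, Rabs t <= / 2 -> Cmod (h t) <= B) /\
  exists Q M, trig_poly Q /\ forall t, Rabs t <= / 2 -> Cmod (h t - Q t) <= M * Rabs t ^ D.

Lemma trig_approx_const D c : trig_approx D (fun _ => c).
Proof.
  split; [exists (Cmod c); intros; lra|].
  exists (fun _ => c), 0. split; [apply trig_const|]. intros t _.
  replace (c - c)%C with (RtoC 0) by ring. rewrite Cmod_0. lra.
Qed.

Lemma trig_approx_plus D f g :
  trig_approx D f -> trig_approx D g -> trig_approx D (fun t => (f t + g t)%C).
Proof.
  intros [[B1 H1] (Q1 & M1 & T1 & E1)] [[B2 H2] (Q2 & M2 & T2 & E2)]. split.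
  - exists (B1 + B2). intros t Ht. eapply Rle_trans; [apply Cmod_triangle|].
    specialize (H1 t Ht). specialize (H2 t Ht). lra.
  - exists (fun t => (Q1 t + Q2 t)%C), (M1 + M2). split; [now apply trig_plus|]. intros t Ht.
    replace (f t + g t - (Q1 t + Q2 t))%C with ((f t - Q1 t) + (g t - Q2 t))%C by ring.
    eapply Rle_trans; [apply Cmod_triangle|].
    specialize (E1 t Ht). specialize (E2 t Ht). lra.
Qed.

Lemma trig_approx_mult D f g :
  trig_approx D f -> trig_approx D g -> trig_approx D (fun t => (f t * g t)%C).
Proof.
  intros [[B1 H1] (Q1 & M1 & T1 & E1)] [[B2 H2] (Q2 & M2 & T2 & E2)]. split.
  - exists (B1 * B2). intros t Ht. rewrite Cmod_mult.
    apply Rmult_le_compat; auto using Cmod_ge_0.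
  - destruct (trig_bounded Q1 T1) as [B HB].
    exists (fun t => (Q1 t * Q2 t)%C), (M1 * B2 + B * M2). split; [now apply trig_mult|]. intros t Ht.
    replace (f t * g t - Q1 t * Q2 t)%C with ((f t - Q1 t) * g t + Q1 t * (g t - Q2 t))%C by ring.
    eapply Rle_trans; [apply Cmod_triangle|]. rewrite !Cmod_mult.
    rewrite Rmult_plus_distr_r. apply Rplus_le_compat.
    + replace (M1 * B2 * Rabs t ^ D) with (M1 * Rabs t ^ D * B2) by ring.
      apply Rmult_le_compat; auto using Cmod_ge_0.
    + rewrite Rmult_assoc. apply Rmult_le_compat; auto using Cmod_ge_0.
Qed.

(** The Taylor polynomial of [log (1 + u)] at [u = e t - 1]. *)
Definition log_poly (D : nat) (t : R) : C :=
  sum_n (fun k => (RtoC ((-1) ^ k / INR (S k)) * Cpow (e t - 1) (S k))%C) D.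

Lemma trig_log_poly D : trig_poly (log_poly D).
Proof.
  apply trig_sum. intros k. apply trig_scal.
  assert (U : trig_poly (fun t => (e t - 1)%C)).
  { apply trig_ext with (fun t => (e t * 1 + - (1))%C); [intros; ring|].
    apply trig_plus; [apply trig_shift|]; apply trig_const. }
  induction (S k) as [|n IHn].
  - apply trig_ext with (fun _ => RtoC 1); [reflexivity|apply trig_const].
  - cbn [Cpow]. now apply trig_mult.
Qed.

Lemma alternating_geometric (u : C) D :
  ((1 + u) * sum_n (fun k => (RtoC ((-1) ^ k) * Cpow u k)%C) D
   = 1 + RtoC ((-1) ^ D) * Cpow u (S D))%C.
Proof.
  induction D.
  - rewrite sum_O. simpl. ring.
  - rewrite sum_n_S_C, Cmult_plus_distr_l, IHD. cbn [pow Cpow]. rewrite RtoC_mult.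
    replace (RtoC (-1)) with (- (1))%C by (rewrite <- RtoC_opp; reflexivity). ring.
Qed.

(** The derivative of the Taylor polynomial of the logarithm is a geometric sum,
    and [u' = 2 i pi (1 + u)] for [u = e t - 1], so that the derivative is
    [2 i pi] up to [O(|u|^(D+1))]. *)
Lemma derivC_log_poly D x :
  derivC (log_poly D) x (freq 1 * (1 + RtoC ((-1) ^ D) * Cpow (e x - 1) (S D)))%C.
Proof.
  assert (U : derivC (fun t => (e t - 1)%C) x (freq 1 * e x)%C).
  { evar_last.
    - apply (is_derive_minus (V := C_R_NormedModule) e (fun _ => RtoC 1)); [apply derivC_e1|apply derivC_const].
    - change (freq 1 * e x - RtoC 0 = freq 1 * e x)%C. ring. }
  rewrite <- alternating_geometric. unfold log_poly. evar_last.
  - apply (derivC_sum (fun k t => (RtoC ((-1) ^ k / INR (S k)) * Cpow (e t - 1) (S k))%C)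
      (fun k x => (RtoC ((-1) ^ k / INR (S k)) *
         (RtoC (INR (S k)) * Cpow (e x - 1) k * (freq 1 * e x)))%C)).
    intros k. apply derivC_Cmult_l, (derivC_pow (fun t => (e t - 1)%C)), U.
  - replace (freq 1 * ((1 + (e x - 1)) * sum_n (fun k => RtoC ((-1) ^ k) * Cpow (e x - 1) k) D))%C
      with ((freq 1 * e x) * sum_n (fun k => RtoC ((-1) ^ k) * Cpow (e x - 1) k) D)%C by ring.
    rewrite <- sum_n_Cmult_l. apply sum_n_ext. intros k.
    unfold Rdiv. rewrite RtoC_mult.
    assert (I : (RtoC (/ INR (S k)) * RtoC (INR (S k)) = 1)%C).
    { rewrite <- RtoC_mult, Rinv_l by (apply not_0_INR; lia). reflexivity. }
    transitivity (RtoC ((-1) ^ k) * (RtoC (/ INR (S k)) * RtoC (INR (S k))) * (Cpow (e x - 1) k * (freq 1 * e x)))%C;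
      [Cring|]. rewrite I. Cring.
Qed.

(** Since [2 i pi t = log (1 + u)] with [u = e t - 1], the Taylor polynomial of
    the logarithm, divided by [2 i pi], approximates [t]. *)
Lemma trig_approx_id D : trig_approx D RtoC.
Proof.
  split; [exists (/ 2); intros t Ht; now rewrite Cmod_R|].
  pose proof PI_RGT_0 as HPI.
  assert (F1 : freq 1 <> RtoC 0) by (apply freq_neq_0; lra).
  exists (fun t => (/ freq 1 * log_poly D t)%C), (2 * (4 * PI) ^ S D).
  split; [apply trig_scal, trig_log_poly|]. intros t Ht.
  replace (RtoC t - / freq 1 * log_poly D t)%C
    with (- (/ freq 1 * (log_poly D t + - freq 1 * RtoC t)))%C
    by (field; exact F1).
  rewrite Cmod_opp, Cmod_mult, Cmod_inv by exact F1.
  (* [log_poly D t - 2 i pi t] vanishes at [0] and its derivative is [O(|t|^(D+1))]. *)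
  assert (A : Cmod (log_poly D t + - freq 1 * RtoC t) <= 2 * (2 * PI * (4 * PI * Rabs t) ^ S D) * Rabs t).
  { assert (Z : (log_poly D 0 + - freq 1 * RtoC 0 = RtoC 0)%C).
    { assert (S0 : forall N, sum_n (fun _ : nat => RtoC 0) N = RtoC 0 :> C).
      { induction N; [now rewrite sum_O|]. rewrite sum_n_S_C, IHN. Cring. }
      unfold log_poly. rewrite (sum_n_ext _ (fun _ => RtoC 0)); [rewrite S0; ring|].
      intros k. rewrite e_0. cbn [Cpow]. Cring. }
    replace (log_poly D t + - freq 1 * RtoC t)%C
      with (log_poly D t + - freq 1 * RtoC t - (log_poly D 0 + - freq 1 * RtoC 0))%C by (rewrite Z; ring).
    eapply Rle_trans.
    - apply (mean_value_C (fun t => log_poly D t + - freq 1 * RtoC t)%C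
        (fun x => freq 1 * (1 + RtoC ((-1) ^ D) * Cpow (e x - 1) (S D)) + - freq 1 * 1)%C
        (2 * PI * (4 * PI * Rabs t) ^ S D)).
      intros x Hx. rewrite !Rminus_0_r in Hx. split.
      + apply derivC_Cplus; [apply derivC_log_poly|]. apply derivC_Cmult_l.
        apply derivC_components. simpl. split; auto_derive; auto.
      + replace (freq 1 * (1 + RtoC ((-1) ^ D) * Cpow (e x - 1) (S D)) + - freq 1 * 1)%C
          with (freq 1 * (RtoC ((-1) ^ D) * Cpow (e x - 1) (S D)))%C by ring.
        rewrite !Cmod_mult, Cmod_freq, Cmod_R, pow_1_abs, Rmult_1_l, Rabs_R1, Rmult_1_r, Cmod_pow.
        apply Rmult_le_compat_l; [lra|]. apply pow_incr. split; [apply Cmod_ge_0|].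
        eapply Rle_trans; [apply Cmod_e_minus_1|]. apply Rmult_le_compat_l; lra.
    - rewrite Rminus_0_r. lra. }
  rewrite Cmod_freq, Rabs_R1, Rmult_1_r.
  apply Rle_trans with (/ (2 * PI) * (2 * (2 * PI * (4 * PI * Rabs t) ^ S D) * Rabs t)).
  - apply Rmult_le_compat_l; [|exact A]. left; apply Rinv_0_lt_compat; lra.
  - rewrite Rpow_mult_distr. simpl (Rabs t ^ S D).
    pose proof (Rabs_pos t). pose proof (pow_le (Rabs t) D (Rabs_pos t)).
    pose proof (pow_le (4 * PI) (S D) ltac:(lra)).
    replace (/ (2 * PI) * (2 * (2 * PI * ((4 * PI) ^ S D * (Rabs t * Rabs t ^ D))) * Rabs t))
      with (2 * (4 * PI) ^ S D * (Rabs t ^ D * (Rabs t * Rabs t))) by (field; lra).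
    apply Rmult_le_compat_l; [lra|].
    rewrite <- (Rmult_1_r (Rabs t ^ D)) at 2. apply Rmult_le_compat_l; [assumption|]. nra.
Qed.

(** The functions with a good approximation form an algebra that contains the
    constants and the identity. *)
Lemma trig_approx_poly D (p : nat -> C) d :
  trig_approx D (fun t => sum_n (fun j => (p j * Cpow (RtoC t) j)%C) d).
Proof.
  assert (X : forall f g, (forall t, f t = g t) -> trig_approx D f -> trig_approx D g).
  { intros f g E [[B H] (Q & M & T & K)]. split.
    - exists B. intros t Ht. rewrite <- E. auto.
    - exists Q, M. split; [assumption|]. intros t Ht. rewrite <- E. auto. }
  assert (Mn : forall j, trig_approx D (fun t => Cpow (RtoC t) j)).
  { induction j; [apply (trig_approx_const D (RtoC 1))|]. cbn [Cpow].
    apply trig_approx_mult; [apply trig_approx_id|exact IHj]. }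
  assert (Mp : forall j, trig_approx D (fun t => (p j * Cpow (RtoC t) j)%C)).
  { intros j. apply (trig_approx_mult D (fun _ => p j)); [apply trig_approx_const|apply Mn]. }
  induction d.
  - apply X with (2 := Mp 0%nat). intros; now rewrite sum_O.
  - apply X with (fun t => (sum_n (fun j => (p j * Cpow (RtoC t) j)%C) d + p (S d) * Cpow (RtoC t) (S d))%C).
    + intros; now rewrite sum_n_S_C.
    + now apply trig_approx_plus.
Qed.

(** * Absolutely convergent Fourier series *)

Definition fourier_sum (bp bm : nat -> C) (N : nat) (t : R) : C :=
  (sum_n (fun n => bp n * e (INR (S n) * t)) N + sum_n (fun n => bm n * e (- INR (S n) * t)) N)%C.

(** The frequencies [n + 1] carry [bp n] and the frequencies [-(n + 1)] carry
    [bm n]; the frequency [0] is absent from [f_alpha]. *)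
Definition fourier (bp bm : nat -> C) (t : R) : C :=
  (CSeries (fun n => bp n * e (INR (S n) * t)) + CSeries (fun n => bm n * e (- INR (S n) * t)))%C.

Lemma fourier_opp bp bm t : fourier bm bp t = fourier bp bm (- t).
Proof.
  unfold fourier. rewrite Cplus_comm. f_equal; f_equal; apply functional_extensionality;
    intros n; do 2 f_equal; ring.
Qed.

Lemma fourier_uniform bp bm :
  ex_series (fun n => Cmod (bp n)) -> ex_series (fun n => Cmod (bm n)) ->
  exists tau, is_lim_seq tau 0 /\
    forall N t, Cmod (fourier bp bm t - fourier_sum bp bm N t) <= tau N.
Proof.
  intros Hp Hm.
  exists (fun n => (Series (fun n => Cmod (bp n)) - sum_n (fun n => Cmod (bp n)) n)
       + (Series (fun n => Cmod (bm n)) - sum_n (fun n => Cmod (bm n)) n)).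
  split.
  - rewrite <- (Rplus_0_r 0). apply is_lim_seq_plus'; now apply series_tail_lim.
  - intros N t.
    destruct (CSeries_dominated (fun n => bp n * e (INR (S n) * t))%C (fun n => Cmod (bp n))) as [_ A]; auto.
    { intros k. rewrite Cmod_mult, Cmod_e. lra. }
    destruct (CSeries_dominated (fun n => bm n * e (- INR (S n) * t))%C (fun n => Cmod (bm n))) as [_ B]; auto.
    { intros k. rewrite Cmod_mult, Cmod_e. lra. }
    specialize (A N). specialize (B N). unfold fourier, fourier_sum.
    match goal with |- Cmod (?a + ?b - (?c + ?d)) <= _ =>
      replace (a + b - (c + d))%C with ((a - c) + (b - d))%C by ring end.
    eapply Rle_trans; [apply Cmod_triangle|]. now apply Rplus_le_compat.
Qed.

Lemma fourier_sum_continuous bp bm N (t : R) : continuous (fourier_sum bp bm N) t.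
Proof.
  apply continuous_Cplus; apply continuous_sum_C; intros n;
    (apply continuous_Cmult; [apply continuous_const|apply continuous_e]).
Qed.

Lemma fourier_continuous bp bm :
  ex_series (fun n => Cmod (bp n)) -> ex_series (fun n => Cmod (bm n)) ->
  forall t : R, continuous (fourier bp bm) t.
Proof.
  intros Hp Hm. destruct (fourier_uniform bp bm Hp Hm) as [tau [Ht B]].
  apply (continuous_uniform_limit (fourier_sum bp bm) _ tau); auto using fourier_sum_continuous.
Qed.

Lemma fourier_sum_coefficient bp bm n N : (n <= N)%nat ->
  RIntC (fun t => (fourier_sum bp bm N t * e (- INR (S n) * t))%C) (- / 2) (/ 2) (bp n).
Proof.
  intros Hn.
  apply RIntC_ext with (fun t =>
    (sum_n (fun k => bp k * e (IZR (Z.of_nat k - Z.of_nat n) * t))%C N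
     + sum_n (fun k => bm k * e (IZR (- Z.of_nat (S k) - Z.of_nat (S n)) * t))%C N)%C).
  { intros t. unfold fourier_sum. rewrite Cmult_plus_distr_r, !(Cmult_comm _ (e _)).
    rewrite <- !sum_n_Cmult_l. f_equal; apply sum_n_ext; intros k.
    - replace (IZR (Z.of_nat k - Z.of_nat n) * t) with (- INR (S n) * t + INR (S k) * t).
      + rewrite e_plus. Cring.
      + rewrite minus_IZR, <- !INR_IZR_INZ, !S_INR. ring.
    - replace (IZR (- Z.of_nat (S k) - Z.of_nat (S n)) * t) with (- INR (S n) * t + - INR (S k) * t).
      + rewrite e_plus. Cring.
      + rewrite minus_IZR, opp_IZR, <- !INR_IZR_INZ. ring. }
  replace (bp n) with (sum_n (fun k => if Nat.eq_dec k n then bp n else RtoC 0) N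
     + sum_n (fun k => RtoC 0 * bp n)%C N)%C.
  - apply RIntC_Cplus; apply RIntC_sum; intros k _.
    + evar_last; [apply RIntC_Cmult_l, RIntC_e_integer|].
      destruct (Z.eq_dec (Z.of_nat k - Z.of_nat n) 0) as [E|E], (Nat.eq_dec k n) as [F|F]; try lia.
      * subst; Cring.
      * Cring.
    + evar_last; [apply RIntC_Cmult_l, RIntC_e_integer|].
      destruct (Z.eq_dec (- Z.of_nat (S k) - Z.of_nat (S n)) 0) as [E|E]; [lia|]. Cring.
  - rewrite sum_n_delta, sum_n_Cmult_l. destruct (le_lt_dec n N); [ring|lia].
Qed.

(** Orthogonality for the partial sums, then passage to the uniform limit. *)
Lemma fourier_coefficient bp bm n :
  ex_series (fun n => Cmod (bp n)) -> ex_series (fun n => Cmod (bm n)) ->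
  RIntC (fun t => (fourier bp bm t * e (- INR (S n) * t))%C) (- / 2) (/ 2) (bp n).
Proof.
  intros Hp Hm. destruct (fourier_uniform bp bm Hp Hm) as [tau [Ht B]].
  destruct (RIntC_continuous (fun t => (fourier bp bm t * e (- INR (S n) * t))%C) (- / 2) (/ 2)) as [l Hl].
  { intros t. apply continuous_Cmult; [now apply fourier_continuous|apply continuous_e]. }
  replace (bp n) with l; [exact Hl|].
  assert (D : forall N, (n <= N)%nat -> Cmod (l - bp n) <= tau N).
  { intros N HN.
    assert (I : RIntC (fun t => (fourier bp bm t * e (- INR (S n) * t)
              + - (1) * (fourier_sum bp bm N t * e (- INR (S n) * t)))%C) (- / 2) (/ 2) (l + - (1) * bp n)%C).
    { apply RIntC_Cplus; [exact Hl|]. apply RIntC_Cmult_l. now apply fourier_sum_coefficient. }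
    replace (l - bp n)%C with (l + - (1) * bp n)%C by ring.
    replace (tau N) with ((/ 2 - - / 2) * tau N) by field.
    apply (RIntC_bound_const _ (tau N)) with (3 := I); [lra|].
    intros t _.
    replace (fourier bp bm t * e (- INR (S n) * t) + - (1) * (fourier_sum bp bm N t * e (- INR (S n) * t)))%C
      with ((fourier bp bm t - fourier_sum bp bm N t) * e (- INR (S n) * t))%C by ring.
    rewrite Cmod_mult, Cmod_e, Rmult_1_r. apply B. }
  assert (Z : Cmod (l - bp n) <= 0).
  { apply (is_lim_seq_le_loc (fun _ => Cmod (l - bp n)) tau (Cmod (l - bp n)) 0).
    - exists n; exact D.
    - apply is_lim_seq_const.
    - exact Ht. }
  assert (E : (l - bp n)%C = RtoC 0) by (apply Cmod_eq_0; generalize (Cmod_ge_0 (l - bp n)); lra).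
  replace l with ((l - bp n) + bp n)%C by ring. rewrite E. Cring.
Qed.

(** Pairing with this kernel over a period extracts a linear combination of the
    coefficients at positive frequencies. *)
Definition dual_kernel (c : nat -> C) (N : nat) (t : R) : C :=
  sum_n (fun n => (c n * e (- INR (S n) * t))%C) N.

Lemma dual_kernel_continuous c N (t : R) : continuous (dual_kernel c N) t.
Proof.
  apply continuous_sum_C; intros n;
    (apply continuous_Cmult; [apply continuous_const|apply continuous_e]).
Qed.

Lemma fourier_pairing bp bm c N :
  ex_series (fun n => Cmod (bp n)) -> ex_series (fun n => Cmod (bm n)) ->
  RIntC (fun t => (fourier bp bm t * dual_kernel c N t)%C) (- / 2) (/ 2)
    (sum_n (fun n => (c n * bp n)%C) N).
Proof.
  intros Hp Hm.
  apply RIntC_ext with (fun t => sum_n (fun n => (c n * (fourier bp bm t * e (- INR (S n) * t)))%C) N).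
  { intros t. unfold dual_kernel. rewrite <- sum_n_Cmult_l. apply sum_n_ext. intros n. Cring. }
  apply RIntC_sum. intros n _. apply RIntC_Cmult_l. now apply fourier_coefficient.
Qed.

(** The bound does not depend on [N], nor on [c] beyond [beta]: the integral
    picks the coefficients of the kernel at the finitely many frequencies of
    [Q].  The factor [e (INR j * t)] is there for the induction on [Q]. *)
Lemma trig_pairing (beta : nat -> R) Q : trig_poly Q -> forall j, exists B, forall c N,
  (forall n, Cmod (c n) <= beta n) ->
  exists l, RIntC (fun t => (Q t * e (INR j * t) * dual_kernel c N t)%C) (- / 2) (/ 2) l /\ Cmod l <= B.
Proof.
  induction 1 as [d|f Hf IH|f g Hf IHf Hg IHg|f g E Hf IH]; intros j.
  - exists (Cmod d * beta (pred j)). intros c N Hc.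
    exists (d * (if Nat.eq_dec j 0 then RtoC 0 else if le_lt_dec (pred j) N then c (pred j) else RtoC 0))%C. split.
    + apply RIntC_ext with (fun t => (d * sum_n (fun n => (c n * e (IZR (Z.of_nat j - Z.of_nat (S n)) * t))%C) N)%C).
      { intros t. unfold dual_kernel. rewrite <- Cmult_assoc. f_equal.
        rewrite <- sum_n_Cmult_l. apply sum_n_ext. intros n.
        replace (IZR (Z.of_nat j - Z.of_nat (S n)) * t) with (INR j * t + - INR (S n) * t).
        - rewrite e_plus. Cring.
        - rewrite minus_IZR, <- !INR_IZR_INZ. ring. }
      apply RIntC_Cmult_l.
      replace (if Nat.eq_dec j 0 then RtoC 0 else if le_lt_dec (pred j) N then c (pred j) else RtoC 0)
        with (sum_n (fun n => (c n * if Z.eq_dec (Z.of_nat j - Z.of_nat (S n)) 0 then RtoC 1 else RtoC 0)%C) N : C).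
      * apply RIntC_sum. intros n _. apply RIntC_Cmult_l, RIntC_e_integer.
      * destruct (Nat.eq_dec j 0) as [->|Hj].
        { rewrite (sum_n_ext _ (fun n => RtoC 0 * c n)%C).
          - rewrite sum_n_Cmult_l. Cring.
          - intros n. destruct (Z.eq_dec (Z.of_nat 0 - Z.of_nat (S n)) 0); [lia|]. Cring. }
        rewrite <- sum_n_delta. apply sum_n_ext. intros n.
        destruct (Z.eq_dec (Z.of_nat j - Z.of_nat (S n)) 0) as [E|E], (Nat.eq_dec n (pred j)) as [F|F]; try lia.
        -- subst; Cring.
        -- Cring.
    + rewrite Cmod_mult. apply Rmult_le_compat_l; [apply Cmod_ge_0|].
      assert (0 <= beta (pred j)) by (eapply Rle_trans; [apply Cmod_ge_0|apply Hc]).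
      destruct (Nat.eq_dec j 0); [rewrite Cmod_0; assumption|].
      destruct (le_lt_dec (pred j) N); [apply Hc|rewrite Cmod_0; assumption].
  - destruct (IH (S j)) as [B HB]. exists B. intros c N Hc.
    destruct (HB c N Hc) as [l [Hl Bl]]. exists l. split; [|assumption].
    revert Hl. apply RIntC_ext. intros t.
    replace (INR (S j) * t) with (t + INR j * t) by (rewrite S_INR; ring).
    rewrite e_plus. ring.
  - destruct (IHf j) as [B1 H1], (IHg j) as [B2 H2]. exists (B1 + B2). intros c N Hc.
    destruct (H1 c N Hc) as [l1 [K1 L1]], (H2 c N Hc) as [l2 [K2 L2]].
    exists (l1 + l2)%C. split.
    + generalize (RIntC_Cplus _ _ _ _ _ _ K1 K2). apply RIntC_ext. intros t. ring.
    + eapply Rle_trans; [apply Cmod_triangle|]. lra.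
  - destruct (IH j) as [B HB]. exists B. intros c N Hc.
    destruct (HB c N Hc) as [l [Hl Bl]]. exists l. split; [|assumption].
    revert Hl. apply RIntC_ext. intros t. now rewrite E.
Qed.

(** * Poisson means at a point of pointwise regularity *)

Definition poisson_weight (alpha y : R) (n : nat) : R :=
  Rpower (INR (S n)) alpha * exp (- (2 * PI * y) * INR (S n)).

Lemma poisson_summable (b : nat -> C) alpha y :
  ex_series (fun n => Cmod (b n)) -> 0 < alpha -> 0 < y ->
  is_lim_C (sum_n (fun n => (RtoC (poisson_weight alpha y n) * b n)%C))
    (CSeries (fun n => (RtoC (poisson_weight alpha y n) * b n)%C)).
Proof.
  intros Hb Ha Hy. pose proof PI_RGT_0 as HPI.
  destruct (Rpower_exp_bounded alpha (2 * PI * y) Ha) as [B [HB HBx]].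
  { apply Rmult_lt_0_compat; lra. }
  apply (CSeries_dominated _ (fun n => B * Cmod (b n))).
  - intros n. rewrite Cmod_mult. apply Rmult_le_compat_r; [apply Cmod_ge_0|].
    unfold poisson_weight. rewrite Cmod_R, Rabs_pos_eq.
    + apply HBx. apply lt_0_INR; lia.
    + apply Rmult_le_pos; left; apply exp_pos.
  - apply (ex_series_scal (V := R_NormedModule)) with (1 := Hb).
Qed.

Lemma dual_kernel_poisson alpha y N t :
  dual_kernel (fun n => RtoC (poisson_weight alpha y n)) N t =
  sum_n (fun n => (RtoC (Rpower (INR (S n)) alpha)
            * Cpow (RtoC (exp (- 2 * PI * y)) * e (- t)) (S n))%C) N :> C.
Proof.
  apply sum_n_ext. intros n. unfold poisson_weight.
  rewrite Cpow_mult_l, Cpow_e, <- RtoC_pow, exp_pow, RtoC_mult.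
  replace (INR (S n) * - t) with (- INR (S n) * t) by ring.
  replace (-2 * PI * y * INR (S n)) with (- (2 * PI * y) * INR (S n)) by ring. Cring.
Qed.

(** With [sigma = 1] and [sigma = -1] this covers both halves of the period. *)
Lemma is_RInt_Rpower y sigma q a b : sigma <> 0 -> q <> 0 -> a <= b ->
  (forall t, a <= t <= b -> 0 < y + sigma * t) ->
  is_RInt (fun t => Rpower (y + sigma * t) (q - 1)) a b
    ((Rpower (y + sigma * b) q - Rpower (y + sigma * a) q) / (sigma * q)).
Proof.
  intros Hs Hq Hab Hpos.
  replace ((Rpower (y + sigma * b) q - Rpower (y + sigma * a) q) / (sigma * q))
    with (minus (/ (sigma * q) * Rpower (y + sigma * b) q) (/ (sigma * q) * Rpower (y + sigma * a) q))
    by (unfold minus, plus, opp; simpl; field; auto).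
  apply (is_RInt_derive (V := R_CompleteNormedModule) (fun t => / (sigma * q) * Rpower (y + sigma * t) q)).
  - intros t Ht. rewrite Rmin_left, Rmax_right in Ht by assumption.
    replace (Rpower (y + sigma * t) (q - 1))
      with (/ (sigma * q) * (sigma * (q * Rpower (y + sigma * t) (q - 1)))) by (field; auto).
    apply (is_derive_scal (fun t => Rpower (y + sigma * t) q)).
    apply (is_derive_comp (V := R_NormedModule) (fun u => Rpower u q) (fun t => y + sigma * t)).
    + apply is_derive_Reals, derivable_pt_lim_power. auto.
    + auto_derive; auto. ring.
  - intros t Ht. rewrite Rmin_left, Rmax_right in Ht by assumption.
    apply (ex_derive_continuous (V := R_NormedModule)).
    eexists. apply (is_derive_comp (V := R_NormedModule) (fun u => Rpower u (q - 1)) (fun t => y + sigma * t)).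
    + apply is_derive_Reals, derivable_pt_lim_power. auto.
    + auto_derive; auto.
Qed.

(** The integral of [(y + |t|)^(- beta - 1)] over a half-line from [0] is
    [y^(- beta) / beta]. *)
Lemma half_interval_bound (f : R -> C) y beta A E a b l :
  0 < y -> 0 < beta -> 0 <= A -> a <= b -> b - a <= 1 -> (a = 0 \/ b = 0) -> 0 <= E ->
  (forall t, a <= t <= b -> Cmod (f t) <= A * Rpower (y + Rabs t) (- beta - 1) + E) ->
  RIntC f a b l -> Cmod l <= A * Rpower y (- beta) / beta + E.
Proof.
  intros Hy Hb HA Hab Hlen Hor HE Hf Hl.
  assert (G : forall sigma, sigma = 1 \/ sigma = -1 ->
    (forall t, a <= t <= b -> Rabs t = sigma * t) ->
    - sigma * (Rpower (y + sigma * b) (- beta) - Rpower (y + sigma * a) (- beta)) <= Rpower y (- beta) ->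
    Cmod l <= A * Rpower y (- beta) / beta + E).
  { intros sigma Hsg Habs Hend.
    assert (Hs0 : sigma <> 0) by (destruct Hsg; lra).
    assert (I : is_RInt (fun t => A * Rpower (y + sigma * t) (- beta - 1) + E) a b
      (A * ((Rpower (y + sigma * b) (- beta) - Rpower (y + sigma * a) (- beta)) / (sigma * - beta)) + (b - a) * E)).
    { apply (is_RInt_plus (V := R_NormedModule)).
      - apply (is_RInt_scal (V := R_NormedModule)). apply is_RInt_Rpower; [assumption|lra|assumption|].
        intros t Ht. rewrite <- Habs by assumption. generalize (Rabs_pos t); lra.
      - apply (is_RInt_const (V := R_NormedModule)). }
    eapply Rle_trans.
    - apply (RIntC_bound f _ a b l _ Hab) with (2 := Hl) (3 := I).
      intros t Ht. rewrite <- Habs by assumption. auto.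
    - apply Rplus_le_compat.
      + unfold Rdiv at 2. rewrite Rmult_assoc. apply Rmult_le_compat_l; [assumption|].
        assert (0 < / beta) by (apply Rinv_0_lt_compat; assumption).
        apply Rle_trans with ((- sigma * (Rpower (y + sigma * b) (- beta) - Rpower (y + sigma * a) (- beta))) * / beta).
        * right. destruct Hsg; subst sigma; field; lra.
        * apply Rmult_le_compat_r; lra.
      + rewrite <- (Rmult_1_l E) at 2. apply Rmult_le_compat_r; assumption. }
  destruct Hor as [Ha|Hb'].
  - subst a. apply (G 1); [now left| |].
    + intros t Ht. rewrite Rabs_pos_eq; lra.
    + rewrite Rmult_0_r, Rplus_0_r. pose proof (Rpower_pos (y + 1 * b) (- beta)). lra.
  - subst b. apply (G (-1)); [now right| |].
    + intros t Ht. destruct (Req_dec t 0) as [->|]; [rewrite Rabs_R0; lra|]. rewrite Rabs_left; lra.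
    + rewrite Rmult_0_r, Rplus_0_r. pose proof (Rpower_pos (y + -1 * a) (- beta)). lra.
Qed.

(** The bounds of the theory are on punctured neighbourhoods, whereas bounding
    an integral requires a bound at [t = 0] as well. *)
Lemma vanish_at_0 (psi : R -> C) s M : 0 < s -> 0 <= M -> continuous psi 0 ->
  (forall t, 0 < Rabs t <= / 2 -> Cmod (psi t) <= M * Rpower (Rabs t) s) -> psi 0 = RtoC 0.
Proof.
  intros Hs HM Hc H. apply Cmod_eq_0. destruct (Req_dec (Cmod (psi 0)) 0) as [|Hn]; [assumption|exfalso].
  set (eta := Cmod (psi 0)) in *. assert (He : 0 < eta) by (generalize (Cmod_ge_0 (psi 0)); unfold eta in *; lra).
  destruct (proj2 (continuous_C_eps psi 0) Hc (eta / 2) ltac:(lra)) as [d [Hd K]].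
  destruct (Rpower_small M s (eta / 2) HM Hs ltac:(lra)) as [t0 [Ht0 Hsm]].
  set (t := Rmin t0 (Rmin (d / 2) (/ 2))).
  assert (T1 : t <= t0) by apply Rmin_l.
  assert (T2 : t <= d / 2) by (eapply Rle_trans; [apply Rmin_r|apply Rmin_l]).
  assert (T3 : t <= / 2) by (eapply Rle_trans; [apply Rmin_r|apply Rmin_r]).
  assert (T4 : 0 < t) by (repeat apply Rmin_glb_lt; lra).
  specialize (H t). rewrite (Rabs_pos_eq t) in H by lra. specialize (H ltac:(lra)).
  specialize (K t). rewrite Rminus_0_r, (Rabs_pos_eq t) in K by lra. specialize (K ltac:(lra)).
  specialize (Hsm t ltac:(lra)).
  assert (Z : eta <= Cmod (psi t) + Cmod (psi t - psi 0)).
  { unfold eta. replace (psi 0) with (psi t - (psi t - psi 0))%C at 1 by ring. apply Cmod_minus_triangle. }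
  lra.
Qed.

(** The remainder [psi] of the approximation of the Fourier series by a
    trigonometric polynomial is [O(|t|^s)] on the whole period, since it is
    bounded away from [0].  Integrated against the kernel it gives
    [O(y^(s - alpha))], and the trigonometric polynomial gives [O(1)]. *)
Lemma poisson_mean_bound (bp bm : nat -> C) (alpha s M delta : R) (d : nat) (p : nat -> C) :
  ex_series (fun n => Cmod (bp n)) -> ex_series (fun n => Cmod (bm n)) ->
  0 < s < alpha -> 0 < delta ->
  (forall t, 0 < Rabs t < delta ->
     Cmod (fourier bp bm t - sum_n (fun j => (p j * Cpow (RtoC t) j)%C) d) <= M * Rpower (Rabs t) s) ->
  exists K, 0 <= K /\ forall y, 0 < y <= 1 ->
    Cmod (CSeries (fun n => (RtoC (poisson_weight alpha y n) * bp n)%C)) <= K * Rpower y (s - alpha).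
Proof.
  intros Hp Hm Hs Hdelta Hloc. pose proof PI_RGT_0 as HPI.
  destruct (nfloor_ex s ltac:(lra)) as [D0 HD0]. set (D := S D0).
  assert (HD : s <= INR D) by (unfold D; rewrite S_INR; lra).
  (* An integer order [D >= s] turns the approximation error into [O(|t|^s)]. *)
  destruct (trig_approx_poly D p d) as [_ (Q & M2 & TQ & HQ)].
  destruct (trig_bounded Q TQ) as [BQ HBQ].
  set (psi := fun t => (fourier bp bm t - Q t)%C).
  assert (Cpsi : forall t : R, continuous psi t).
  { intros t. apply continuous_Cminus; [now apply fourier_continuous|now apply trig_continuous]. }
  assert (Bpsi : exists B0, 0 <= B0 /\ forall t, Cmod (psi t) <= B0).
  { destruct (fourier_uniform bp bm Hp Hm) as [tau [_ Htau]].
    assert (X : forall t, Cmod (psi t) <= tau 0%nat + (Cmod (bp 0%nat) + Cmod (bm 0%nat)) + BQ).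
    { intros t. unfold psi. eapply Rle_trans; [apply Cmod_minus_triangle|].
      apply Rplus_le_compat; [|apply HBQ].
      replace (fourier bp bm t) with ((fourier bp bm t - fourier_sum bp bm 0 t) + fourier_sum bp bm 0 t)%C by ring.
      eapply Rle_trans; [apply Cmod_triangle|]. apply Rplus_le_compat; [apply Htau|].
      unfold fourier_sum. rewrite !sum_O. eapply Rle_trans; [apply Cmod_triangle|].
      rewrite !Cmod_mult, !Cmod_e. lra. }
    eexists. split; [|exact X]. eapply Rle_trans; [apply Cmod_ge_0|apply (X 0)]. }
  destruct Bpsi as [B0 [HB0 Bpsi]].
  (* Away from [0] the boundedness of [psi] absorbs the power, at a cost depending on [delta]. *)
  assert (L1 : exists M1, 0 <= M1 /\ forall t, 0 < Rabs t <= / 2 -> Cmod (psi t) <= M1 * Rpower (Rabs t) s).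
  { exists (Rabs M + Rabs M2 + B0 / Rpower delta s).
    assert (Pd : 0 < Rpower delta s) by apply Rpower_pos.
    assert (F : 0 <= B0 / Rpower delta s) by (apply Rmult_le_pos; [assumption|left; now apply Rinv_0_lt_compat]).
    pose proof (Rabs_pos M). pose proof (Rabs_pos M2). split; [lra|].
    intros t Ht. pose proof (Rpower_pos (Rabs t) s) as Pt.
    destruct (Rlt_le_dec (Rabs t) delta) as [Hlt|Hge].
    - apply Rle_trans with ((Rabs M + Rabs M2) * Rpower (Rabs t) s);
        [|apply Rmult_le_compat_r; lra].
      unfold psi. set (P := sum_n (fun j => (p j * Cpow (RtoC t) j)%C) d : C) in *.
      replace (fourier bp bm t - Q t)%C with ((fourier bp bm t - P) + (P - Q t))%C by ring.
      eapply Rle_trans; [apply Cmod_triangle|]. rewrite Rmult_plus_distr_r.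
      apply Rplus_le_compat.
      + eapply Rle_trans; [apply Hloc; lra|]. apply Rmult_le_compat_r; [lra|apply Rle_abs].
      + eapply Rle_trans; [apply HQ; lra|].
        apply Rle_trans with (Rabs M2 * Rabs t ^ D).
        * apply Rmult_le_compat_r; [apply pow_le; lra|apply Rle_abs].
        * apply Rmult_le_compat_l; [assumption|].
          rewrite <- Rpower_pow by lra. apply Rpower_antitone_exponent; lra.
    - apply Rle_trans with (B0 / Rpower delta s * Rpower (Rabs t) s).
      + eapply Rle_trans; [apply Bpsi|]. 
        apply Rle_trans with (B0 / Rpower delta s * Rpower delta s); [right; field; lra|].
        apply Rmult_le_compat_l; [assumption|]. apply Rle_Rpower_l; lra.
      + apply Rmult_le_compat_r; lra. }
  destruct L1 as [M1 [HM1 L1]].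
  assert (Z0 : psi 0 = RtoC 0) by (apply (vanish_at_0 psi s M1); auto; lra).
  assert (L2 : forall y t, 0 < y -> Rabs t <= / 2 -> Cmod (psi t) <= M1 * Rpower (y + Rabs t) s).
  { intros y t Hy Ht. destruct (Req_dec t 0) as [->|Ht0].
    - rewrite Z0, Cmod_0. apply Rmult_le_pos; [assumption|left; apply Rpower_pos].
    - pose proof (Rabs_pos_lt t Ht0). eapply Rle_trans; [apply L1; lra|].
      apply Rmult_le_compat_l; [assumption|]. apply Rle_Rpower_l; lra. }
  destruct (pow_kernel_bound alpha ltac:(lra)) as [K [m [HK Kern]]].
  destruct (trig_pairing (fun n => Rpower (INR (S n)) alpha) Q TQ 0) as [BT HBT].
  set (c0 := exp (- 2 * PI) / 2).
  assert (Hc0 : 0 < c0) by (unfold c0; generalize (exp_pos (-2 * PI)); lra).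
  set (A := M1 * (K * Rpower c0 (- (alpha + 1)))).
  assert (HA : 0 <= A).
  { unfold A. repeat apply Rmult_le_pos; auto. left; apply Rpower_pos. }
  assert (HBT0 : 0 <= Rabs BT) by apply Rabs_pos.
  exists (2 * A / (alpha - s) + Rabs BT). split.
  { apply Rplus_le_le_0_compat; [|assumption]. apply Rmult_le_pos; [lra|].
    left; apply Rinv_0_lt_compat; lra. }
  intros y Hy.
  set (c := fun n => RtoC (poisson_weight alpha y n)).
  set (r := exp (- 2 * PI * y)).
  assert (Hr : 0 < r <= 1).
  { split; [apply exp_pos|]. unfold r. rewrite <- exp_0. left; apply exp_increasing. nra. }
  (* [En N] is the boundary term of the kernel bound; it tends to [0] for fixed [y]. *)
  set (En := fun N => Rpower (INR (S (S N))) alpha * exp (- (2 * PI * y) * INR (S (S N)))).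
  assert (HEn : forall N, 0 <= En N) by (intros; apply Rmult_le_pos; left; apply exp_pos).
  set (F := B0 * (K * (/ (c0 * y)) ^ m)).
  assert (HF : 0 <= F).
  { unfold F. repeat apply Rmult_le_pos; auto. apply pow_le. left; apply Rinv_0_lt_compat. nra. }
  assert (KB : forall N t, Rabs t <= / 2 ->
    Cmod (dual_kernel c N t) <= K * (Rpower c0 (- (alpha + 1)) * Rpower (y + Rabs t) (- (alpha + 1))
                                    + (/ (c0 * y)) ^ m * En N)).
  { intros N t Ht. unfold c. rewrite dual_kernel_poisson.
    pose proof (dist_to_one y t Hy Ht) as Dist. fold c0 r in Dist.
    pose proof (Rabs_pos t) as At.
    assert (Dpos : 0 < c0 * (y + Rabs t)) by (apply Rmult_lt_0_compat; lra).
    fold r.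
    assert (Wr : Cmod (RtoC r * e (- t)) = r) by (rewrite Cmod_mult, Cmod_e, Cmod_R, Rabs_pos_eq; lra).
    eapply Rle_trans; [apply Kern; [rewrite Wr; lra|lra]|].
    apply Rmult_le_compat_l; [assumption|]. rewrite Wr. apply Rplus_le_compat.
    - rewrite Rpower_mult_distr by lra. apply Rle_Rpower_neg; lra.
    - apply Rmult_le_compat.
      + apply pow_le. left; apply Rinv_0_lt_compat; lra.
      + apply Rmult_le_pos; [left; apply Rpower_pos|apply pow_le; lra].
      + apply pow_incr. split; [left; apply Rinv_0_lt_compat; lra|].
        apply Rinv_le_contravar; [apply Rmult_lt_0_compat; lra|].
        eapply Rle_trans; [|exact Dist]. apply Rmult_le_compat_l; lra.
      + right. unfold En, r. rewrite exp_pow, (S_INR (S N)). f_equal. f_equal. ring. }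
  assert (PB : forall N t, Rabs t <= / 2 ->
    Cmod (psi t * dual_kernel c N t) <= A * Rpower (y + Rabs t) (- (alpha - s) - 1) + F * En N).
  { intros N t Ht. rewrite Cmod_mult. pose proof (Rabs_pos t) as At.
    pose proof (Rpower_pos c0 (- (alpha + 1))). pose proof (Rpower_pos (y + Rabs t) (- (alpha + 1))).
    assert (G0 : 0 <= (/ (c0 * y)) ^ m * En N).
    { apply Rmult_le_pos; [|apply HEn]. apply pow_le. left; apply Rinv_0_lt_compat. nra. }
    eapply Rle_trans; [apply Rmult_le_compat_l; [apply Cmod_ge_0|apply KB, Ht]|].
    rewrite !Rmult_plus_distr_l. apply Rplus_le_compat.
    - replace (- (alpha - s) - 1) with (s + - (alpha + 1)) by ring. rewrite Rpower_plus.
      replace (A * (Rpower (y + Rabs t) s * Rpower (y + Rabs t) (- (alpha + 1))))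
        with ((M1 * Rpower (y + Rabs t) s) * (K * (Rpower c0 (- (alpha + 1)) * Rpower (y + Rabs t) (- (alpha + 1)))))
        by (unfold A; ring).
      apply Rmult_le_compat_r; [apply Rmult_le_pos; nra|]. apply L2; lra.
    - replace (F * En N) with (B0 * (K * ((/ (c0 * y)) ^ m * En N))) by (unfold F; ring).
      apply Rmult_le_compat_r; [apply Rmult_le_pos; lra|]. apply Bpsi. }
  assert (SB : forall N, Cmod (sum_n (fun n => (c n * bp n)%C) N) <=
      (2 * A / (alpha - s) * Rpower y (s - alpha) + Rabs BT) + 2 * F * En N).
  { intros N.
    assert (CK : forall t : R, continuous (fun t => psi t * dual_kernel c N t)%C t).
    { intros t. apply continuous_Cmult; [apply Cpsi|apply dual_kernel_continuous]. }
    destruct (RIntC_continuous _ (- / 2) 0 CK) as [l1 H1].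
    destruct (RIntC_continuous _ 0 (/ 2) CK) as [l2 H2].
    destruct (HBT c N) as [l3 [H3 B3]].
    { intros n. unfold c, poisson_weight. rewrite Cmod_R, Rabs_pos_eq.
      - rewrite <- (Rmult_1_r (Rpower _ _)) at 2. apply Rmult_le_compat_l; [left; apply Rpower_pos|].
        rewrite <- exp_0. left; apply exp_increasing.
        assert (Hn : 0 < INR (S n)) by (apply lt_0_INR; lia).
        assert (Hpy : 0 < 2 * PI * y) by (apply Rmult_lt_0_compat; lra).
        pose proof (Rmult_lt_0_compat _ _ Hpy Hn). lra.
      - apply Rmult_le_pos; left; apply exp_pos. }
    assert (H12 : RIntC (fun t => psi t * dual_kernel c N t)%C (- / 2) (/ 2) (l1 + l2)%C)
      by exact (is_RInt_Chasles _ _ _ _ _ _ H1 H2).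
    assert (E : (sum_n (fun n => (c n * bp n)%C) N = (l1 + l2) + l3 :> C)%C).
    { apply (RIntC_unique (fun t => fourier bp bm t * dual_kernel c N t)%C (- / 2) (/ 2)).
      - now apply fourier_pairing.
      - generalize (RIntC_Cplus _ _ _ _ _ _ H12 H3). apply RIntC_ext. intros t.
        simpl INR. rewrite Rmult_0_l, e_0. unfold psi. ring. }
    rewrite E.
    assert (B1 : Cmod l1 <= A * Rpower y (- (alpha - s)) / (alpha - s) + F * En N).
    { apply (half_interval_bound (fun t => psi t * dual_kernel c N t)%C y (alpha - s) A (F * En N) (- / 2) 0); try lra.
      - apply Rmult_le_pos; auto.
      - intros t Ht. apply PB. apply Rabs_le; lra.
      - exact H1. }
    assert (B2 : Cmod l2 <= A * Rpower y (- (alpha - s)) / (alpha - s) + F * En N).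
    { apply (half_interval_bound (fun t => psi t * dual_kernel c N t)%C y (alpha - s) A (F * En N) 0 (/ 2)); try lra.
      - apply Rmult_le_pos; auto.
      - intros t Ht. apply PB. apply Rabs_le; lra.
      - exact H2. }
    replace (- (alpha - s)) with (s - alpha) in B1, B2 by ring.
    eapply Rle_trans; [apply Cmod_triangle|].
    pose proof (Cmod_triangle l1 l2). pose proof (Rle_abs BT).
    replace (2 * A / (alpha - s) * Rpower y (s - alpha))
      with (2 * (A * Rpower y (s - alpha) / (alpha - s))) by (field; lra).
    lra. }
  assert (Conv : is_lim_C (sum_n (fun n => (c n * bp n)%C)) (CSeries (fun n => (c n * bp n)%C)))
    by (apply poisson_summable; [assumption|lra|lra]).
  apply Rle_trans with (2 * A / (alpha - s) * Rpower y (s - alpha) + Rabs BT).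
  - apply (is_lim_C_Cmod_le _ _ (fun N => (2 * A / (alpha - s) * Rpower y (s - alpha) + Rabs BT) + 2 * F * En N) _ Conv).
    + exists 0%nat. intros N _. apply SB.
    + set (X := 2 * A / (alpha - s) * Rpower y (s - alpha) + Rabs BT).
      replace (Finite X) with (Finite (X + 2 * F * 0)) by (f_equal; ring).
      apply is_lim_seq_plus'; [apply is_lim_seq_const|].
      apply (is_lim_seq_scal_l En (2 * F) 0). apply Rpower_exp_lim; [lra|].
      apply Rmult_lt_0_compat; lra.
  - rewrite Rmult_plus_distr_r. apply Rplus_le_compat_l.
    rewrite <- (Rmult_1_r (Rabs BT)) at 1. apply Rmult_le_compat_l; [assumption|].
    rewrite <- (Rpower_1_l (s - alpha)). apply Rle_Rpower_neg; lra.
Qed.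

(** * Summation by parts against power weights *)

(** Summation by parts replaces the weights by their differences, which are
    [O(n^(-rho-1))].  The resulting terms [n^(tau-rho-1)] are dominated by the
    differences of [n^(tau-rho)] and telescope. *)
Lemma Abel_power_weight tau rho : 0 <= rho -> tau < rho -> exists K, 0 <= K /\
  forall (c : nat -> C) M, 0 <= M ->
  (forall N, Cmod (sum_n c N) <= M * Rpower (INR (S N)) tau) ->
  forall n m, (n <= m)%nat ->
  Cmod (sum_n (fun k => (c k * RtoC (Rpower (INR (S k)) (- rho)))%C) m
        - sum_n (fun k => (c k * RtoC (Rpower (INR (S k)) (- rho)))%C) n)
    <= K * M * Rpower (INR (S n)) (tau - rho).
Proof.
  intros Hr Ht. set (q := rho - tau). assert (Hq : 0 < q) by (unfold q; lra).
  set (K := Rpower 2 q * 2 / q).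
  assert (HK : 0 < K).
  { unfold K. apply Rdiv_lt_0_compat; [|assumption]. generalize (Rpower_pos 2 q); lra. }
  exists (2 + rho * K). split; [nra|]. intros c M HM HS n m Hnm.
  set (lam := fun k => Rpower (INR (S k)) (- rho)).
  replace (tau - rho) with (- q) by (unfold q; ring).
  assert (I : exists Rm : C,
    (sum_n (fun k => c k * RtoC (lam k)) m - sum_n (fun k => c k * RtoC (lam k)) n
     = sum_n c m * RtoC (lam m) - sum_n c n * RtoC (lam n) + Rm)%C /\
    Cmod Rm <= M * (rho * (K * (Rpower (INR (S n)) (- q) - Rpower (INR (S m)) (- q))))).
  { induction Hnm as [|m Hnm IH].
    - exists (RtoC 0). split; [ring|]. rewrite Cmod_0. right; ring.
    - destruct IH as [Rm [E B]].
      exists (Rm + sum_n c m * RtoC (lam m - lam (S m)))%C. split.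
      + rewrite (sum_n_S_C (fun k => (c k * RtoC (lam k))%C)).
        replace (sum_n (fun k => c k * RtoC (lam k)) m + c (S m) * RtoC (lam (S m)) - sum_n (fun k => c k * RtoC (lam k)) n)%C
          with (sum_n (fun k => c k * RtoC (lam k)) m - sum_n (fun k => c k * RtoC (lam k)) n
            + c (S m) * RtoC (lam (S m)))%C by ring.
        rewrite E, sum_n_S_C, RtoC_minus. ring.
      + eapply Rle_trans; [apply Cmod_triangle|].
        set (x := INR (S m)). assert (Hx : 1 <= x) by apply INR_S_ge_1.
        pose proof (Rpower_step_upper x rho Hx Hr) as U.
        pose proof (Rpower_step_lower x q Hx Hq) as L. fold K in L.
        assert (lamE : lam (S m) = Rpower (x + 1) (- rho)) by (unfold lam, x; now rewrite (S_INR (S m))).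
        assert (xE : INR (S (S m)) = x + 1) by (unfold x; now rewrite (S_INR (S m))).
        assert (T : Cmod (sum_n c m * RtoC (lam m - lam (S m))) <=
           M * (rho * (K * (Rpower x (- q) - Rpower (x + 1) (- q))))).
        { rewrite Cmod_mult, Cmod_R, lamE. unfold lam. fold x.
          rewrite Rabs_pos_eq.
          - apply Rle_trans with (M * Rpower x tau * (rho * Rpower x (- rho - 1))).
            + apply Rmult_le_compat; [apply Cmod_ge_0| |apply HS|exact U].
              assert (Rpower (x + 1) (- rho) <= Rpower x (- rho)) by (apply Rle_Rpower_neg; lra). lra.
            + replace (M * Rpower x tau * (rho * Rpower x (- rho - 1)))
                with (M * (rho * (Rpower x tau * Rpower x (- rho - 1)))) by ring.
              rewrite <- Rpower_plus. replace (tau + (- rho - 1)) with (- q - 1) by (unfold q; ring).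
              apply Rmult_le_compat_l; [assumption|]. apply Rmult_le_compat_l; assumption.
          - assert (Rpower (x + 1) (- rho) <= Rpower x (- rho)) by (apply Rle_Rpower_neg; lra). lra. }
        rewrite xE. fold x in B. 
        replace (M * (rho * (K * (Rpower (INR (S n)) (- q) - Rpower (x + 1) (- q)))))
          with (M * (rho * (K * (Rpower (INR (S n)) (- q) - Rpower x (- q))))
            + M * (rho * (K * (Rpower x (- q) - Rpower (x + 1) (- q))))) by ring.
        lra. }
  destruct I as [Rm [E B]]. fold lam.
  change (fun k : nat => (c k * Rpower (INR (S k)) (- rho))%C)
    with (fun k => (c k * RtoC (lam k))%C).
  rewrite E.
  assert (Bd : forall k, Cmod (sum_n c k * RtoC (lam k)) <= M * Rpower (INR (S k)) (- q)).
  { intros k. rewrite Cmod_mult, Cmod_R, Rabs_pos_eq by (left; apply Rpower_pos).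
    replace (- q) with (tau + - rho) by (unfold q; ring). rewrite Rpower_plus, <- Rmult_assoc.
    apply Rmult_le_compat_r; [left; apply Rpower_pos|apply HS]. }
  pose proof (Bd n) as Bn. pose proof (Bd m) as Bm.
  pose proof (Cmod_triangle (sum_n c m * RtoC (lam m) - sum_n c n * RtoC (lam n)) Rm).
  pose proof (Cmod_minus_triangle (sum_n c m * RtoC (lam m)) (sum_n c n * RtoC (lam n))).
  assert (Mon : Rpower (INR (S m)) (- q) <= Rpower (INR (S n)) (- q)).
  { apply Rle_Rpower_neg; [lra|]. split; [generalize (INR_S_ge_1 n); lra|apply le_INR; lia]. }
  pose proof (Rpower_pos (INR (S m)) (- q)).
  assert (M * Rpower (INR (S m)) (- q) <= M * Rpower (INR (S n)) (- q)) by (apply Rmult_le_compat_l; assumption).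
  assert (M * (rho * (K * (Rpower (INR (S n)) (- q) - Rpower (INR (S m)) (- q))))
     <= M * (rho * (K * Rpower (INR (S n)) (- q)))).
  { repeat (apply Rmult_le_compat_l; [lra|]). lra. }
  replace ((2 + rho * K) * M * Rpower (INR (S n)) (- q))
    with (M * Rpower (INR (S n)) (- q) + M * Rpower (INR (S n)) (- q) + M * (rho * (K * Rpower (INR (S n)) (- q)))) by ring.
  lra.
Qed.

(** This bounds the derivative of an exponential sum by [N] times the bound on
    the exponential sums. *)
Lemma Abel_weight_n (c : nat -> C) M tau : 0 <= tau -> 0 <= M ->
  (forall N, Cmod (sum_n c N) <= M * Rpower (INR (S N)) tau) ->
  forall N, Cmod (sum_n (fun k => (RtoC (INR (S k)) * c k)%C) N)
     <= 2 * M * (INR (S N) * Rpower (INR (S N)) tau).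
Proof.
  intros Ht HM HS N.
  assert (I : exists Rm : C, (sum_n (fun k => RtoC (INR (S k)) * c k) N = RtoC (INR (S N)) * sum_n c N - Rm)%C
     /\ Cmod Rm <= M * (INR N * Rpower (INR (S N)) tau)).
  { induction N as [|N IH].
    - exists (RtoC 0). rewrite !sum_O. split; [Cring|]. rewrite Cmod_0. simpl; right; ring.
    - destruct IH as [Rm [E B]]. exists (Rm + sum_n c N)%C. split.
      + rewrite (sum_n_S_C (fun k => (RtoC (INR (S k)) * c k)%C)), E, (sum_n_S_C c), (S_INR (S N)), RtoC_plus. Cring.
      + eapply Rle_trans; [apply Cmod_triangle|]. specialize (HS N).
        assert (Mon : Rpower (INR (S N)) tau <= Rpower (INR (S (S N))) tau) by (apply Rpower_INR_mono; [assumption|lia]).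
        rewrite (S_INR N) at 1. pose proof (pos_INR N).
        apply Rle_trans with (M * (INR N * Rpower (INR (S N)) tau) + M * Rpower (INR (S N)) tau); [lra|].
        replace (M * (INR N * Rpower (INR (S N)) tau) + M * Rpower (INR (S N)) tau)
          with (M * ((INR N + 1) * Rpower (INR (S N)) tau)) by ring.
        apply Rmult_le_compat_l; [assumption|]. apply Rmult_le_compat_l; lra. }
  destruct I as [Rm [E B]]. rewrite E.
  eapply Rle_trans; [apply Cmod_minus_triangle|].
  rewrite Cmod_scale by (generalize (INR_S_ge_1 N); lra).
  specialize (HS N). pose proof (INR_S_ge_1 N).
  apply Rmult_le_compat_l with (r := INR (S N)) in HS; [|lra].
  assert (M * (INR N * Rpower (INR (S N)) tau) <= M * (INR (S N) * Rpower (INR (S N)) tau)).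
  { apply Rmult_le_compat_l; [assumption|]. apply Rmult_le_compat_r; [left; apply Rpower_pos|].
    rewrite S_INR; lra. }
  replace (2 * M * (INR (S N) * Rpower (INR (S N)) tau))
    with (INR (S N) * (M * Rpower (INR (S N)) tau) + M * (INR (S N) * Rpower (INR (S N)) tau)) by ring.
  lra.
Qed.

(** * Differentiated series and their Hölder continuity *)

(** The sign [sigma] is [1] for the part of the series over [n > 0] and [-1]
    for the part over [n < 0]. *)
Definition exp_term (a : nat -> C) (sigma x : R) (n : nat) : C := (a n * e (sigma * INR (S n) * x))%C.

(** The [k]-th derivative of the term of [f_alpha] of index [sigma (n + 1)]:
    each derivation multiplies it by [freq sigma * (n + 1)], which shifts the
    exponent of the weight. *)
Definition deriv_term (a : nat -> C) (sigma alpha : R) (k : nat) (x : R) (n : nat) : C :=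
  (Cpow (freq sigma) k * (exp_term a sigma x n * RtoC (Rpower (INR (S n)) (- (alpha - INR k)))))%C.

Definition deriv_series (a : nat -> C) (sigma alpha : R) (k : nat) (x : R) : C :=
  CSeries (deriv_term a sigma alpha k x).

Definition unif_growth (a : nat -> C) (sigma tau M : R) : Prop :=
  forall x N, Cmod (sum_n (exp_term a sigma x) N) <= M * Rpower (INR (S N)) tau.

Lemma unif_growth_nonneg a sigma tau M : unif_growth a sigma tau M -> 0 <= M.
Proof.
  intros H. specialize (H 0 0%nat). pose proof (Cmod_ge_0 (sum_n (exp_term a sigma 0) 0)).
  simpl INR in H. rewrite Rpower_1_l in H. lra.
Qed.

Lemma derivC_exp_term a sigma x n :
  derivC (fun x => exp_term a sigma x n) x (freq sigma * (RtoC (INR (S n)) * exp_term a sigma x n))%C.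
Proof.
  unfold exp_term. evar_last; [apply derivC_Cmult_l, derivC_e|]. rewrite freq_mult. Cring.
Qed.

Lemma derivC_deriv_term a sigma alpha k x n :
  derivC (fun x => deriv_term a sigma alpha k x n) x (deriv_term a sigma alpha (S k) x n).
Proof.
  unfold deriv_term. evar_last.
  - apply derivC_Cmult_l. apply derivC_Cmult; [apply derivC_exp_term|apply derivC_const].
  - replace (- (alpha - INR (S k))) with (- (alpha - INR k) + 1) by (rewrite S_INR; ring).
    rewrite Rpower_plus, Rpower_1 by (apply lt_0_INR; lia). rewrite RtoC_mult. cbn [Cpow]. Cring.
Qed.

Lemma deriv_series_uniform a sigma alpha tau M k :
  unif_growth a sigma tau M -> 0 <= tau -> tau + INR k < alpha ->
  exists b, is_lim_seq b 0 /\ forall x,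
    is_lim_C (sum_n (deriv_term a sigma alpha k x)) (deriv_series a sigma alpha k x) /\
    forall N, Cmod (deriv_series a sigma alpha k x - sum_n (deriv_term a sigma alpha k x) N) <= b N.
Proof.
  intros HS Htau Hk. pose proof (unif_growth_nonneg _ _ _ _ HS) as HM.
  destruct (Abel_power_weight tau (alpha - INR k)) as [K [HK A]]; [lra|lra|].
  set (q := alpha - INR k - tau). assert (Hq : 0 < q) by (unfold q; lra).
  set (G := Cmod (freq sigma) ^ k * (K * M)).
  exists (fun N => G * Rpower (INR (S N)) (- q)).
  assert (HG : 0 <= G).
  { unfold G. apply Rmult_le_pos; [apply pow_le, Cmod_ge_0|]. now apply Rmult_le_pos. }
  assert (Hlim : is_lim_seq (fun N => G * Rpower (INR (S N)) (- q)) 0).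
  { replace (Finite 0) with (Rbar_mult G 0) by (simpl; f_equal; ring).
    apply is_lim_seq_scal_l. now apply Rpower_INR_lim_0. }
  split; [assumption|]. intros x.
  assert (B : forall n m, (n <= m)%nat ->
    Cmod (sum_n (deriv_term a sigma alpha k x) m - sum_n (deriv_term a sigma alpha k x) n)
      <= G * Rpower (INR (S n)) (- q)).
  { intros n m Hnm. unfold deriv_term. rewrite !sum_n_Cmult_l.
    match goal with |- Cmod (?p * ?u - ?p * ?v) <= _ =>
      replace (p * u - p * v)%C with (p * (u - v))%C by ring end.
    rewrite Cmod_mult, Cmod_pow. unfold G. rewrite Rmult_assoc.
    apply Rmult_le_compat_l; [apply pow_le, Cmod_ge_0|].
    replace (- q) with (tau - (alpha - INR k)) by (unfold q; ring).
    apply A; [assumption|apply HS|assumption]. }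
  destruct (is_lim_C_Cauchy (sum_n (deriv_term a sigma alpha k x))) as [l Hl].
  { intros eps Heps. apply is_lim_seq_spec in Hlim. destruct (Hlim (mkposreal eps Heps)) as [N HN].
    exists N. intros n m Hn Hm. eapply Rle_trans; [apply B, Hm|].
    specialize (HN n Hn). simpl in HN. apply Rabs_def2 in HN. simpl. lra. }
  unfold deriv_series. rewrite (CSeries_correct _ _ Hl). split; [assumption|].
  intros N. apply is_lim_C_distance_le with (1 := Hl). intros; now apply B.
Qed.

Lemma deriv_series_continuous a sigma alpha tau M k :
  unif_growth a sigma tau M -> 0 <= tau -> tau + INR k < alpha ->
  forall x : R, continuous (deriv_series a sigma alpha k) x.
Proof.
  intros HS Htau Hk. destruct (deriv_series_uniform _ _ _ _ _ _ HS Htau Hk) as [b [Hb H]].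
  apply (continuous_uniform_limit (fun N x => sum_n (deriv_term a sigma alpha k x) N) _ b Hb).
  - intros n x. apply H.
  - intros n x. apply (continuous_sum_C (fun n x => deriv_term a sigma alpha k x n)). intros m.
    eapply derivC_continuous, derivC_deriv_term.
Qed.

Lemma deriv_series_derive a sigma alpha tau M k :
  unif_growth a sigma tau M -> 0 <= tau -> tau + INR (S k) < alpha ->
  forall x : R, derivC (deriv_series a sigma alpha k) x (deriv_series a sigma alpha (S k) x).
Proof.
  intros HS Htau Hk.
  assert (Hk' : tau + INR k < alpha) by (rewrite S_INR in Hk; lra).
  destruct (deriv_series_uniform _ _ _ _ _ _ HS Htau Hk) as [b [Hb H]].
  destruct (deriv_series_uniform _ _ _ _ _ _ HS Htau Hk') as [b' [Hb' H']].
  apply (derivC_uniform_limit (fun N x => sum_n (deriv_term a sigma alpha k x) N)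
          (fun N x => sum_n (deriv_term a sigma alpha (S k) x) N) _ _ b); auto.
  - intros n x. apply (derivC_sum (fun n x => deriv_term a sigma alpha k x n)
      (fun n x => deriv_term a sigma alpha (S k) x n)). intros; apply derivC_deriv_term.
  - intros x. apply H'.
  - intros n x. apply H.
  - now apply (deriv_series_continuous _ _ _ tau M).
Qed.

(** Interpolation between the bound on the sums and the mean value bound on
    their derivatives: [min(1, X) <= X^theta] with [X = (N + 1) |x - y|]. *)
Lemma exp_sum_difference a sigma tau M theta x y N :
  unif_growth a sigma tau M -> 0 <= tau -> 0 < theta <= 1 -> x <> y ->
  Cmod (sum_n (fun n => (exp_term a sigma x n - exp_term a sigma y n)%C) N)
    <= (2 * M + 8 * PI * Rabs sigma * M) * Rpower (Rabs (x - y)) theta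
       * Rpower (INR (S N)) (tau + theta).
Proof.
  intros HS Htau Hth Hxy. pose proof (unif_growth_nonneg _ _ _ _ HS) as HM.
  pose proof PI_RGT_0 as HPI. pose proof (Rabs_pos sigma) as As.
  pose proof (INR_S_ge_1 N) as HN.
  assert (Hd : 0 < Rabs (x - y)) by (apply Rabs_pos_lt; lra).
  rewrite sum_n_Cminus.
  set (n := INR (S N)) in *. set (d := Rabs (x - y)) in *.
  assert (B1 : Cmod (sum_n (exp_term a sigma x) N - sum_n (exp_term a sigma y) N) <= 2 * M * Rpower n tau).
  { eapply Rle_trans; [apply Cmod_minus_triangle|].
    generalize (HS x N) (HS y N). fold n. lra. }
  assert (B2 : Cmod (sum_n (exp_term a sigma x) N - sum_n (exp_term a sigma y) N)
     <= 8 * PI * Rabs sigma * M * Rpower n tau * (n * d)).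
  { eapply Rle_trans.
    - apply (mean_value_C (fun x => sum_n (exp_term a sigma x) N : C)
        (fun x => sum_n (fun k => freq sigma * (RtoC (INR (S k)) * exp_term a sigma x k))%C N)
        (2 * PI * Rabs sigma * (2 * M * (n * Rpower n tau)))).
      intros t _. split.
      + apply (derivC_sum (fun k x => exp_term a sigma x k)
          (fun k x => (freq sigma * (RtoC (INR (S k)) * exp_term a sigma x k))%C)).
        intros k. apply derivC_exp_term.
      + rewrite sum_n_Cmult_l, Cmod_mult, Cmod_freq. apply Rmult_le_compat_l; [nra|].
        apply (Abel_weight_n (exp_term a sigma t) M tau Htau HM). apply HS.
    - fold d. right; ring. }
  assert (T : Rpower d theta * Rpower n (tau + theta) = Rpower n tau * Rpower (n * d) theta).
  { rewrite <- Rpower_mult_distr, Rpower_plus by lra. ring. }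
  rewrite Rmult_assoc, T.
  pose proof (Rpower_pos n tau) as Pn. pose proof (Rpower_pos (n * d) theta) as Pd.
  assert (Hnd : 0 < n * d) by (apply Rmult_lt_0_compat; lra).
  assert (C1 : 0 <= 2 * M * Rpower n tau) by (apply Rmult_le_pos; lra).
  assert (C2 : 0 <= 8 * PI * Rabs sigma * M * Rpower n tau)
    by (apply Rmult_le_pos; [apply Rmult_le_pos; [apply Rmult_le_pos|]|]; lra).
  replace ((2 * M + 8 * PI * Rabs sigma * M) * (Rpower n tau * Rpower (n * d) theta))
    with (2 * M * Rpower n tau * Rpower (n * d) theta
          + 8 * PI * Rabs sigma * M * Rpower n tau * Rpower (n * d) theta) by ring.
  (* The mean value bound is the better one when [n d <= 1], the trivial bound otherwise. *)
  destruct (Rle_lt_dec (n * d) 1) as [H1|H1].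
  - assert (n * d <= Rpower (n * d) theta).
    { rewrite <- (Rpower_1 (n * d)) at 1 by assumption. apply Rpower_antitone_exponent; lra. }
    assert (8 * PI * Rabs sigma * M * Rpower n tau * (n * d)
       <= 8 * PI * Rabs sigma * M * Rpower n tau * Rpower (n * d) theta) by (apply Rmult_le_compat_l; assumption).
    assert (0 <= 2 * M * Rpower n tau * Rpower (n * d) theta) by (apply Rmult_le_pos; lra). lra.
  - assert (1 <= Rpower (n * d) theta) by (apply Rpower_ge_1; lra).
    assert (2 * M * Rpower n tau * 1 <= 2 * M * Rpower n tau * Rpower (n * d) theta)
      by (apply Rmult_le_compat_l; assumption).
    assert (0 <= 8 * PI * Rabs sigma * M * Rpower n tau * Rpower (n * d) theta) by (apply Rmult_le_pos; lra). lra.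
Qed.

(** The differences of the exponentials have partial sums that are larger by
    [N^theta] and carry the factor [|x - y|^theta], so one summation by parts
    gives the Hölder condition without cutting the series at [1/|x - y|]. *)
Lemma deriv_series_holder a sigma alpha tau M k theta :
  unif_growth a sigma tau M -> 0 <= tau -> 0 < theta <= 1 -> tau + theta + INR k < alpha ->
  exists B, forall x y, x <> y ->
    Cmod (deriv_series a sigma alpha k x - deriv_series a sigma alpha k y)
      <= B * Rpower (Rabs (x - y)) theta.
Proof.
  intros HS Htau Hth Hk. pose proof (unif_growth_nonneg _ _ _ _ HS) as HM.
  pose proof PI_RGT_0 as HPI. pose proof (Rabs_pos sigma) as As.
  destruct (deriv_series_uniform a sigma alpha tau M k HS Htau ltac:(lra)) as [b [_ H]].
  destruct (Abel_power_weight (tau + theta) (alpha - INR k)) as [K [HK A]]; [lra|lra|].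
  set (M' := 2 * M + 8 * PI * Rabs sigma * M).
  assert (HM' : 0 <= M').
  { unfold M'. assert (0 <= 8 * PI * Rabs sigma * M)
      by (apply Rmult_le_pos; [apply Rmult_le_pos|]; lra). lra. }
  exists (Cmod (freq sigma) ^ k * ((K + 1) * M')). intros x y Hxy.
  set (c := fun n => (exp_term a sigma x n - exp_term a sigma y n)%C).
  set (P := Rpower (Rabs (x - y)) theta). assert (HP : 0 < P) by apply Rpower_pos.
  assert (Hc : forall N, Cmod (sum_n c N) <= M' * P * Rpower (INR (S N)) (tau + theta)).
  { intros N. now apply exp_sum_difference. }
  assert (HMP : 0 <= M' * P) by (apply Rmult_le_pos; lra).
  set (s := fun N => sum_n (fun n => (c n * RtoC (Rpower (INR (S n)) (- (alpha - INR k))))%C) N : C).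
  assert (Bs : forall N, Cmod (s N) <= (K + 1) * (M' * P)).
  { intros N. replace (s N) with ((s N - s 0%nat) + s 0%nat)%C by ring.
    eapply Rle_trans; [apply Cmod_triangle|].
    specialize (A c (M' * P) HMP Hc 0%nat N ltac:(lia)). fold (s N) (s 0%nat) in A.
    change (INR 1) with 1 in A. rewrite Rpower_1_l in A.
    assert (Z : Cmod (s 0%nat) <= M' * P).
    { unfold s. rewrite sum_O. simpl INR. rewrite Rpower_1_l, Cmod_mult, Cmod_1, Rmult_1_r.
      specialize (Hc 0%nat). rewrite sum_O in Hc. simpl INR in Hc. rewrite Rpower_1_l in Hc. lra. }
    lra. }
  destruct (H x) as [Hx _]. destruct (H y) as [Hy _].
  assert (L : is_lim_C (fun N => (Cpow (freq sigma) k * s N)%C)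
     (deriv_series a sigma alpha k x - deriv_series a sigma alpha k y)%C).
  { apply is_lim_C_ext with (fun N => (sum_n (deriv_term a sigma alpha k x) N
        + - (1) * sum_n (deriv_term a sigma alpha k y) N)%C).
    - intros N. unfold s. rewrite <- !sum_n_Cmult_l, <- sum_n_Cplus. apply sum_n_ext.
      intros n. unfold deriv_term, c. Cring.
    - replace (deriv_series a sigma alpha k x - deriv_series a sigma alpha k y)%C
        with (deriv_series a sigma alpha k x + - (1) * deriv_series a sigma alpha k y)%C by ring.
      apply is_lim_C_plus; [exact Hx|]. apply is_lim_C_scal, Hy. }
  apply (is_lim_C_Cmod_le _ _ (fun _ => Cmod (freq sigma) ^ k * ((K + 1) * M') * P) _ L).
  - exists 0%nat. intros N _. rewrite Cmod_mult, Cmod_pow, Rmult_assoc.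
    apply Rmult_le_compat_l; [apply pow_le, Cmod_ge_0|]. specialize (Bs N). lra.
  - apply is_lim_seq_const.
Qed.

(** * Comparison of the Hölder classes *)

Lemma locally'_intro (P : R -> Prop) x0 d : 0 < d ->
  (forall x, 0 < Rabs (x - x0) < d -> P x) -> locally' x0 P.
Proof.
  intros Hd H. exists (mkposreal d Hd). intros y Hy Hne. apply H. split; [|exact Hy].
  apply Rabs_pos_lt. lra.
Qed.

Lemma locally'_elim (P : R -> Prop) x0 : locally' x0 P ->
  exists d, 0 < d /\ forall x, 0 < Rabs (x - x0) < d -> P x.
Proof.
  intros [d H]. exists d. split; [apply cond_pos|]. intros x [H1 H2]. apply H; [exact H2|].
  intros ->. rewrite Rminus_diag, Rabs_R0 in H1. lra.
Qed.

Lemma C_on_C_restricted (U : R -> Prop) l r k s x0 (g : R -> C) :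
  l < x0 < r -> (forall x, l < x < r -> U x) -> (forall x : R, continuous g x) ->
  0 < s -> C_on k s U g -> C_restricted k s x0 g.
Proof.
  intros Hx HU Hg Hs [D [[HD0 HD] [[E _]|[_ [M HM]]]]]; [lra|].
  split; [exact Hg|]. exists l, r, D. split; [exact Hx|]. split; [|split].
  - split; intros; [apply HD0|apply HD]; auto.
  - intros x Hlr. apply continuous_C_eps. intros eps He.
    destruct (Rpower_small (Rabs M) s eps (Rabs_pos M) Hs He) as [d [Hd K]].
    exists (Rmin d (Rmin (x - l) (r - x))). split; [repeat apply Rmin_glb_lt; lra|].
    intros y Hy. destruct (Req_dec y x) as [->|Hne].
    + replace (D k x - D k x)%C with (RtoC 0) by ring. now rewrite Cmod_0.
    + pose proof (Rmin_l d (Rmin (x - l) (r - x))). pose proof (Rmin_r d (Rmin (x - l) (r - x))).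
      pose proof (Rmin_l (x - l) (r - x)). pose proof (Rmin_r (x - l) (r - x)).
      assert (Hyx : l < y < r) by (destruct (Rabs_def2 _ _ Hy); lra).
      eapply Rle_lt_trans; [apply HM; auto|].
      eapply Rle_lt_trans; [|apply (K (Rabs (y - x)))].
      * apply Rmult_le_compat_r; [left; apply Rpower_pos|apply Rle_abs].
      * split; [apply Rabs_pos_lt; lra|lra].
  - exists M. apply locally'_intro with (Rmin (x0 - l) (r - x0)); [apply Rmin_glb_lt; lra|].
    intros x [H1 H2].
    pose proof (Rmin_l (x0 - l) (r - x0)). pose proof (Rmin_r (x0 - l) (r - x0)).
    apply HM.
    + apply HU. destruct (Rabs_def2 _ _ H2); lra.
    + apply HU; lra.
    + intros ->. rewrite Rminus_diag, Rabs_R0 in H1. lra.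
Qed.

(** A class with [s = 0] at order [k + 1] is a Lipschitz class at order [k]:
    a continuous derivative is bounded near [x0]. *)
Lemma C_on_S_0_C_restricted (U : R -> Prop) l r k x0 (g : R -> C) :
  l < x0 < r -> (forall x, l < x < r -> U x) -> (forall x : R, continuous g x) ->
  C_on (S k) 0 U g -> C_restricted k 1 x0 g.
Proof.
  intros Hx HU Hg [D [[HD0 HD] [[_ Hc]|[E _]]]]; [|lra].
  split; [exact Hg|]. exists l, r, D. split; [exact Hx|]. split; [|split].
  - split; intros; [apply HD0|apply HD]; auto.
  - intros x Hlr. apply (derivC_continuous (D k) x (D (S k) x)). apply HD; [lia|auto].
  - destruct (proj2 (continuous_C_eps (D (S k)) x0) (Hc x0 (HU x0 Hx)) 1 ltac:(lra)) as [d [Hd K]].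
    exists (2 * (Cmod (D (S k) x0) + 1)).
    apply locally'_intro with (Rmin d (Rmin (x0 - l) (r - x0))); [repeat apply Rmin_glb_lt; lra|].
    intros x [H1 H2]. rewrite Rpower_1 by assumption.
    pose proof (Rmin_l d (Rmin (x0 - l) (r - x0))). pose proof (Rmin_r d (Rmin (x0 - l) (r - x0))).
    pose proof (Rmin_l (x0 - l) (r - x0)). pose proof (Rmin_r (x0 - l) (r - x0)).
    apply (mean_value_C (D k) (D (S k))). intros t Ht.
    assert (Ht' : Rabs (t - x0) < Rmin d (Rmin (x0 - l) (r - x0))) by lra.
    split.
    + apply HD; [lia|]. apply HU. destruct (Rabs_def2 _ _ Ht'); lra.
    + specialize (K t ltac:(lra)).
      replace (D (S k) t) with ((D (S k) t - D (S k) x0) + D (S k) x0)%C by ring.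
      eapply Rle_trans; [apply Cmod_triangle|]. lra.
Qed.

(** Induction on [k]: the Taylor remainder of [D 0] has the Taylor remainder of
    [D 1] as its derivative, and integrating gains one power of [|x - x0|].  The
    value of [p 0] is recorded since the derivative of the remainder must vanish
    at [x0], where the bound by a power says nothing. *)
Lemma Taylor_bound k : forall (D : nat -> R -> C) x0 d M s, 0 < d -> 0 <= M -> 0 < s ->
  (forall j, (j < k)%nat -> forall x, Rabs (x - x0) < d -> derivC (D j) x (D (S j) x)) ->
  (forall x, 0 < Rabs (x - x0) < d -> Cmod (D k x - D k x0) <= M * Rpower (Rabs (x - x0)) s) ->
  exists (p : nat -> C) M', 0 <= M' /\ p 0%nat = D 0%nat x0 /\
    forall x, 0 < Rabs (x - x0) < d ->
    Cmod (D 0%nat x - sum_n (fun j => (p j * Cpow (RtoC (x - x0)) j)%C) k)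
      <= M' * Rpower (Rabs (x - x0)) (INR k + s).
Proof.
  induction k; intros D x0 d M s Hd HM Hs HD Hk.
  - exists (fun _ => D 0%nat x0), M. split; [assumption|]. split; [reflexivity|].
    intros x Hx. rewrite sum_O. simpl. rewrite Rplus_0_l, Cmult_1_r. auto.
  - destruct (IHk (fun j => D (S j)) x0 d M s Hd HM Hs) as (p & M' & HM' & Hp0 & Hp).
    { intros j Hj x Hx. apply HD; [lia|assumption]. }
    { exact Hk. }
    (* The Taylor coefficients of [D 0]: those of [D 1] divided by the new index. *)
    set (p' := fun j => match j with O => D 0%nat x0 | S j => (RtoC (/ INR (S j)) * p j)%C end).
    exists p', (2 * M'). split; [lra|]. split; [reflexivity|].
    intros x Hx.
    set (H := fun t => (D 0%nat t - sum_n (fun j => (p' j * Cpow (RtoC (t - x0)) j)%C) (S k))%C).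
    set (H' := fun t => (D 1%nat t - sum_n (fun j => (p j * Cpow (RtoC (t - x0)) j)%C) k)%C).
    assert (H0 : forall q : nat -> C, forall n, sum_n (fun j => (q j * Cpow (RtoC (x0 - x0)) j)%C) n = q 0%nat :> C).
    { intros q n. rewrite Rminus_diag. induction n as [|n IHn]; [rewrite sum_O; simpl; Cring|].
      rewrite sum_n_S_C, IHn. cbn [Cpow]. Cring. }
    assert (Hx0 : H x0 = RtoC 0).
    { unfold H. rewrite (H0 p'). simpl. ring. }
    assert (A : Cmod (H x - H x0) <= 2 * (M' * Rpower (Rabs (x - x0)) (INR k + s)) * Rabs (x - x0)).
    { apply (mean_value_C H H'). intros t Ht. split.
      - unfold H, H', Cminus. apply derivC_Cplus; [apply HD; [lia|lra]|].
        assert (S1 : derivC (fun t => sum_n (fun j => (p' j * Cpow (RtoC (t - x0)) j)%C) (S k)) t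
             (sum_n (fun j => (p j * Cpow (RtoC (t - x0)) j)%C) k)).
        { apply (is_derive_ext (V := C_R_NormedModule)
            (fun t => (p' 0%nat + sum_n (fun j => (p' (S j) * Cpow (RtoC (t - x0)) (S j))%C) k)%C)).
          { intros u. rewrite sum_n_head. change (Cpow (RtoC (u - x0)) 0) with (RtoC 1). Cring. }
          evar_last.
          - apply derivC_Cplus; [apply derivC_const|].
            apply (derivC_sum (fun j t => (p' (S j) * Cpow (RtoC (t - x0)) (S j))%C)
               (fun j t => (p' (S j) * (RtoC (INR (S j)) * Cpow (RtoC (t - x0)) j * 1))%C)).
            intros j. apply derivC_Cmult_l, (derivC_pow (fun t => RtoC (t - x0))).
            apply derivC_components. simpl. split; auto_derive; auto; ring.
          - transitivity (sum_n (fun j => (p' (S j) * (RtoC (INR (S j)) * Cpow (RtoC (t - x0)) j * 1))%C) k : C); [Cring|].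
            apply sum_n_ext. intros j. unfold p'.
            assert (I : (RtoC (/ INR (S j)) * RtoC (INR (S j)) = 1)%C).
            { rewrite <- RtoC_mult, Rinv_l by (apply not_0_INR; lia). reflexivity. }
            transitivity (RtoC (/ INR (S j)) * RtoC (INR (S j)) * (p j * Cpow (RtoC (t - x0)) j))%C; [Cring|].
            rewrite I. Cring. }
        evar_last.
        + apply (is_derive_opp (V := C_R_NormedModule)), S1.
        + reflexivity.
      - destruct (Req_dec t x0) as [->|Hne].
        + unfold H'. rewrite H0, Hp0.
          replace (D 1%nat x0 - D 1%nat x0)%C with (RtoC 0) by ring. rewrite Cmod_0.
          apply Rmult_le_pos; [assumption|left; apply Rpower_pos].
        + assert (0 < Rabs (t - x0)) by (apply Rabs_pos_lt; lra).
          eapply Rle_trans; [apply Hp; lra|]. apply Rmult_le_compat_l; [assumption|].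
          apply Rle_Rpower_l; [|lra]. generalize (pos_INR k); lra. }
    rewrite Hx0 in A. replace (H x - 0)%C with (H x) in A by ring.
    eapply Rle_trans; [exact A|]. rewrite S_INR.
    replace (INR k + 1 + s) with (INR k + s + 1) by ring.
    rewrite (Rpower_plus (INR k + s) 1), Rpower_1 by lra. right; ring.
Qed.

Lemma C_restricted_pointwise k s x0 g : 0 < s -> C_restricted k s x0 g -> C_pointwise (INR k + s) x0 g.
Proof.
  intros Hs [Hg (l & r & D & Hx & [HD0 HD] & _ & [M HM])].
  split; [exact Hg|]. apply locally'_elim in HM as [d0 [Hd0 HM]].
  set (d := Rmin d0 (Rmin (x0 - l) (r - x0))).
  assert (Hd : 0 < d) by (unfold d; repeat apply Rmin_glb_lt; lra).
  assert (d <= d0) by apply Rmin_l.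
  assert (Hin : forall x, Rabs (x - x0) < d -> l < x < r).
  { intros x H1. pose proof (Rmin_r d0 (Rmin (x0 - l) (r - x0))).
    pose proof (Rmin_l (x0 - l) (r - x0)). pose proof (Rmin_r (x0 - l) (r - x0)).
    fold d in H0. destruct (Rabs_def2 _ _ H1); lra. }
  destruct (Taylor_bound k D x0 d (Rabs M) s Hd (Rabs_pos M) Hs) as (p & M' & _ & _ & Hp).
  - intros j Hj x Hxd. apply HD; auto.
  - intros x Hxd. eapply Rle_trans; [apply HM; lra|].
    apply Rmult_le_compat_r; [left; apply Rpower_pos|apply Rle_abs].
  - exists k, p. split; [lra|]. exists M'. apply locally'_intro with d; [assumption|].
    intros x Hxd. rewrite <- HD0 by (apply Hin; lra). now apply Hp.
Qed.

Lemma Lub_Rbar_of_interval (E : R -> Prop) L : 0 < L ->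
  (forall t, E t -> t <= L) -> (forall t, 0 < t < L -> E t) -> Lub_Rbar E = Finite L.
Proof.
  intros HL Hub Hd. apply is_lub_Rbar_unique. split.
  - intros t Ht. apply Hub, Ht.
  - intros b Hb. destruct b as [b| |]; simpl; auto.
    + apply Rnot_lt_le. intros Hlt.
      set (t := (Rmax b 0 + L) / 2). pose proof (Rmax_l b 0). pose proof (Rmax_r b 0).
      assert (Rmax b 0 < L) by (apply Rmax_lub_lt; assumption).
      specialize (Hb t (Hd t ltac:(unfold t; lra))). simpl in Hb. unfold t in Hb. lra.
    + apply (Hb (L / 2)), Hd. lra.
Qed.

(** * The series f_alpha and the extension f *)

Definition pos_part (a : Z -> C) (n : nat) : C := a (Z.of_nat (S n)).

Definition neg_part (a : Z -> C) (n : nat) : C := a (- Z.of_nat (S n))%Z.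

Lemma IZR_S n : IZR (Z.of_nat (S n)) = INR (S n).
Proof. symmetry. apply INR_IZR_INZ. Qed.

Lemma IZR_opp_S n : IZR (- Z.of_nat (S n)) = - INR (S n).
Proof. now rewrite opp_IZR, IZR_S. Qed.

Lemma Rabs_INR_S n : Rabs (INR (S n)) = INR (S n).
Proof. apply Rabs_pos_eq, pos_INR. Qed.

(** The sums of the hypothesis include the index [0], the series [f_alpha] does
    not. *)
Lemma partial_sums_without_zero (u : nat -> C) tau M N : 0 <= tau -> 0 <= M ->
  (forall N, (1 <= N)%nat -> Cmod (sum_n u N) <= M * Rpower (INR N) tau) ->
  Cmod (sum_n (fun n => u (S n)) N) <= (M + Cmod (u 0%nat)) * Rpower (INR (S N)) tau.
Proof.
  intros Ht HM H. specialize (H (S N) ltac:(lia)). rewrite sum_n_head in H.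
  replace (sum_n (fun n => u (S n)) N : C)
    with ((u 0%nat + sum_n (fun n => u (S n)) N) - u 0%nat)%C by ring.
  eapply Rle_trans; [apply Cmod_minus_triangle|]. rewrite Rmult_plus_distr_r.
  apply Rplus_le_compat; [exact H|].
  rewrite <- (Rmult_1_r (Cmod (u 0%nat))) at 1. apply Rmult_le_compat_l; [apply Cmod_ge_0|].
  apply Rpower_ge_1; [apply INR_S_ge_1|assumption].
Qed.

Lemma pos_part_growth a tau : 0 <= tau -> unif_bigO_power (partial_sum_pos a) tau ->
  exists M, unif_growth (pos_part a) 1 tau M.
Proof.
  intros Ht [M HM]. exists (Rabs M + Cmod (a 0%Z)). intros x N.
  replace (Cmod (a 0%Z)) with (Cmod (a (Z.of_nat 0) * e (IZR (Z.of_nat 0) * x))%C)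
    by (rewrite Cmod_mult, Cmod_e; apply Rmult_1_r).
  rewrite (sum_n_ext _ (fun n => a (Z.of_nat (S n)) * e (IZR (Z.of_nat (S n)) * x))%C).
  - apply (partial_sums_without_zero (fun n => a (Z.of_nat n) * e (IZR (Z.of_nat n) * x))%C);
      [assumption|apply Rabs_pos|].
    intros n Hn. eapply Rle_trans; [apply (HM x n Hn)|].
    apply Rmult_le_compat_r; [left; apply Rpower_pos|apply Rle_abs].
  - intros n. unfold exp_term, pos_part. rewrite IZR_S, Rmult_1_l. reflexivity.
Qed.

Lemma neg_part_growth a tau : 0 <= tau -> unif_bigO_power (partial_sum_neg a) tau ->
  exists M, unif_growth (neg_part a) (-1) tau M.
Proof.
  intros Ht [M HM]. exists (Rabs M + Cmod (a 0%Z)). intros x N.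
  replace (Cmod (a 0%Z)) with (Cmod (a (- Z.of_nat 0)%Z * e (IZR (- Z.of_nat 0) * x))%C)
    by (rewrite Cmod_mult, Cmod_e; apply Rmult_1_r).
  rewrite (sum_n_ext _ (fun n => a (- Z.of_nat (S n))%Z * e (IZR (- Z.of_nat (S n)) * x))%C).
  - apply (partial_sums_without_zero (fun n => a (- Z.of_nat n)%Z * e (IZR (- Z.of_nat n) * x))%C);
      [assumption|apply Rabs_pos|].
    intros n Hn. eapply Rle_trans; [apply (HM x n Hn)|].
    apply Rmult_le_compat_r; [left; apply Rpower_pos|apply Rle_abs].
  - intros n. unfold exp_term, neg_part. rewrite IZR_opp_S.
    replace (-1 * INR (S n) * x) with (- INR (S n) * x) by ring. reflexivity.
Qed.

(** The Fourier coefficients of [t -> f_alpha (x0 + t)] at the frequencies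
    [n + 1]; those at [-(n + 1)] are [coef_neg]. *)
Definition coef_pos a alpha x0 n : C := f_alpha_term a alpha x0 (Z.of_nat (S n)).

Definition coef_neg a alpha x0 n : C := f_alpha_term a alpha x0 (- Z.of_nat (S n)).

Lemma f_alpha_term_pos a alpha x n :
  f_alpha_term a alpha x (Z.of_nat (S n)) =
  (pos_part a n * RtoC (Rpower (INR (S n)) (- alpha)) * e (INR (S n) * x))%C.
Proof.
  unfold f_alpha_term. destruct (Z.eq_dec (Z.of_nat (S n)) 0) as [E|_]; [lia|].
  rewrite IZR_S, Rabs_INR_S. unfold Cdiv. rewrite Rpower_Ropp, RtoC_inv; [reflexivity|].
  generalize (Rpower_pos (INR (S n)) alpha); lra.
Qed.

Lemma f_alpha_term_neg a alpha x n :
  f_alpha_term a alpha x (- Z.of_nat (S n)) =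
  (neg_part a n * RtoC (Rpower (INR (S n)) (- alpha)) * e (- INR (S n) * x))%C.
Proof.
  unfold f_alpha_term. destruct (Z.eq_dec (- Z.of_nat (S n)) 0) as [E|_]; [lia|].
  rewrite IZR_opp_S, Rabs_Ropp, Rabs_INR_S. unfold Cdiv. rewrite Rpower_Ropp, RtoC_inv; [reflexivity|].
  generalize (Rpower_pos (INR (S n)) alpha); lra.
Qed.

Lemma coef_summable a alpha x0 : ZSeries_abs_cv (f_alpha_term a alpha x0) ->
  ex_series (fun n => Cmod (coef_pos a alpha x0 n)) /\
  ex_series (fun n => Cmod (coef_neg a alpha x0 n)).
Proof.
  intros [H1 H2]. split; [|exact H2].
  apply (ex_series_incr_1 (V := R_NormedModule) (fun n => Cmod (f_alpha_term a alpha x0 (Z.of_nat n)))), H1.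
Qed.

Lemma f_alpha_fourier a alpha x0 t :
  ZSeries_abs_cv (f_alpha_term a alpha x0) ->
  f_alpha a alpha (x0 + t) = fourier (coef_pos a alpha x0) (coef_neg a alpha x0) t.
Proof.
  intros H. apply coef_summable in H as [H1 H2].
  assert (Ep : forall n, f_alpha_term a alpha (x0 + t) (Z.of_nat (S n))
       = (coef_pos a alpha x0 n * e (INR (S n) * t))%C).
  { intros n. unfold coef_pos. rewrite !f_alpha_term_pos, Rmult_plus_distr_l, e_plus. ring. }
  assert (Em : forall n, f_alpha_term a alpha (x0 + t) (- Z.of_nat (S n))
       = (coef_neg a alpha x0 n * e (- INR (S n) * t))%C).
  { intros n. unfold coef_neg. rewrite !f_alpha_term_neg, Rmult_plus_distr_l, e_plus. ring. }
  unfold f_alpha, ZSeries, fourier. f_equal.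
  - rewrite (CSeries_head _ (CSeries (fun n => coef_pos a alpha x0 n * e (INR (S n) * t))%C)).
    + unfold f_alpha_term at 1. simpl. ring.
    + apply is_lim_C_ext with (sum_n (fun n => coef_pos a alpha x0 n * e (INR (S n) * t))%C).
      { intros n. apply sum_n_ext. intros k. symmetry. apply Ep. }
      apply (CSeries_dominated _ (fun n => Cmod (coef_pos a alpha x0 n))); [|assumption].
      intros k. rewrite Cmod_mult, Cmod_e. lra.
  - apply CSeries_correct.
    apply is_lim_C_ext with (sum_n (fun n => coef_neg a alpha x0 n * e (- INR (S n) * t))%C).
    { intros n. apply sum_n_ext. intros k. symmetry. apply Em. }
    apply (CSeries_dominated _ (fun n => Cmod (coef_neg a alpha x0 n))); [|assumption].
    intros k. rewrite Cmod_mult, Cmod_e. lra.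
Qed.

Lemma f_alpha_continuous a alpha :
  (forall x, ZSeries_abs_cv (f_alpha_term a alpha x)) -> forall x : R, continuous (f_alpha a alpha) x.
Proof.
  intros H x. destruct (coef_summable a alpha 0 (H 0)) as [H1 H2].
  apply continuous_ext with (fourier (coef_pos a alpha 0) (coef_neg a alpha 0)).
  - intros t. rewrite <- f_alpha_fourier by apply H. f_equal. ring.
  - now apply fourier_continuous.
Qed.

Lemma deriv_term_0 a sigma alpha x n :
  deriv_term a sigma alpha 0 x n = (a n * RtoC (Rpower (INR (S n)) (- alpha)) * e (sigma * INR (S n) * x))%C.
Proof. unfold deriv_term, exp_term. simpl INR at 3. rewrite Rminus_0_r. cbn [Cpow]. ring. Qed.

Lemma f_alpha_deriv_series a alpha tau M1 M2 x :
  unif_growth (pos_part a) 1 tau M1 -> unif_growth (neg_part a) (-1) tau M2 ->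
  0 <= tau < alpha ->
  f_alpha a alpha x = (deriv_series (pos_part a) 1 alpha 0 x + deriv_series (neg_part a) (-1) alpha 0 x)%C.
Proof.
  intros H1 H2 Ht.
  destruct (deriv_series_uniform _ _ alpha _ _ 0 H1) as [b1 [_ K1]]; [lra|simpl; lra|].
  destruct (deriv_series_uniform _ _ alpha _ _ 0 H2) as [b2 [_ K2]]; [lra|simpl; lra|].
  destruct (K1 x) as [L1 _]. destruct (K2 x) as [L2 _].
  unfold f_alpha, ZSeries. f_equal.
  - rewrite (CSeries_head _ (deriv_series (pos_part a) 1 alpha 0 x)).
    + unfold f_alpha_term at 1. simpl. ring.
    + revert L1. apply is_lim_C_ext. intros n. apply sum_n_ext. intros k.
      rewrite f_alpha_term_pos, deriv_term_0, Rmult_1_l. reflexivity.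
  - apply CSeries_correct. revert L2. apply is_lim_C_ext. intros n. apply sum_n_ext. intros k.
    rewrite f_alpha_term_neg, deriv_term_0.
    replace (-1 * INR (S k) * x) with (- INR (S k) * x) by ring. reflexivity.
Qed.

(** The loss [eps] is chosen so that [gamma + eps + k + theta < alpha]. *)
Lemma C_on_f_alpha a gamma alpha k theta (U : R -> Prop) : 0 < gamma ->
  (forall eps : R, 0 < eps ->
       unif_bigO_power (partial_sum_pos a) (gamma + eps) /\
       unif_bigO_power (partial_sum_neg a) (gamma + eps)) ->
  0 < theta <= 1 -> INR k + theta < alpha - gamma ->
  C_on k theta U (f_alpha a alpha).
Proof.
  intros Hg HO Hth Hk. set (eps := (alpha - gamma - (INR k + theta)) / 2).
  assert (He : 0 < eps) by (unfold eps; lra).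
  destruct (HO eps He) as [O1 O2]. pose proof (pos_INR k) as Pk.
  destruct (pos_part_growth a (gamma + eps) ltac:(lra) O1) as [M1 G1].
  destruct (neg_part_growth a (gamma + eps) ltac:(lra) O2) as [M2 G2].
  assert (Hlt : gamma + eps + theta + INR k < alpha) by (unfold eps; lra).
  exists (fun j x => (deriv_series (pos_part a) 1 alpha j x + deriv_series (neg_part a) (-1) alpha j x)%C).
  split; [split|right; split; [lra|]].
  - intros x _. symmetry. apply (f_alpha_deriv_series a alpha (gamma + eps) M1 M2); auto; lra.
  - intros j Hj x _. assert (Hj' : INR (S j) <= INR k) by (apply le_INR; lia).
    apply derivC_Cplus; eapply deriv_series_derive; eauto; lra.
  - destruct (deriv_series_holder _ _ alpha _ _ k theta G1) as [B1 K1]; [lra|lra|lra|].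
    destruct (deriv_series_holder _ _ alpha _ _ k theta G2) as [B2 K2]; [lra|lra|lra|].
    exists (B1 + B2). intros x y _ _ Hxy. specialize (K1 x y Hxy). specialize (K2 x y Hxy).
    match goal with |- Cmod (?p + ?q - (?u + ?v)) <= _ =>
      replace (p + q - (u + v))%C with ((p - u) + (q - v))%C by ring end.
    eapply Rle_trans; [apply Cmod_triangle|]. lra.
Qed.

(** The weights [n^alpha] of the Poisson means undo the weights [n^(-alpha)] of
    [f_alpha]. *)
Lemma f_ext_poisson a alpha x0 y : ZSeries_abs_cv (f_alpha_term a alpha x0) -> 0 < alpha -> 0 < y ->
  f_ext a (x0, y) =
  (a 0%Z + CSeries (fun n => RtoC (poisson_weight alpha y n) * coef_pos a alpha x0 n)
    + CSeries (fun n => RtoC (poisson_weight alpha y n) * coef_neg a alpha x0 n))%C.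
Proof.
  intros H Ha Hy. apply coef_summable in H as [H1 H2].
  assert (W : forall n, (RtoC (poisson_weight alpha y n) * RtoC (Rpower (INR (S n)) (- alpha))
     = RtoC (exp (- 2 * PI * INR (S n) * y)))%C).
  { intros n. rewrite <- RtoC_mult. f_equal. unfold poisson_weight.
    assert (I : Rpower (INR (S n)) alpha * Rpower (INR (S n)) (- alpha) = 1).
    { rewrite <- Rpower_plus, Rplus_opp_r. apply Rpower_O, lt_0_INR; lia. }
    transitivity (Rpower (INR (S n)) alpha * Rpower (INR (S n)) (- alpha) * exp (- (2 * PI * y) * INR (S n))); [ring|].
    rewrite I, Rmult_1_l. f_equal. ring. }
  unfold f_ext, ZSeries. cbn [Re Im fst snd]. f_equal.
  - erewrite CSeries_head.
    + f_equal. cbn [Z.of_nat]. rewrite Rabs_R0, Rmult_0_r, !Rmult_0_l, exp_0, e_0. ring.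
    + apply is_lim_C_ext with (2 := poisson_summable _ alpha y H1 Ha Hy).
      intros n. apply sum_n_ext. intros k. unfold coef_pos.
      rewrite f_alpha_term_pos, IZR_S, Rabs_INR_S, <- W. unfold pos_part. Cring.
  - apply CSeries_correct. apply is_lim_C_ext with (2 := poisson_summable _ alpha y H2 Ha Hy).
    intros n. apply sum_n_ext. intros k. unfold coef_neg.
    rewrite f_alpha_term_neg, IZR_opp_S, Rabs_Ropp, Rabs_INR_S, <- W. unfold neg_part. Cring.
Qed.

(** If [s > alpha - gamma] then the Poisson means at [x0] over positive and over
    negative frequencies are both [O(y^(s' - alpha))] for some [s'] between
    [alpha - gamma] and [min(s, alpha)], and [s' - alpha > - gamma]. *)
Lemma C_pointwise_f_alpha_le a gamma alpha x0 s :
  0 < gamma -> gamma < alpha -> ZSeries_abs_cv (f_alpha_term a alpha x0) ->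
  ~ @is_domin R R_AbsRing C_AbsRing R_NormedModule C_NormedModule
        (at_right 0) (fun y => Rpower y (- gamma)) (fun y => f_ext a (x0, y)) ->
  C_pointwise s x0 (f_alpha a alpha) -> s <= alpha - gamma.
Proof.
  intros Hg Ha Hcv Hnd [_ (d & p & _ & M & HM)]. apply Rnot_lt_le. intros Hs. apply Hnd.
  set (s' := (alpha - gamma + Rmin s alpha) / 2).
  assert (S1 : alpha - gamma < Rmin s alpha) by (apply Rmin_glb_lt; lra).
  pose proof (Rmin_l s alpha). pose proof (Rmin_r s alpha).
  assert (Hs' : alpha - gamma < s' < alpha /\ s' <= s) by (unfold s'; lra).
  destruct (coef_summable a alpha x0 Hcv) as [H1 H2].
  apply locally'_elim in HM as [dl [Hdl HM]].
  set (delta := Rmin dl 1). assert (Hde : 0 < delta) by (apply Rmin_glb_lt; lra).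
  pose proof (Rmin_l dl 1) as D1. pose proof (Rmin_r dl 1) as D2. fold delta in D1, D2.
  set (bp := coef_pos a alpha x0) in *. set (bm := coef_neg a alpha x0) in *.
  assert (B1 : forall t, 0 < Rabs t < delta ->
    Cmod (fourier bp bm t - sum_n (fun j => (p j * Cpow (RtoC t) j)%C) d) <= Rabs M * Rpower (Rabs t) s').
  { intros t Ht. specialize (HM (x0 + t)). replace (x0 + t - x0) with t in HM by ring.
    specialize (HM ltac:(lra)). rewrite f_alpha_fourier in HM by assumption. fold bp bm in HM.
    eapply Rle_trans; [exact HM|].
    apply Rle_trans with (Rabs M * Rpower (Rabs t) s).
    - apply Rmult_le_compat_r; [left; apply Rpower_pos|apply Rle_abs].
    - apply Rmult_le_compat_l; [apply Rabs_pos|]. apply Rpower_antitone_exponent; lra. }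
  destruct (poisson_mean_bound bp bm alpha s' (Rabs M) delta d p) as [K1 [HK1 L1]]; try assumption; [lra|].
  (* Negative frequencies: reflect [t], which changes the sign of the odd coefficients of the polynomial. *)
  destruct (poisson_mean_bound bm bp alpha s' (Rabs M) delta d (fun j => p j * Cpow (RtoC (-1)) j)%C)
    as [K2 [HK2 L2]]; try assumption; [lra| |].
  { intros t Ht. rewrite fourier_opp, <- (Rabs_Ropp t).
    rewrite (sum_n_ext _ (fun j => (p j * Cpow (RtoC (- t)) j)%C)).
    - apply B1. now rewrite Rabs_Ropp.
    - intros j. replace (- t) with (-1 * t) by ring. rewrite RtoC_mult, Cpow_mult_l. Cring. }
  intros eps. set (mu := s' - alpha + gamma). assert (Hmu : 0 < mu) by (unfold mu; lra).
  set (G := Cmod (a 0%Z) + K1 + K2).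
  assert (HG : 0 <= G) by (unfold G; generalize (Cmod_ge_0 (a 0%Z)); lra).
  destruct (Rpower_small G mu eps HG Hmu (cond_pos eps)) as [d0 [Hd0 Hsm]].
  exists (mkposreal (Rmin d0 1) (Rmin_glb_lt _ _ _ Hd0 Rlt_0_1)). intros y Hb Hy.
  assert (Hy1 : y < Rmin d0 1).
  { assert (X : Rabs (y - 0) < Rmin d0 1) by exact Hb.
    rewrite Rminus_0_r, Rabs_pos_eq in X by lra. exact X. }
  pose proof (Rmin_l d0 1). pose proof (Rmin_r d0 1).
  change (Cmod (f_ext a (x0, y)) <= eps * Rabs (Rpower y (- gamma))).
  rewrite (Rabs_pos_eq (Rpower y (- gamma))) by (left; apply Rpower_pos).
  rewrite (f_ext_poisson a alpha) by (assumption || lra). fold bp bm.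
  specialize (L1 y ltac:(lra)). specialize (L2 y ltac:(lra)).
  apply Rle_trans with (G * Rpower y (s' - alpha)).
  - eapply Rle_trans; [apply Cmod_triangle|].
    eapply Rle_trans; [apply Rplus_le_compat_r, Cmod_triangle|].
    assert (1 <= Rpower y (s' - alpha)).
    { rewrite <- (Rpower_1_l (s' - alpha)). apply Rle_Rpower_neg; lra. }
    assert (Cmod (a 0%Z) <= Cmod (a 0%Z) * Rpower y (s' - alpha)).
    { rewrite <- (Rmult_1_r (Cmod (a 0%Z))) at 1. apply Rmult_le_compat_l; [apply Cmod_ge_0|assumption]. }
    unfold G. rewrite !Rmult_plus_distr_r. lra.
  - replace (s' - alpha) with (mu + - gamma) by (unfold mu; ring). rewrite Rpower_plus, <- Rmult_assoc.
    apply Rmult_le_compat_r; [left; apply Rpower_pos|]. left. apply Hsm. lra.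
Qed.

(** * The Hölder exponents *)

Lemma Rbar_interval_neighborhood l r x0 : Rbar_interval l r x0 ->
  exists l' r' : R, l' < x0 < r' /\ forall x, l' < x < r' -> Rbar_interval l r x.
Proof.
  intros [Hl Hr].
  assert (L : exists l' : R, l' < x0 /\ forall x : R, l' < x -> Rbar_lt l x).
  { destruct l as [l| |]; simpl in Hl; [exists l; auto|contradiction|exists (x0 - 1); split; [lra|auto]]. }
  assert (Rr : exists r' : R, x0 < r' /\ forall x : R, x < r' -> Rbar_lt x r).
  { destruct r as [r| |]; simpl in Hr; [exists r; auto|exists (x0 + 1); split; [lra|simpl; auto]|contradiction]. }
  destruct L as [l' [L1 L2]], Rr as [r' [R1 R2]]. exists l', r'. split; [lra|].
  intros x Hx. split; [apply L2|apply R2]; lra.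
Qed.

(** Every positive number is admissible as [k + s] with [0 < s <= 1], so that
    [k] is its ceiling minus one. *)
Lemma split_exponent t : 0 < t -> exists k theta, 0 < theta <= 1 /\ t = INR k + theta.
Proof.
  intros Ht. destruct (nfloor1_ex t Ht) as [n Hn]. exists n, (t - INR n). split; lra.
Qed.

Theorem theorem2p1 :
  forall (a : Z -> C) (gamma alpha x0 : R),
    polynomial_growth a ->
    0 < gamma ->
    (forall eps : R, 0 < eps ->
       unif_bigO_power (partial_sum_pos a) (gamma + eps) /\
       unif_bigO_power (partial_sum_neg a) (gamma + eps)) ->
    gamma < alpha ->
    (forall x : R, ZSeries_abs_cv (f_alpha_term a alpha x)) ->
    ~ @is_domin R R_AbsRing C_AbsRing R_NormedModule C_NormedModule
        (at_right 0)
        (fun y => Rpower y (- gamma))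
        (fun y => f_ext a (x0, y)) ->
    holder_exponent (f_alpha a alpha) x0 = Finite (alpha - gamma) /\
    restricted_holder_exponent (f_alpha a alpha) x0 = Finite (alpha - gamma) /\
    is_local_holder_exponent (f_alpha a alpha) x0 (Finite (alpha - gamma)).
Proof.
  intros a gamma alpha x0 _ Hg HO Ha Hcv Hnd.
  assert (Hpos : 0 < alpha - gamma) by lra.
  pose proof (f_alpha_continuous a alpha Hcv) as Cont.
  assert (Upper : forall s, C_pointwise s x0 (f_alpha a alpha) -> s <= alpha - gamma)
    by (intros s; now apply C_pointwise_f_alpha_le).
  assert (UpperR : forall k s, 0 < s -> C_restricted k s x0 (f_alpha a alpha) -> INR k + s <= alpha - gamma)
    by (intros k s Hs H; now apply Upper, C_restricted_pointwise).
  assert (LowerR : forall k s, 0 < s <= 1 -> INR k + s < alpha - gamma -> C_restricted k s x0 (f_alpha a alpha)).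
  { intros k s Hs Hk. apply (C_on_C_restricted (fun _ => True) (x0 - 1) (x0 + 1)); auto; try lra.
    now apply C_on_f_alpha with gamma. }
  split; [|split].
  - apply Lub_Rbar_of_interval; [assumption| |].
    + intros t [_ H]. now apply Upper.
    + intros t Ht. split; [lra|]. destruct (split_exponent t ltac:(lra)) as (k & th & Hth & ->).
      apply C_restricted_pointwise; [lra|]. apply LowerR; [assumption|lra].
  - apply Lub_Rbar_of_interval; [assumption| |].
    + intros t (k & s & Hs & H & ->). apply UpperR; [lra|assumption].
    + intros t Ht. destruct (split_exponent t ltac:(lra)) as (k & th & Hth & E).
      exists k, th. split; [assumption|]. split; [|assumption]. apply LowerR; [assumption|lra].
  - intros I (HI & _ & HI0).
    assert (E : forall n, holder_exponent_on (I n) (f_alpha a alpha) = Finite (alpha - gamma)).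
    { intros n. destruct (HI n) as (l & r & Hlr).
      destruct (Rbar_interval_neighborhood l r x0) as (l' & r' & Hx & Hin).
      { apply Hlr. now apply HI0. }
      assert (Hin' : forall x, l' < x < r' -> I n x) by (intros; now apply Hlr, Hin).
      apply Lub_Rbar_of_interval; [assumption| |].
      - intros t (k & s & Hs & H & ->). destruct (Req_dec s 0) as [->|Hs0].
        + destruct k as [|k]; [simpl; lra|]. rewrite S_INR, Rplus_0_r.
          apply UpperR; [lra|]. now apply (C_on_S_0_C_restricted (I n) l' r').
        + apply UpperR; [lra|]. apply (C_on_C_restricted (I n) l' r'); auto; lra.
      - intros t Ht. destruct (split_exponent t ltac:(lra)) as (k & th & Hth & Et).
        exists k, th. split; [lra|]. split; [|assumption].
        apply C_on_f_alpha with gamma; auto; lra. }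
    split; intros r Hr; exists 0%nat; intros n _; now rewrite E.
Qed.
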